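(* Let $X$ be a projective scheme over $\mathbb Z$. Let $\overline{\mathcal L}=(\mathbb V_X(\mathcal L),T)$ be a semipositive seminormed line bundle over $X$, very ample over $\mathbb Z$. Let $i:Y\to X$ be a hyperplane section with respect to $\mathcal L$. Let $(D_YX,\overline{\mathcal L'})$, $\overline{\mathcal L'}=(\mathbb V_{D_YX}(\mathcal L'),T')$, be the deformation to the projective completion of the cone associated to $(X,Y,\overline{\mathcal L})$. Then the fiber over $1$ of $(D_YX,\overline{\mathcal L'})$ is $(X,\overline{\mathcal L})$; that is, under the identification of the fiber of $(D_YX,\mathcal L')$ over $1\in\mathbb P^1_{\mathbb Z}$ with $(X,\mathcal L)$, one has $T'\cap\mathbb V_{D_YX}(\mathcal L')_{|1}(\mathbb C)=T$.
   Context: **Seminormed line bundles and tubes.** Let $X$ be a projective scheme over $\mathbb Z$. A seminormed line bundle $\overline{\mathcal L}=(\mathcal L,|\cdot|)$ on $X$ is a line bundle $\mathcal L$ with a seminorm $|\cdot|_x$ on each complex line $\mathcal L_{|x}$ ($x\in X(\mathbb C)$), invariant under complex conjugation, such that for every open $U$ of the analytic space $X_{\mathbb C}$ and $s\in H^0(U,\mathcal L)$ the function $x\mapsto |s(x)|_x$ is upper semicontinuous. Put $\mathbb V_X(\mathcal L)=\mathrm{Spec}_X\bigoplus_{n\ge0}\mathcal L^{\otimes n}$ (total space of $\mathcal L^\vee$); its complex points are pairs $(x,\varphi)$, $x\in X(\mathbb C)$, $\varphi\in\mathcal L^\vee_{|x}$. The analytic tube of $\overline{\mathcal L}$ is the compact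 set $T=\{(x,\varphi): |\varphi|_x\le 1\}$, $|\varphi|_x$ the dual (possibly infinite) norm. Giving a seminorm is equivalent to giving a compact $T\subset\mathbb V_X(\mathcal L)(\mathbb C)$ containing the zero section, stable under fiberwise multiplication by $\lambda$, $|\lambda|\le1$, and under complex conjugation; one writes $\overline{\mathcal L}=(\mathbb V_X(\mathcal L),T)$. $\overline{\mathcal L}$ is *semipositive* if $\mathcal L$ is ample over $\mathbb Z$ and $T$ is holomorphically convex in $\mathbb V_X(\mathcal L)(\mathbb C)$, i.e. equal to its holomorphically convex hull $\widehat T=\{z:|f(z)|\le\sup_T|f|\text{ for all holomorphic }f\text{ on }\mathbb V_X(\mathcal L)(\mathbb C)\}$. **Deformation.** Let $\mathcal L$ be very ample over $\mathbb Z$, $S_\bullet=\bigoplus_{n\ge0} H^0(X,\mathcal L^{\otimes n})$. A closed immersion $i:Y\to X$ is a *hyperplane section with respect to $\mathcal L$* if the graded ideal $I_\bullet\subset S_\bullet$ associated to $i$ is generated in degree 1. Write $\mathbb P^1=\mathrm{Proj}\,\mathbb Z[u,t]$, $0=\{u=0\}$, $\infty=\{t=0\}$, $1=[1:1]$. $D_YX\to\mathbb P^1$ is obtained by gluing $X\times\mathrm{Spec}\,\mathbb Z[u/t]$ over $\{u\ne\infty\}$ with $\mathrm{Proj}\,S'_\bullet$ over $\{u\neq0\}$, where $S'_\bullet=\bigoplus_{l\in\mathbb Z}I_\bullet^l(t/u)^{-l}$ ($I_\bullet^l=S_\bullet$ for $l\le0$; grading induced from $S_\bullet$), via the canonical identification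 of both with $X\times(\mathbb A^1-\{0\})$ over $\{u\ne0,\infty\}$. Let $t_1,\dots,t_M\in H^0(X,\mathcal L)$ generate $I_\bullet$ and $s_0,\dots,s_N\in H^0(X,\mathcal L)$ induce a closed immersion $X\to\mathbb P^N$. The map $(x,u)\mapsto([s_0(x):\dots:s_N(x):ut_1(x):\dots:ut_M(x)],[u:1])$ from $X\times\mathbb A^1$ to $\mathbb P^{N+M}\times\mathbb P^1$ extends to $D_YX$, and $\mathcal L'$ is the pullback to $D_YX$ of $\mathcal O(1)\boxtimes\mathcal O(1)$ (independent of choices, ample over $\mathbb Z$, with fiber over $1$ equal to $(X,\mathcal L)$). The *natural transverse action* of $\mathbb G_m$ on $D_YX$ and $\mathbb V_{D_YX}(\mathcal L')$ is induced by $([x_0:\dots:x_{N+M}],[u:t])\mapsto([x_0:\dots:x_N:\lambda x_{N+1}:\dots:\lambda x_{N+M}],[\lambda u:t])$ on $\mathbb P^{N+M}\times\mathbb P^1$ and $\mu(x_0,\dots,x_{N+M})\otimes(u,t)\mapsto\mu(x_0,\dots,x_N,\lambda x_{N+1},\dots,\lambda x_{N+M})\otimes(\lambda u,t)$ on $\mathbb V(\mathcal O(1)\boxtimes\mathcal O(1))$. Let $K$ be the union of the zero section of $\mathbb V_{D_YX}(\mathcal L')(\mathbb C)$ and the orbit $U(1)\cdot T$ of $T\subset\mathbb V_X(\mathcal L)(\mathbb C)=\mathbb V_{D_YX}(\mathcal L')_{|1}(\mathbb C)$ under the natural transverse action restricted to $U(1)=\{|\lambda|=1\}$. Set $T'=\widehat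 K$ (holomorphically convex hull in $\mathbb V_{D_YX}(\mathcal L')(\mathbb C)$) and $\overline{\mathcal L'}=(\mathbb V_{D_YX}(\mathcal L'),T')$. *)

(* Defs.v *)
From HB Require Import structures.
From mathcomp Require Import all_boot all_order all_algebra.
From mathcomp Require Import complex.
From mathcomp Require Import all_classical all_reals all_analysis.
(* not imported: its notations clash with MathComp-Analysis *)
From mathcomp Require mpoly.
Import Order.TTheory GRing.Theory Num.Theory.
Import numFieldNormedType.Exports.

Set Implicit Arguments.
Unset Strict Implicit.
Unset Printing Implicit Defensive.

Local Open Scope classical_set_scope.
Local Open Scope ring_scope.
Local Open Scope quotient_scope.

(* The complex numbers, typed so that the topology and the norm that
   MathComp-Analysis attaches to every numFieldType are found. *)
Definition Cx (R : realType) : numFieldType := R[i].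

Definition Cconj (R : realType) (z : Cx R) : Cx R := conjc (z : R[i]).

Definition modulus (R : realType) (z : Cx R) : R := complex.Re `|z : R[i]|.

(** * Polarized projective schemes

   A pair (X, L), with X projective over Z and L very ample over Z, is given by
   its ring of sections S = \bigoplus_(n >= 0) H^0(X, L^n):  X = Proj S,
   L = O(1), and [Sg n] is H^0(X, L^n).  [very_ample_section_ring] says that
   a graded ring is the ring of sections of such a pair.  As S is a nonzero
   ring, X is nonempty; X(C) may be empty. *)

Record grading (S : comNzRingType) := Grading {
  piece :> nat -> set S;
  piece0 : forall n, piece n 0;
  pieceB : forall n a b, piece n a -> piece n b -> piece n (a - b);
  piece1 : piece 0%N 1;
  pieceM : forall m n a b, piece m a -> piece n b -> piece (m + n)%N (a * b);
  piece_span : forall a, exists n (c : nat -> S),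
    (forall k, piece k (c k)) /\ a = \sum_(k < n) c k;
  piece_direct : forall n (c : nat -> S),
    (forall k, piece k (c k)) -> \sum_(k < n) c k = 0 ->
    forall k, (k < n)%N -> c k = 0
}.

Lemma pieceD (S : comNzRingType) (Sg : grading S) n a b :
  Sg n a -> Sg n b -> Sg n (a + b).
Proof.
move=> Ha Hb; rewrite -[b]opprK; apply: pieceB => //; rewrite -sub0r.
by apply: pieceB => //; apply: piece0.
Qed.

(* The s_i are sections of O(1) on Proj S without common zero, so that they
   define a morphism Proj S -> P^(N-1) over Z; it is a closed immersion:
   Z[x_j/x_i]_j -> (S_(s_i))_0 is onto for all i; and S_n -> H^0(Proj S, O(n))
   is bijective for all n, where a section of O(n) is a family of fractions
   a_i/s_i^k on the open sets D_+(s_i) which agree on overlaps. *)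
Record embedding_sections (S : comNzRingType) (Sg : grading S)
    (N : nat) (s : 'I_N -> S) : Prop := EmbeddingSections {
  emb_deg1 : forall i, Sg 1%N (s i);
  emb_cover : forall n a, (0 < n)%N -> Sg n a ->
    exists k (b : 'I_N -> S), a ^+ k = \sum_i b i * s i;
  emb_closed : forall i n a, Sg n a ->
    exists k (P : mpoly.mpoly N int), s i ^+ k * a = mpoly.mmap intr s P;
  emb_injective : forall n b, Sg n b ->
    (forall i, exists m, s i ^+ m * b = 0) -> b = 0;
  emb_glue : forall n k (a : 'I_N -> S), (forall i, Sg (n + k)%N (a i)) ->
    (forall i j, exists m,
       (s i * s j) ^+ m * (s j ^+ k * a i - s i ^+ k * a j) = 0) ->
    exists b, Sg n b /\
      forall i, exists m, s i ^+ m * (s i ^+ k * b - a i) = 0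
}.

Definition very_ample_section_ring (S : comNzRingType) (Sg : grading S) :=
  exists N (s : 'I_N -> S), embedding_sections Sg s.

(** * Hyperplane sections *)

Record ideal (S : comNzRingType) := Ideal {
  ideal_set :> S -> Prop;
  ideal_0 : ideal_set 0;
  ideal_D : forall a b, ideal_set a -> ideal_set b -> ideal_set (a + b);
  ideal_M : forall a b, ideal_set b -> ideal_set (a * b)
}.

(* Closed subschemes Y of X = Proj S correspond to the saturated homogeneous
   ideals of S, Y to the ideal I of the sections which vanish on Y. *)
Record hyperplane_section (S : comNzRingType) (Sg : grading S)
    (I : ideal S) : Prop := HyperplaneSection {
  hyp_homogeneous : forall n (c : nat -> S), (forall k, Sg k (c k)) ->
    I (\sum_(k < n) c k) -> forall k, (k < n)%N -> I (c k);
  hyp_saturated : forall n b, Sg n b ->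
    (forall s, Sg 1%N s -> exists m, I (s ^+ m * b)) -> I b;
  hyp_degree1 : forall a, I a -> exists m (b t : 'I_m -> S),
    (forall j, I (t j) /\ Sg 1%N (t j)) /\ a = \sum_j b j * t j
}.

(** * Total spaces of line bundles over multigraded Proj's

   Let A be a ring graded by N^r, [D d] being the set of its homogeneous
   elements of degree d.  Let Omega be the open set of the x in Spec A such that,
   for each i < r, some element of degree (0,..,1,..,0) (1 in position i) is
   nonzero at x.  The quotient of Omega by the torus (C^* )^r is Proj A, and the
   total space of the dual of O(1,..,1) is the quotient of Omega * A^1 by
     l . (x, mu) = (l . x, (l_1 ... l_r)^-1 mu).
   For r = 1 and A = S, the class of (x, mu) is the pair made of the point [x] of
   X and of the linear form  a |-> mu * x(a)  on sections a of L. *)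

Section Total.
Context {R : realType} {A : comNzRingType} {r : nat}.
Variable D : ('I_r -> nat) -> set A.
Local Notation C := (Cx R).

Definition unit_degree (i : 'I_r) : 'I_r -> nat := fun j => (j == i : nat).

(* a point of Omega * A^1 *)
Record coord := Coord {
  ev : {rmorphism A -> C};
  mu : C;
  semistable : forall i, exists2 a, D (unit_degree i) a & ev a != 0
}.

HB.instance Definition _ := gen_eqMixin coord.
HB.instance Definition _ := gen_choiceMixin coord.

(* pointwise convergence on A *)
Definition coord_fun (p : coord) : ({ptws A -> C} * C)%type :=
  ((ev p : A -> C), mu p).
HB.instance Definition _ := Topological.copy coord (initial_topology coord_fun).

Definition character (l : 'I_r -> C) (d : 'I_r -> nat) : C :=
  \prod_i l i ^+ d i.

Definition same_point (p q : coord) : Prop := exists l : 'I_r -> C,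
  [/\ forall i, l i != 0,
      forall d a, D d a -> ev q a = character l d * ev p a &
      mu q = (\prod_i l i)^-1 * mu p].

Let same_pointb p q := `[< same_point p q >].

Local Lemma same_point_refl : reflexive same_pointb.
Proof.
move=> p; apply/asboolP; exists (fun=> 1); split=> [i|d a _|].
- exact: oner_neq0.
- by rewrite /character big1 ?mul1r// => i _; rewrite expr1n.
- by rewrite big1 ?invr1 ?mul1r.
Qed.

Local Lemma same_point_symP p q : same_point p q -> same_point q p.
Proof.
move=> [l [l0 lD lm]]; exists (fun i => (l i)^-1); split=> [i|d a Da|].
- by rewrite invr_eq0.
- rewrite (lD _ _ Da) mulrA /character -big_split/= big1 ?mul1r// => i _.
  by rewrite -exprMn mulVf ?expr1n.
- by rewrite lm prodfV invrK mulrA mulfV ?mul1r//; apply/prodf_neq0.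
Qed.

Local Lemma same_point_sym : symmetric same_pointb.
Proof.
move=> p q; apply/is_true_inj/propext.
by split=> /asboolP pq; apply/asboolP; apply: same_point_symP.
Qed.

Local Lemma same_point_trans : transitive same_pointb.
Proof.
move=> q p s /asboolP[l [l0 lD lm]] /asboolP[k [k0 kD km]]; apply/asboolP.
exists (fun i => k i * l i); split=> [i|d a Da|].
- by rewrite mulf_neq0.
- rewrite (kD _ _ Da) (lD _ _ Da) mulrA /character -big_split/=.
  by congr (_ * _); apply: eq_bigr => i _; rewrite exprMn.
- by rewrite km lm mulrA big_split/= invfM mulrC mulrA mulrC mulrA.
Qed.

Definition same_point_rel :=
  EquivRel _ same_point_refl same_point_sym same_point_trans.

(* the set of complex points, with its transcendental topology *)
Definition total := {eq_quot same_point_rel}.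
HB.instance Definition _ := Topological.copy total (quotient_topology total).
HB.instance Definition _ := Quotient.on total.

Lemma total_eqP (p q : coord) : \pi_total p = \pi_total q <-> same_point p q.
Proof. by split=> [/eqquotP/asboolP|pq]//; apply/eqquotP/asboolP. Qed.

Definition zero_section : set total :=
  [set z | exists2 p : coord, mu p = 0 & z = \pi_total p].

(** ** Holomorphic functions

   These are the global sections of the structure sheaf of the analytification,
   which is not assumed to be reduced.  A germ is g(a_1, .., a_k, mu) with
   a_1, .., a_k in A homogeneous and g holomorphic near the relevant point and
   torus-invariant near it.  Two germs are equal when, after adding more
   elements a_i if needed, their difference is in the ideal of convergent
   power series generated by the polynomial relations between the a_i. *)

Record germ := Germ {
  arity : nat;
  elts : 'I_arity -> A;
  degs : 'I_arity -> 'I_r -> nat;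
  gfun : 'rV[C]_arity * C -> C
}.
Arguments elts : clear implicits.
Arguments degs : clear implicits.
Arguments gfun : clear implicits.

Definition values (k : nat) (a : 'I_k -> A) (p : coord) : 'rV[C]_k * C :=
  (\row_i ev p (a i), mu p).

Definition germ_value (g : germ) (p : coord) : C := gfun g (values (elts g) p).

Definition holomorphic_near (k : nat) (g : 'rV[C]_k * C -> C)
    (z : 'rV[C]_k * C) : Prop :=
  \forall w \near z, differentiable g w.

Definition torus_act (k : nat) (d : 'I_k -> 'I_r -> nat) (l : 'rV[C]_r)
    (z : 'rV[C]_k * C) : 'rV[C]_k * C :=
  (\row_i (character (l ord0) (d i) * z.1 ord0 i),
   (\prod_i l ord0 i)^-1 * z.2).

Definition germ_at (p : coord) (g : germ) : Prop :=
  [/\ forall i, D (degs g i) (elts g i),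
      holomorphic_near (gfun g) (values (elts g) p) &
      \forall l \near (const_mx 1 : 'rV[C]_r) & z \near values (elts g) p,
        gfun g (torus_act (degs g) l z) = gfun g z].

Definition select (k m : nat) (f : 'I_k -> 'I_m) (z : 'rV[C]_m * C) :
    'rV[C]_k * C :=
  (\row_i z.1 ord0 (f i), z.2).

Definition germ_eq (p : coord) (g h : germ) : Prop :=
  exists m (a : 'I_m -> A) (f : 'I_(arity g) -> 'I_m) (f' : 'I_(arity h) -> 'I_m),
  [/\ forall i, a (f i) = elts g i,
      forall i, a (f' i) = elts h i &
      exists n (P : 'I_n -> mpoly.mpoly m int) (c : 'I_n -> 'rV[C]_m * C -> C),
      [/\ forall j, mpoly.mmap intr a (P j) = 0,
          forall j, holomorphic_near (c j) (values a p) &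
          \forall z \near values a p,
            gfun g (select f z) - gfun h (select f' z) =
            \sum_j mpoly.mmap intr (z.1 ord0) (P j) * c j z]].

Definition holomorphic (F : total -> C) : Prop :=
  exists g : coord -> germ, forall p,
  [/\ germ_at p (g p),
      F (\pi_total p) = germ_value (g p) p &
      \forall q \near p, germ_eq q (g p) (g q)].

Definition hull (K : set total) : set total :=
  [set z | forall F, holomorphic F ->
    ((modulus (F z))%:E <= ereal_sup [set (modulus (F w))%:E | w in K])%E].

(** ** Seminormed line bundles *)

(* T is the tube of a seminorm *)
Record tube (T : set total) : Prop := Tube {
  tube_compact : compact T;
  tube_zero : zero_section `<=` T;
  tube_disc : forall (p q : coord) (l : C), modulus l <= 1 ->
    ev q =1 ev p -> mu q = l * mu p -> T (\pi_total p) -> T (\pi_total q);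
  tube_conj : forall p q : coord,
    (forall a, ev q a = Cconj (ev p a)) -> mu q = Cconj (mu p) ->
    T (\pi_total p) -> T (\pi_total q)
}.

(* the bundle is ample wherever this is used *)
Definition semipositive (T : set total) : Prop := hull T = T.

End Total.

Arguments coord R {A r} D.
Arguments total R {A r} D.
Arguments hull {R A r D} K.
Arguments zero_section {R A r D}.

(** * V_X(L) *)

Definition line_deg (S : comNzRingType) (Sg : grading S) :
  ('I_1 -> nat) -> set S := fun d => Sg (d ord0).

Definition VX (R : realType) (S : comNzRingType) (Sg : grading S) :=
  total R (line_deg Sg).

(** * The deformation to the projective completion of the cone *)

Section Deformation.
Context {S : comNzRingType}.
Variable I : ideal S.

Fixpoint ideal_pow (l : nat) : set S :=
  if l is l'.+1 then
    [set x | exists m (a b : 'I_m -> S),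
       (forall j, I (a j) /\ ideal_pow l' (b j)) /\ x = \sum_j a j * b j]
  else setT.

Lemma ideal_powM l a b : ideal_pow l b -> ideal_pow l (a * b).
Proof.
case: l => // l [m [x [y [xy ->]]]]; exists m, (fun j => a * x j), y; split.
  by move=> j; have [? ?] := xy j; split=> //; apply: ideal_M.
by rewrite mulr_sumr; apply: eq_bigr => j _; rewrite mulrA.
Qed.

Lemma ideal_pow0 l : ideal_pow l 0.
Proof.
case: l => // l; exists 0%N, (fun=> 0), (fun=> 0).
by split=> [[]//|]; rewrite big_ord0.
Qed.

Lemma ideal_powD l a b :
  ideal_pow l a -> ideal_pow l b -> ideal_pow l (a + b).
Proof.
case: l => // l [m [x [y [xy ->]]]] [n [z [t [zt ->]]]].
pose u (T : Type) (f : 'I_m -> T) (g : 'I_n -> T) (j : 'I_(m + n)) :=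
  match fintype.split j with inl i => f i | inr i => g i end.
exists (m + n)%N, (u _ x z), (u _ y t); split.
  by move=> j; rewrite /u; case: (fintype.split j).
rewrite big_split_ord/=; congr (_ + _); apply: eq_bigr => j _; rewrite /u.
  by rewrite (unsplitK (inl j)).
by rewrite (unsplitK (inr j)).
Qed.

Lemma ideal_powS l a : ideal_pow l.+1 a -> ideal_pow l a.
Proof.
move=> [m [x [y [xy ->]]]]; elim/big_ind: _ => [||j _].
- exact: ideal_pow0.
- exact: ideal_powD.
- by apply: ideal_powM; have [] := xy j.
Qed.

Lemma ideal_pow_le k l a : (k <= l)%N -> ideal_pow l a -> ideal_pow k a.
Proof.
move/subnK <-; elim: (l - k)%N => // n IH Ha; apply: IH.
by apply: ideal_powS; rewrite addSn in Ha.
Qed.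

Lemma ideal_pow_mul k l a b :
  ideal_pow k a -> ideal_pow l b -> ideal_pow (k + l) (a * b).
Proof.
elim: k a => [a _ Hb|k IH a [m [x [y [xy ->]]]] Hb]; first exact: ideal_powM.
rewrite mulr_suml addSn; exists m, x, (fun j => y j * b); split.
  by move=> j; have [? ?] := xy j; split=> //; apply: IH.
by apply: eq_bigr => j _; rewrite mulrA.
Qed.

(* the coefficient of v^i t^j *)
Definition coef2 (P : {poly {poly S}}) (i j : nat) : S := (P`_j : {poly S})`_i.

(* D_Y X is Proj of a bigraded ring B, which is generated over S by homogeneous
   coordinates u, t of P^1 and by the products of elements of I with v = u/t:
   B is the set of the polynomials in v = 'X%:P and t = 'X in S[v][t] whose
   coefficient of v^i t^j is in I^(i - j) (in S if i <= j).
   B is bigraded by the degree of S and the degree in t; u = v t, and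
   - t = 1 gives S[u/t], hence the chart X * Spec Z[u/t];
   - u = 1 gives \bigoplus_l I^l (t/u)^(-l), hence the chart Proj S'. *)
Definition rees : {pred {poly {poly S}}} :=
  fun P => `[< forall i j, ideal_pow (i - j) (coef2 P i j) >].

Lemma reesP (P : {poly {poly S}}) :
  reflect (forall i j, ideal_pow (i - j) (coef2 P i j)) (P \in rees).
Proof. exact: asboolP. Qed.

Lemma rees_subring : subring_closed rees.
Proof.
split=> [|P Q /reesP HP /reesP HQ|P Q /reesP HP /reesP HQ]; apply/reesP => i j;
  rewrite /coef2.
- rewrite coef1; case: j => [|j]; last by rewrite coef0; apply: ideal_pow0.
  by rewrite coef1; case: i => // i; apply: ideal_pow0.
- rewrite !coefB -mulN1r; apply: ideal_powD => //; exact: ideal_powM.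
- rewrite coefM coef_sum; elim/big_ind: _ => [||[k /= kj] _].
  + exact: ideal_pow0.
  + exact: ideal_powD.
  + rewrite coefM; elim/big_ind: _ => [||[l /= li] _].
    * exact: ideal_pow0.
    * exact: ideal_powD.
    * apply: (@ideal_pow_le _ ((l - k) + ((i - l) - (j - k)))%N).
        rewrite ltnS in kj; rewrite ltnS in li.
        rewrite leq_subLR -{1}(subnKC li) -{1}(subnKC kj).
        rewrite [leqRHS]addnACA.
        by apply: leq_add; rewrite -maxnE leq_maxr.
      exact: ideal_pow_mul.
Qed.

HB.instance Definition _ :=
  GRing.isSubringClosed.Build {poly {poly S}} rees rees_subring.

Record coxring := Coxring { cox_val :> {poly {poly S}}; _ : cox_val \in rees }.
HB.instance Definition _ := [isSub for cox_val].
HB.instance Definition _ := [Choice of coxring by <:].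
HB.instance Definition _ := [SubChoice_isSubComNzRing of coxring by <:].

Lemma cst_rees (a : S) : a%:P%:P \in rees.
Proof.
apply/reesP => i j; rewrite /coef2 coefC; case: j => [|j] /=; last first.
  by rewrite coef0; apply: ideal_pow0.
by rewrite coefC; case: i => // i; apply: ideal_pow0.
Qed.
Definition cox_cst (a : S) : coxring := Coxring (cst_rees a).

Lemma t_rees : 'X \in rees.
Proof.
apply/reesP => i j; rewrite /coef2 coefX; case: eqP => [->|_].
  by rewrite coef1; case: i => [|[|i]]//; apply: ideal_pow0.
by rewrite coef0; apply: ideal_pow0.
Qed.
Definition cox_t : coxring := Coxring t_rees.

Lemma u_rees : 'X%:P * 'X \in rees.
Proof.
apply/reesP => i j; rewrite /coef2 coefMX; case: j => [|j] /=.
  by rewrite coef0; apply: ideal_pow0.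
rewrite coefC; case: j => [|j] /=; last by rewrite coef0; apply: ideal_pow0.
by rewrite coefX; case: i => [|[|i]]//; apply: ideal_pow0.
Qed.
Definition cox_u : coxring := Coxring u_rees.

Definition defo_deg (Sg : grading S) : ('I_2 -> nat) -> set coxring :=
  fun d => [set P : coxring | forall i j,
    if j == d ord_max then Sg (d ord0) (coef2 P i j)
    else coef2 P i j = 0].

(* the value at v = t = 1, that is, at u = t = 1 *)
Definition cox_at1 : {rmorphism coxring -> S} :=
  horner_eval (1 : S) \o horner_eval (1 : {poly S}) \o
    (val : coxring -> {poly {poly S}}).

Lemma cox_at1_cst a : cox_at1 (cox_cst a) = a.
Proof. by rewrite /= /horner_eval !hornerE. Qed.

Lemma cox_at1_t : cox_at1 cox_t = 1.
Proof. by rewrite /= /horner_eval !hornerE. Qed.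

Lemma cox_at1_u : cox_at1 cox_u = 1.
Proof. by rewrite /= /horner_eval !hornerE. Qed.

Lemma defo_deg_cst (Sg : grading S) d a :
  Sg (d ord0) a -> d ord_max = 0%N -> defo_deg Sg d (cox_cst a).
Proof.
move=> Ha d0 i j; rewrite d0 /coef2 /= coefC; case: eqP => _.
  by rewrite coefC; case: ifP => // _; apply: piece0.
by rewrite coef0.
Qed.

Lemma defo_deg_t (Sg : grading S) d :
  d ord0 = 0%N -> d ord_max = 1%N -> defo_deg Sg d cox_t.
Proof.
move=> d0 d1 i j; rewrite d0 d1 /coef2 /= coefX; case: eqP => _.
  by rewrite coef1; case: (i == 0%N); [apply: piece1|apply: piece0].
by rewrite coef0.
Qed.

Lemma cox_at1_deg (Sg : grading S) d P :
  defo_deg Sg d P -> Sg (d ord0) (cox_at1 P).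
Proof.
move=> HP; have [val0 valD] := (@piece0 _ Sg (d ord0), @pieceD _ Sg (d ord0)).
rewrite /= /horner_eval (horner_coef (cox_val P)).
under eq_bigr do rewrite expr1n mulr1.
rewrite horner_sum; elim/big_ind: _ => // j _.
rewrite horner_coef; elim/big_ind: _ => // i _; rewrite expr1n mulr1.
by have := HP i j; rewrite /coef2; case: ifP => // _ ->.
Qed.

End Deformation.

Section Tubes.
Context {R : realType} {S : comNzRingType}.
Variables (Sg : grading S) (I : ideal S).
Local Notation C := (Cx R).

(* The bundle L' is O(1,1).  For s_i in S_1 and t_j in I_1, the class of (x, mu)
   is the point  mu (s_0(x), .., s_N(x), (t_1 v)(x), .., (t_M v)(x)) (x) (u, t)
   of the total space of the dual of O(1) (x) O(1), where t_j v is t_j u/t. *)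
Definition VD := total R (@defo_deg S I Sg).

Local Notation coordX := (coord R (line_deg Sg)).
Local Notation coordD := (coord R (@defo_deg S I Sg)).
Local Notation VX := (VX R Sg).

Lemma fiber1_semistable (p : coordX) (i : 'I_2) :
  exists2 P, @defo_deg S I Sg (unit_degree i) P & (ev p \o cox_at1 I) P != 0.
Proof.
have [a Da pa] := semistable p ord0.
have [->|->] : i = ord0 \/ i = ord_max.
- by case: i => [[|[|]]]//= ?; [left|right]; apply: val_inj.
- by exists (cox_cst I a); [apply: defo_deg_cst|rewrite compE cox_at1_cst].
- exists (cox_t I); first exact: defo_deg_t.
  by rewrite compE cox_at1_t rmorph1 oner_neq0.
Qed.

(* the identification of V_X(L) with the fiber over 1 *)
Definition fiber1_coord (p : coordX) : coordD :=
  @Coord R (coxring I) 2 (@defo_deg S I Sg) (ev p \o cox_at1 I) (mu p)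
    (fiber1_semistable p).

Definition fiber1_emb (z : VX) : VD := \pi_VD (fiber1_coord (repr z)).

Lemma fiber1_embE (p : coordX) :
  fiber1_emb (\pi_VX p) = \pi_VD (fiber1_coord p).
Proof.
apply/total_eqP; have /total_eqP[l [l0 lD lm]] := reprK (\pi_VX p).
exists (fun i => if i == ord0 then l ord0 else 1); split.
- by move=> i; case: ifP => // _; apply: oner_neq0.
- move=> d P /cox_at1_deg HP /=; rewrite (lD (fun=> d ord0))//; congr (_ * _).
  by rewrite /character big_ord1 big_ord_recl big_ord1/= expr1n mulr1.
- by rewrite lm big_ord1 big_ord_recl big_ord1 /= mulr1.
Qed.

Definition fiber1 : set VD :=
  [set z | exists2 p : coordD,
     ev p (cox_u I) = ev p (cox_t I) & z = \pi_VD p].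

(* l . p = q, where l acts by t |-> t, u |-> l u, a |-> a for a in S,
   a (u/t) |-> l a (u/t) for a in I, mu |-> mu *)
Definition transverse (l : C) (p q : coordD) : Prop :=
  mu q = mu p /\
  forall i (P : coxring I), (forall k j, k != i -> coef2 P k j = 0) ->
    ev q P = l ^+ i * ev p P.

Lemma transverse_fiber1 (l : C) (p : coordX) : l != 0 ->
  exists q, transverse l (fiber1_coord p) q.
Proof.
move=> l0.
pose e : {rmorphism coxring I -> C} :=
  (horner_eval l : {poly C} -> C) \o map_poly (ev p) \o
  horner_eval (1 : {poly S}) \o (val : coxring I -> {poly {poly S}}).
have eE i (P : coxring I) : (forall k j, k != i -> coef2 P k j = 0) ->
    e P = l ^+ i * ev p (cox_at1 I P).
  move=> HP; rewrite /= /horner_eval (_ : (val P).[1] = ((val P).[1])`_i *: 'X^i).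
    by rewrite map_polyZ map_polyXn !hornerE expr1n mulr1 mulrC.
  apply/polyP => k; rewrite coefZ coefXn; case: eqP => [->|/eqP ki].
    by rewrite mulr1.
  rewrite mulr0 horner_coef coef_sum big1// => j _.
  by rewrite expr1n mulr1; apply: HP.
have st i : exists2 P, @defo_deg S I Sg (unit_degree i) P & e P != 0.
  have [P HP Pn] := fiber1_semistable p i.
  have [a Da pa] := semistable p ord0.
  have [->|->] : i = ord0 \/ i = ord_max.
  - by case: (i) => [[|[|]]]//= ?; [left|right]; apply: val_inj.
  - exists (cox_cst I a); first exact: defo_deg_cst.
    rewrite (eE 0%N) ?cox_at1_cst ?mul1r// => k j k0.
    by rewrite /coef2 /= coefC; case: ifP; rewrite ?coef0// coefC (negbTE k0).
  - exists (cox_t I); first exact: defo_deg_t.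
    rewrite (eE 0%N) ?cox_at1_t ?mul1r ?rmorph1 ?oner_neq0// => k j k0.
    by rewrite /coef2 /= coefX; case: eqP => _; rewrite ?coef0// coef1 (negbTE k0).
by exists (@Coord R _ _ (@defo_deg S I Sg) e (mu p) st); split=> // i P /eE ->.
Qed.

Definition unit_orbit (Z : set VD) : set VD :=
  [set z | exists l p q, [/\ modulus l = 1, Z (\pi_VD p), transverse l p q &
                             z = \pi_VD q]].

Definition deformation_tube (T : set VX) : set VD :=
  hull (zero_section `|` unit_orbit (fiber1_emb @` T)).

End Tubes.

Arguments fiber1 {R S Sg I}.
Arguments fiber1_emb {R S Sg I} z.
Arguments deformation_tube {R S Sg} I T.

(* Main.v *)
From HB Require Import structures.
Require Import Defs.
From mathcomp Require Import all_boot all_order all_algebra.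
From mathcomp Require Import complex ring lra zify.
From mathcomp Require Import all_classical all_reals all_analysis.
From mathcomp Require mpoly.
Import Order.TTheory GRing.Theory Num.Theory.
Import numFieldNormedType.Exports.

Set Implicit Arguments.
Unset Strict Implicit.
Unset Printing Implicit Defensive.

Local Open Scope classical_set_scope.
Local Open Scope ring_scope.
Local Open Scope quotient_scope.

(** One inclusion is immediate, since [T] lies in the set whose hull is taken. For the other, let a
    point of the hull lie over 1, and let [p] be the corresponding point of V_X(L) ([fiber1_lift]).
    The functions mu t s_i on the total space over D_Y X are holomorphic, invariant under the
    transverse action, zero on the zero section, and equal to mu s_i over 1. Testing the hull on
    polynomials in them ([holomorphic_dpos], [dpos_transverse]) shows that the image of [p] in C^N
    under (x, mu) |-> mu s(x), which contracts the zero section, lies in the polynomial hull K of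
    the image of [T]. As [T] is its own holomorphic hull, it remains to bound every holomorphic F on
    V_X(L) at [p] by its supremum on [T]; this is [hull_bound].

    Suppose |F| is larger at [p] than on [T]. Maximise |F|^2 times a weight close to 1 over the
    points above K. The maximum is off the zero section, where F is locally a uniform limit of
    polynomials in the coordinates of C^N ([good_approx], [local_approx], by Cauchy's formula).
    Multiplication by a Hermitian kernel turns it into a strict peak on K, away from the image of
    [T]. Rossi's local maximum modulus principle ([no_peak]) excludes such peaks.

    Rossi's principle comes from the algebra of polynomials with an inverse of the peaking function
    g adjoined, and seminormed by suprema over [T]. Its spectrum is the part of K where |g| >=
    theta, in which a neighbourhood of the peak is open and closed. An approximate form of Shilov's
    idempotent theorem ([approximate_idempotent]) gives an element close to the indicator of that
    piece. Sharpened with bounded norm ([sharp_bounded]), multiplied by a power of g and truncated,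
    it becomes a polynomial that is larger at the peak than on [T] ([no_strict_peak]).

    The idempotent is glued from constants on small boxes. The gluing ([merge_near01]) is a Cauchy
    transform discretised by roots of unity and averaged over concentric circles. The spectral
    theory that it uses ([gelfand_mazur], [spectral_radius]) is developed for algebras that are not
    complete, with approximate inverses and finite means in place of resolvents and integrals. *)

(** * The real-valued modulus *)

Section Modulus.
Context {R : realType}.
Implicit Types x y z : Cx R.

(** The norm of [Cx R] takes its values in [Cx R]; [RtoC] and [modulus] carry its inequalities over
    to [R], where [lra] applies. *)
Definition RtoC (a : R) : Cx R := a%:C%C.

HB.instance Definition _ := GRing.RMorphism.copy RtoC (real_complex R).

Lemma RtoC_le a b : (RtoC a <= RtoC b) = (a <= b).
Proof. exact: lecR. Qed.

Lemma RtoC_lt a b : (RtoC a < RtoC b) = (a < b).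
Proof. exact: ltcR. Qed.

Lemma RtoC_inj : injective RtoC.
Proof. exact: fmorph_inj. Qed.

Lemma modulusCE z : RtoC (modulus z) = `|z|.
Proof. by case: z. Qed.

Lemma modulus_ge0 z : 0 <= modulus z.
Proof. by rewrite -RtoC_le modulusCE rmorph0 normr_ge0. Qed.

Lemma modulus0 : modulus (0 : Cx R) = 0.
Proof. by apply: RtoC_inj; rewrite modulusCE normr0 rmorph0. Qed.

Lemma modulus1 : modulus (1 : Cx R) = 1.
Proof. by apply: RtoC_inj; rewrite modulusCE normr1 rmorph1. Qed.

Lemma modulusM x y : modulus (x * y) = modulus x * modulus y.
Proof. by apply: RtoC_inj; rewrite rmorphM !modulusCE normrM. Qed.

Lemma modulusN x : modulus (- x) = modulus x.
Proof. by apply: RtoC_inj; rewrite !modulusCE normrN. Qed.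

Lemma modulusV x : modulus x^-1 = (modulus x)^-1.
Proof. by apply: RtoC_inj; rewrite fmorphV !modulusCE normfV. Qed.

Lemma modulusD x y : modulus (x + y) <= modulus x + modulus y.
Proof. by rewrite -RtoC_le rmorphD !modulusCE ler_normD. Qed.

Lemma modulus_eq0 x : (modulus x == 0) = (x == 0).
Proof. by rewrite -(inj_eq RtoC_inj) modulusCE rmorph0 normr_eq0. Qed.

Lemma modulusX x n : modulus (x ^+ n) = modulus x ^+ n.
Proof. by elim: n => [|n IH]; rewrite ?modulus1 ?expr0// !exprS modulusM IH. Qed.

Lemma modulusB x y : modulus (x - y) <= modulus x + modulus y.
Proof. by rewrite -[modulus y]modulusN; apply: modulusD. Qed.

Lemma modulusBC x y : modulus (x - y) = modulus (y - x).
Proof. by rewrite -modulusN opprB. Qed.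

Lemma modulus_gt0 x : (0 < modulus x) = (x != 0).
Proof. by rewrite lt_def modulus_ge0 andbT modulus_eq0. Qed.

Lemma modulus_sum (I : Type) (r : seq I) (P : pred I) (F : I -> Cx R) :
  modulus (\sum_(i <- r | P i) F i) <= \sum_(i <- r | P i) modulus (F i).
Proof.
elim/big_rec2: _ => [|i x y _ H]; first by rewrite modulus0.
by rewrite (le_trans (modulusD _ _))// lerD2l.
Qed.

Lemma modulus_prod (I : Type) (r : seq I) (P : pred I) (F : I -> Cx R) :
  modulus (\prod_(i <- r | P i) F i) = \prod_(i <- r | P i) modulus (F i).
Proof.
elim/big_rec2: _ => [|i x y _ H]; first by rewrite modulus1.
by rewrite modulusM H.
Qed.

Lemma modulus_RtoC (a : R) : modulus (RtoC a) = `|a|.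
Proof.
apply: RtoC_inj; rewrite modulusCE; apply/eqP.
have [a0|a0] := leP 0 a.
  by rewrite !ger0_norm// -(rmorph0 RtoC) RtoC_le.
by rewrite !ltr0_norm ?rmorphN// -(rmorph0 RtoC) RtoC_lt.
Qed.

Lemma modulus_RtoC_ge0 (a : R) : 0 <= a -> modulus (RtoC a) = a.
Proof. by move=> a0; rewrite modulus_RtoC ger0_norm. Qed.

Lemma modulus_natr n : modulus (n%:R : Cx R) = n%:R.
Proof. by rewrite -(rmorph_nat RtoC) modulus_RtoC_ge0. Qed.

Lemma modulus_lb x y : modulus x - modulus y <= modulus (x - y).
Proof. by have := modulusD (x - y) y; rewrite subrK; lra. Qed.

Lemma modulus_lbD x y : modulus x - modulus y <= modulus (x + y).
Proof. by have := modulus_lb x (- y); rewrite opprK modulusN. Qed.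

Lemma normc_lt z (e : R) : (`|z| < RtoC e :> Cx R) = (modulus z < e).
Proof. by rewrite -modulusCE RtoC_lt. Qed.

End Modulus.

(** * Compactness of polydiscs *)

Section Compactness.
Context {R : realType}.
Local Notation C := (Cx R).

Definition Cmk (a b : R) : C := Complex a b.
Definition CRe (z : C) : R := complex.Re z.
Definition CIm (z : C) : R := complex.Im z.

Lemma CmkK (z : C) : Cmk (CRe z) (CIm z) = z.
Proof. by case: z. Qed.

Lemma modulus_sqr (z : C) : modulus z ^+ 2 = CRe z ^+ 2 + CIm z ^+ 2.
Proof.
apply: RtoC_inj; rewrite rmorphXn/= modulusCE.
exact: (esym (add_Re2_Im2 (z : R[i]))).
Qed.

Lemma CRe_le (z : C) : `|CRe z| <= modulus z.
Proof.
rewrite -(ler_pXn2r (n := 2))// ?nnegrE ?modulus_ge0//.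
by rewrite real_normK ?num_real// modulus_sqr lerDl sqr_ge0.
Qed.

Lemma CIm_le (z : C) : `|CIm z| <= modulus z.
Proof.
rewrite -(ler_pXn2r (n := 2))// ?nnegrE ?modulus_ge0//.
by rewrite real_normK ?num_real// modulus_sqr lerDr sqr_ge0.
Qed.

Lemma modulus_le_ReIm (z : C) : modulus z <= `|CRe z| + `|CIm z|.
Proof.
rewrite -(ler_pXn2r (n := 2))// ?nnegrE ?modulus_ge0 ?addr_ge0//.
rewrite modulus_sqr sqrrD !real_normK ?num_real//.
by rewrite -addrA lerD2l lerDr pmulrn_lge0// mulr_ge0.
Qed.

Local Notation W J := {ptws (J * bool)%type -> R^o}.

(** Compactness as an induction principle. If [P] failed on the box, the sets whose complement in
    the box satisfies [P] would form a proper filter, and the local hypothesis at a cluster point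
    gives a contradiction. Real and imaginary parts are separate coordinates, so that the box lies
    in a product of real segments. *)
Lemma box_ind (J : finType) (P : set (J -> C) -> Prop) (M : R) :
  (forall U V, U `<=` V -> P V -> P U) ->
  (forall U V, P U -> P V -> P (U `|` V)) ->
  (forall p, exists2 e, 0 < e &
     P [set q | forall j, modulus (q j - p j) < e]) ->
  P [set q | forall j, modulus (q j) <= M].
Proof.
move=> Psub PU Ploc; apply: contrapT => nP.
pose K : set (W J) := [set u | forall k, `[- M, M]%classic (u k)].
have cK : compact K.
  exact: (@tychonoff (J * bool)%type (fun=> R^o) (fun=> `[- M, M]%classic)
    (fun=> @segment_compact R (- M) M)).
pose to (u : W J) : J -> C := fun j => Cmk (u (j, true)) (u (j, false)).
pose F : set_system (W J) := [set A | P [set q | exists2 u, K u /\ ~ A u & q = to u]].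
have P0 U : U = set0 -> P U.
  move=> ->; have [e _ Pe] := Ploc (fun=> 0).
  by apply: Psub Pe => q [].
have FK : F K by apply: P0; rewrite -subset0 => q [u [? []]].
have FF : ProperFilter F.
  split=> [F0|]; last split.
  - apply: nP; apply: Psub F0 => q /= qM.
    exists (fun k => if k.2 then CRe (q k.1) else CIm (q k.1)).
      split=> // -[j b] /=; rewrite in_itv/= -ler_norml.
      by case: b => /=; rewrite (le_trans _ (qM j))// ?CRe_le ?CIm_le.
    by apply/funext => j; rewrite /to /= CmkK.
  - by apply: P0; rewrite -subset0 => q [u [_ []]].
  - move=> A B FA FB; apply: Psub (PU _ _ FA FB) => q [u [Ku nAB] ->].
    have [Au|nA] := pselect (A u); last by left; exists u.
    by right; exists u => //; split=> // Bu; apply: nAB.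
  - move=> A B AB; apply: Psub => q [u [Ku nB] ->].
    by exists u => //; split=> // /AB.
have [p [Kp clp]] := cK F FF FK.
have [e e0 Pe] := Ploc (to p).
pose V : set (W J) := [set u | forall k, `|u k - p k| < e / 2].
have nV : nbhs p V.
  have : \forall u \near p, forall k, `|u k - p k| < e / 2.
    apply: (@filter_forall _ (J * bool)%type (fun k (u : W J) => `|u k - p k| < e / 2)
      (nbhs p)) => k.
    have B : nbhs (p k : R^o) (ball (p k : R^o) (e / 2)).
      by apply: nbhsx_ballx; lra.
    have H : nbhs p [set u : W J | ball (p k : R^o) (e / 2) (u k)].
      exact: (@proj_continuous (J * bool)%type (fun=> R^o) k p _ B).
    apply: (@filterS _ (nbhs p) _ _ _ _ H) => u /=.
    by rewrite -ball_normE /ball_/= distrC.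
  by [].
have FnV : F (~` V).
  apply: Psub Pe => q [u [Ku /contrapT Vu] ->] j /=.
  rewrite (le_lt_trans (modulus_le_ReIm _))//.
  have := Vu (j, true); have := Vu (j, false).
  by rewrite /to /CRe /CIm /=; lra.
by have [u []] := clp _ _ FnV nV.
Qed.

Lemma disc_ind (P : set C -> Prop) (M : R) :
  (forall U V, U `<=` V -> P V -> P U) ->
  (forall U V, P U -> P V -> P (U `|` V)) ->
  (forall p, exists2 e, 0 < e & P [set q | modulus (q - p) < e]) ->
  P [set q | modulus q <= M].
Proof.
move=> Psub PU Ploc.
pose Q (U : set (unit -> C)) := P [set q tt | q in U].
have : Q [set q | forall j, modulus (q j) <= M].
  apply: box_ind => [U V UV|U V|p]; rewrite /Q.
  - by apply: Psub; apply: image_subset.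
  - by rewrite image_setU; apply: PU.
  - have [e e0 Pe] := Ploc (p tt); exists e => //.
    by apply: Psub Pe => _ [q qe <-]; apply: qe.
by apply: Psub => q qM; exists (fun=> q).
Qed.

End Compactness.

Lemma expr_small (R : realType) (s e : R) : 0 <= s -> s < 1 -> 0 < e ->
  exists n, forall m, (n <= m)%N -> s ^+ m < e.
Proof.
move=> s0 s1 e0.
have : (GRing.exp s @ \oo --> (0 : R^o))%classic.
  by apply: cvg_expr; rewrite ger0_norm.
move=> /cvgrPdist_lt/(_ _ e0)[n _ H]; exists n => m nm.
by have := H m nm; rewrite /= sub0r normrN ger0_norm ?exprn_ge0.
Qed.

(** * Submultiplicative seminorms *)

Section Gauge.
Context {R : realType} {A : comNzRingType} (iota : {rmorphism Cx R -> A}).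
Local Notation C := (Cx R).
Implicit Types (B : A -> R -> Prop) (a b : A).

(* [B a r] stands for [N a < r], N a submultiplicative seminorm. *)
Record gauge B : Prop := Gauge {
  gauge_gt0 : forall a r, B a r -> 0 < r;
  gaugeD : forall a b r s, B a r -> B b s -> B (a + b) (r + s);
  gaugeM : forall a b r s, B a r -> B b s -> B (a * b) (r * s);
  gaugeC : forall c r, modulus c < r -> B (iota c) r;
  gauge_le : forall a r s, r <= s -> B a r -> B a s;
  gauge_open : forall a r, B a r -> exists2 s, s < r & B a s;
  gauge_total : forall a, exists r, B a r
}.

(** Stands for N a <= r, whereas [B a r] is strict. *)
Definition gle B a r := forall e, 0 < e -> B a (r + e).

Section Theory.
Variable B : A -> R -> Prop.
Hypothesis gB : gauge B.

Lemma gltW a r : B a r -> gle B a r.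
Proof. by move=> Ba e e0; apply: gauge_le Ba => //; lra. Qed.

Lemma gle_lt a r s : gle B a r -> r < s -> B a s.
Proof. by move=> /(_ (s - r)); rewrite subr_gt0 subrKC. Qed.

Lemma gle_ge0 a r : gle B a r -> 0 <= r.
Proof.
move=> H; rewrite leNgt; apply/negP => r0.
by have := gauge_gt0 gB (gle_lt H r0); lra.
Qed.

Lemma gle_le a r s : r <= s -> gle B a r -> gle B a s.
Proof. by move=> rs H e e0; apply: gle_lt H _; lra. Qed.

Lemma glt_ex a r : B a r -> exists s, [/\ 0 <= s, s < r & gle B a s].
Proof.
move=> /(gauge_open gB)[s sr Bs]; exists s.
by split=> //; [exact: ltW (gauge_gt0 gB Bs)|exact: gltW].
Qed.

Lemma gle_total a : exists2 r, 0 < r & gle B a r.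
Proof.
have [r Br] := gauge_total gB a; exists r; [exact: gauge_gt0 Br|exact: gltW].
Qed.

Lemma gleC c r : modulus c <= r -> gle B (iota c) r.
Proof. by move=> cr e e0; apply: gaugeC => //; lra. Qed.

Lemma gleD a b r s : gle B a r -> gle B b s -> gle B (a + b) (r + s).
Proof.
move=> Ha Hb e e0; rewrite (_ : r + s + e = (r + e / 2) + (s + e / 2)).
  by apply: gaugeD => //; [apply: Ha|apply: Hb]; lra.
by field.
Qed.

Lemma gleM a b r s : gle B a r -> gle B b s -> gle B (a * b) (r * s).
Proof.
move=> Ha Hb e e0; have [r0 s0] := (gle_ge0 Ha, gle_ge0 Hb).
pose d := Num.min 1 (e / (r + s + 1)).
have d0 : 0 < d by rewrite lt_min ltr01 divr_gt0//; lra.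
have d1 : d <= 1 by rewrite ge_min lexx.
have de : d * (r + s + 1) <= e.
  by rewrite -ler_pdivlMr ?ge_min ?lexx ?orbT//; lra.
apply: (gauge_le gB _ (gaugeM gB (Ha _ d0) (Hb _ d0))).
by nra.
Qed.

Lemma gle0 : gle B 0 0.
Proof. by rewrite -(rmorph0 iota); apply: gleC; rewrite modulus0. Qed.

Lemma gle1 : gle B 1 1.
Proof. by rewrite -(rmorph1 iota); apply: gleC; rewrite modulus1. Qed.

Lemma gleX a r n : gle B a r -> gle B (a ^+ n) (r ^+ n).
Proof.
move=> H; elim: n => [|n IH]; first exact: gle1.
by rewrite !exprS; apply: gleM.
Qed.

Lemma gleZ c a r s : modulus c <= s -> gle B a r -> gle B (iota c * a) (s * r).
Proof. by move=> cs; apply: gleM; apply: gleC. Qed.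

Lemma gleN a r : gle B a r -> gle B (- a) r.
Proof.
move=> H; rewrite -mulN1r -(rmorph1 iota) -rmorphN -[r]mul1r.
by apply: gleZ => //; rewrite modulusN modulus1.
Qed.

Lemma gleB a b r s : gle B a r -> gle B b s -> gle B (a - b) (r + s).
Proof. by move=> Ha Hb; apply: gleD => //; apply: gleN. Qed.

Lemma gle_sum (I : Type) (l : seq I) (P : pred I) (F : I -> A) (f : I -> R) :
  (forall i, P i -> gle B (F i) (f i)) ->
  gle B (\sum_(i <- l | P i) F i) (\sum_(i <- l | P i) f i).
Proof.
by move=> H; elim/big_rec2: _ => [|i x y Pi]; [exact: gle0|apply: gleD; exact: H].
Qed.

(** N a <= (N 1)^n N a, which tends to 0 if N 1 < 1. Hence [~ B 1 1] is the form in which a seminorm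
    is nonzero below. *)
Lemma gauge_degenerate a r : B 1 1 -> 0 < r -> B a r.
Proof.
move=> /(gauge_open gB)[s s1 Bs] r0.
have [t Bt] := gauge_total gB a; have t0 := gauge_gt0 gB Bt.
have s0 := gauge_gt0 gB Bs.
have [n /(_ n (leqnn n)) nr] : exists n, forall m, (n <= m)%N -> s ^+ m < r / t.
  by apply: expr_small; [exact: ltW| |exact: divr_gt0].
apply: (@gle_lt _ (s ^+ n * t)); last by rewrite -ltr_pdivlMr.
rewrite -[a]mul1r -(expr1n _ n); apply: gleM; last exact: gltW.
by apply: gleX; apply: gltW.
Qed.

(** With k = q m + i and i < m, replacing N(a^i) by r^i costs at most the factor (1 + t/r)^m. *)
Lemma gle_pow a t r m : gle B a t -> 0 < r -> (0 < m)%N -> B (a ^+ m) (r ^+ m) ->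
  forall k, gle B (a ^+ k) ((1 + t / r) ^+ m * r ^+ k).
Proof.
move=> Ha r0 m0 Hm k.
have t0 := gle_ge0 Ha; have tr : 0 <= t / r by rewrite divr_ge0// ltW.
rewrite (divn_eq k m); set q := (k %/ m)%N; set i := (k %% m)%N.
have im : (i < m)%N by rewrite ltn_mod.
rewrite exprD mulnC exprM.
have := gleM (gleX q (gltW Hm)) (gleX i Ha); apply: gle_le.
rewrite [r ^+ (_ + _)]exprD exprM mulrCA ler_wpM2l ?exprn_ge0 ?(ltW r0)//.
rewrite -ler_pdivrMr ?exprn_gt0// -expr_div_n.
apply: (@le_trans _ _ ((1 + t / r) ^+ i)).
  by rewrite lerXn2r ?nnegrE//; lra.
by rewrite ler_weXn2l// ?(ltnW im)//; lra.
Qed.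

End Theory.

(** The quotient seminorm modulo the ideal of [y]. By the Neumann series, [gquot B y 1 1] says that
    [y] is invertible in the completion. *)
Definition gquot B y a r := exists b, B (a + y * b) r.

Lemma gquotW B y a r : B a r -> gquot B y a r.
Proof. by exists 0; rewrite mulr0 addr0. Qed.

Lemma gle_gquot B y a r : gle B a r -> gle (gquot B y) a r.
Proof. by move=> H e e0; apply: gquotW; exact: H. Qed.

Lemma gquot_gauge B y : gauge B -> gauge (gquot B y).
Proof.
move=> gB; split.
- by move=> a r [b Hb]; exact: (gauge_gt0 gB Hb).
- move=> a b r s [a' Ha] [b' Hb]; exists (a' + b').
  by rewrite mulrDr addrACA; apply: gaugeD.
- move=> a b r s [a' Ha] [b' Hb]; exists (a * b' + a' * b + y * (a' * b')).
  by have := gaugeM gB Ha Hb; congr (B _ _); ring.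
- by move=> c r cr; apply: gquotW; exact: (gaugeC gB cr).
- by move=> a r s rs [b Hb]; exists b; apply: gauge_le Hb.
- by move=> a r [b /(gauge_open gB)[s sr Hs]]; exists s => //; exists b.
- by move=> a; have [r Hr] := gauge_total gB a; exists r; apply: gquotW.
Qed.

Lemma gquot_ideal B y b : gauge B -> gle (gquot B y) (y * b) 0.
Proof.
by move=> gB e e0; exists (- b); rewrite mulrN subrr; apply: (gle0 gB).
Qed.

End Gauge.

(** * Roots of unity of order 2^m, which square roots provide *)

Section RootsOfUnity.
Context {R : realType}.
Local Notation C := (Cx R).

Definition Csqrt (z : C) : C := sqrtc (z : R[i]).

Lemma sqr_Csqrt z : Csqrt z ^+ 2 = z.
Proof. exact: (@sqr_sqrtc R z). Qed.

(* the 2^m-th roots of unity *)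
Fixpoint unit_roots m : seq C :=
  if m is m'.+1 then
    map Csqrt (unit_roots m') ++ map (fun z => - Csqrt z) (unit_roots m')
  else [:: 1].

Lemma size_unit_roots m : size (unit_roots m) = (2 ^ m)%N.
Proof.
by elim: m => // m IH; rewrite /= size_cat !size_map IH expnS mul2n addnn.
Qed.

Lemma unit_roots_expr m w : w \in unit_roots m -> w ^+ (2 ^ m) = 1.
Proof.
elim: m w => [|m IH] w /=; first by rewrite inE => /eqP ->.
by rewrite mem_cat => /orP[]/mapP[z /IH zm ->];
  rewrite expnS exprM ?sqrrN sqr_Csqrt.
Qed.

Lemma unit_roots_neq0 m w : w \in unit_roots m -> w != 0.
Proof.
move=> /unit_roots_expr; apply: contra_eqN => /eqP ->.
by rewrite expr0n expn_eq0 eq_sym oner_eq0.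
Qed.

Lemma modulus_unit_roots m w : w \in unit_roots m -> modulus w = 1.
Proof.
move=> /unit_roots_expr wm; apply/eqP.
have := congr1 (@modulus R) wm; rewrite modulusX modulus1.
by move=> /eqP; rewrite pexpr_eq1 ?expn_gt0// ?modulus_ge0.
Qed.

(** Odd powers cancel between the roots w and -w; even powers reduce to half the order. *)
Lemma sum_unit_roots_expr m i : (0 < i < 2 ^ m)%N ->
  \sum_(w <- unit_roots m) w ^+ i = 0.
Proof.
elim: m i => [|m IH] i; first by rewrite expn0 ltnS; case: i.
move=> /andP[i0 im]; rewrite /= big_cat !big_map/= -big_split/=.
have : i = (odd i + 2 * i./2)%N by rewrite mul2n odd_double_half.
case: (odd i) => E; rewrite E.
  by rewrite big1// => w _; rewrite add1n !exprS !exprM sqrrN mulNr subrr.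
under eq_bigr => w _ do rewrite add0n !exprM sqrrN sqr_Csqrt -mulr2n.
rewrite sumrMnl IH ?mul0rn//.
by apply/andP; split; move: im; rewrite expnS; lia.
Qed.

End RootsOfUnity.

(** * Approximate resolvents and the spectral radius *)

Section GelfandMazur.
Context {R : realType} {A : comNzRingType} (iota : {rmorphism Cx R -> A}).
Local Notation C := (Cx R).
Variable B : A -> R -> Prop.
Hypothesis gB : gauge iota B.

Let gleZ' := gleZ gB.

Lemma gle_geometric u r n : gle B u r -> r < 1 ->
  gle B (\sum_(i < n) u ^+ i) (1 - r)^-1.
Proof.
move=> ur r1; have r0 := gle_ge0 gB ur.
have H : gle B (\sum_(i < n) u ^+ i) (\sum_(i < n) r ^+ i).
  by apply: (gle_sum gB) => i _; apply: (gleX gB).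
apply: gle_le H.
have := subrX1 r n; rewrite -opprB => /(congr1 -%R).
rewrite -mulNr !opprB => E.
rewrite -[leRHS]mul1r ler_pdivlMr; last lra.
rewrite mulrC -E.
by have := exprn_ge0 n r0; lra.
Qed.

(* an approximate inverse [b] of [c] can be improved to any precision
   without losing control of its norm *)
Lemma approx_inverse c b r s : gle B (1 - c * b) r -> r < 1 -> gle B b s ->
  forall e, 0 < e -> exists b', gle B (1 - c * b') e /\ gle B b' (s * (1 - r)^-1).
Proof.
move=> Hr r1 Hb e e0; have r0 := gle_ge0 gB Hr.
have [n /(_ n (leqnn n)) rn] := expr_small r0 r1 e0.
set u := 1 - c * b in Hr.
exists (b * \sum_(i < n) u ^+ i); split; last exact: (gleM gB Hb (gle_geometric n Hr r1)).
have -> : 1 - c * (b * \sum_(i < n) u ^+ i) = u ^+ n.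
  rewrite mulrA (_ : c * b = - (u - 1)); last by rewrite /u; ring.
  by rewrite mulNr -subrX1; ring.
by apply: (gle_le _ (gleX gB n Hr)); apply: ltW.
Qed.

(** Takes the place of a bound for the resolvent of [a]: approximate inverses of every precision
    [e], with one bound [b] for all of them. *)
Definition resolvent_bound (a : A) (b : R) (U : set C) := forall e, 0 < e ->
  forall l, U l -> exists c, gle B (1 - (iota l - a) * c) e /\ gle B c b.

(** An approximate inverse at one point still serves at nearby points, and [approx_inverse] refines
    it at a fixed cost; the annulus is compact. *)
Lemma resolvent_bounded a r s :
  (forall l, r <= modulus l -> modulus l <= s -> gquot B (a - iota l) 1 1) ->
  exists2 b, 0 < b &
    resolvent_bound a b [set l | r <= modulus l /\ modulus l <= s].
Proof.
move=> H.
pose P (U : set C) := exists2 b, 0 < b & resolvent_bound a b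
  [set l | [/\ U l, r <= modulus l & modulus l <= s]].
suff [b b0 Pb] : P [set l | modulus l <= s].
  by exists b => // e e0 l [rl ls]; apply: Pb.
apply: disc_ind.
- move=> U V UV [b b0 Pb]; exists b => // e e0 l [Ul rl ls].
  by apply: Pb => //; split=> //; apply: UV.
- move=> U V [b b0 Pb] [c c0 Pc]; exists (b + c); first exact: addr_gt0.
  move=> e e0 l [[Ul|Vl] rl ls].
    have [|d [d1 d2]] := Pb _ e0 l; first by split.
    exists d; split=> //.
    by apply: (gle_le _ d2); lra.
  have [|d [d1 d2]] := Pc _ e0 l; first by split.
    exists d; split=> //.
  by apply: (gle_le _ d2); lra.
- move=> p; have [pr|rp] := ltP (modulus p) r.
    exists (r - modulus p); first by lra.
    exists 1 => // e e0 l [/= lp rl _].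
    by have := modulus_lb l p; lra.
  have [sp|ps] := ltP s (modulus p).
    exists (modulus p - s); first by lra.
    exists 1 => // e e0 l [/= lp _ rl].
    by have := modulus_lb p l; rewrite modulusBC; lra.
  have [c Hc] := H p rp ps.
  have [t [t0 t1 Ht]] := glt_ex gB Hc.
  have [k k0 Hk] := gle_total gB c.
  exists ((1 - t) / 2 / k); first by rewrite !divr_gt0//; lra.
  exists (k * (1 - (1 + t) / 2)^-1).
    by rewrite mulr_gt0// invr_gt0; lra.
  move=> e e0 l [/= lp _ _].
  apply: (@approx_inverse _ c ((1 + t) / 2)) => //; last by lra.
  have -> : 1 - (iota l - a) * c =
      1 + (a - iota p) * c + iota (p - l) * c by rewrite rmorphB/=; ring.
  apply: (gle_le _ (gleD gB Ht (gleZ' (lexx _) Hk))).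
  by move: lp; rewrite modulusBC ltr_pdivlMr// => /ltW; lra.
Qed.


(** A Riemann sum for 1/(2 pi i) times the integral of [b] over the circle of radius [r]. *)
Definition circle_mean (b : C -> A) (r : R) m : A :=
  iota ((2 ^ m)%:R^-1) *
  \sum_(w <- unit_roots m) iota (RtoC r / w) * b (RtoC r / w).

(** With M = 2^m and x = a/r, the mean of (1 - w x)^-1 over the roots w of w^M = 1 is (1 - x^M)^-1:
    each (1 - x^M)(1 - w x)^-1 is a geometric sum of length M, of which only the term of exponent 0
    survives the averaging. *)
Lemma circle_mean_inverse a b r t e m : 0 < r -> gle B a t ->
  (forall w, w \in unit_roots m ->
     gle B (1 - (iota (RtoC r / w) - a) * b (RtoC r / w)) e) ->
  gle B (1 - (1 - (iota (RtoC r)^-1 * a) ^+ (2 ^ m)) * circle_mean b r m)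
    (e * \sum_(i < 2 ^ m) (t / r) ^+ i).
Proof.
move=> r0 at_ be; set M := (2 ^ m)%N; set x := iota _ * a.
have r0C : RtoC r != 0 by rewrite (fmorph_eq0 RtoC) gt_eqF.
have M0 : (M%:R : C) != 0 by rewrite pnatr_eq0 expn_eq0.
pose err w := 1 - (iota (RtoC r / w) - a) * b (RtoC r / w).
have mean_w w : w \in unit_roots m ->
    (1 - x ^+ M) * (iota (RtoC r / w) * b (RtoC r / w)) =
    (\sum_(i < M) (iota w * x) ^+ i) - (\sum_(i < M) (iota w * x) ^+ i) * err w.
  move=> wU; have w0 := unit_roots_neq0 wU.
  have -> : x ^+ M = (iota w * x) ^+ M.
    by rewrite [RHS]exprMn -(rmorphXn iota) unit_roots_expr// rmorph1 mul1r.
  have -> : 1 - (iota w * x) ^+ M =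
      (1 - iota w * x) * \sum_(i < M) (iota w * x) ^+ i.
    by have := subrX1 (iota w * x) M => /(congr1 -%R); rewrite -mulNr !opprB.
  have E : (1 - iota w * x) * iota (RtoC r / w) = iota (RtoC r / w) - a.
    have E1 : iota w * iota (RtoC r)^-1 * iota (RtoC r / w) = 1.
      rewrite -2!(rmorphM iota) -(rmorph1 iota); congr (iota _).
      by field; apply/andP.
    rewrite mulrBl mul1r -[in RHS](mul1r a) -E1 /x.
    by congr (_ - _); ring.
  by rewrite /err -E; ring.
rewrite (_ : 1 - _ = iota M%:R^-1 * \sum_(w <- unit_roots m)
    (\sum_(i < M) (iota w * x) ^+ i) * err w); last first.
  rewrite /circle_mean -/M mulrCA [X in 1 - _ * X]mulr_sumr.
  rewrite (eq_big_seq _ mean_w) sumrB mulrBr opprB addrCA.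
  rewrite -[RHS]addr0; congr (_ + _); apply/eqP; rewrite subr_eq0; apply/eqP.
  rewrite exchange_big/= (bigD1 (Ordinal (expn_gt0 2 m : (0 < M)%N)))//=.
  rewrite [X in _ + X]big1 ?addr0 => [|i i0].
    under eq_bigr do rewrite expr0.
    rewrite big_const_seq count_predT size_unit_roots iter_addr_0 -/M.
    by rewrite -(rmorph_nat iota) -(rmorphM iota) mulVf ?rmorph1.
  under eq_bigr do rewrite exprMn -(rmorphXn iota).
  rewrite -mulr_suml -(rmorph_sum iota)/= sum_unit_roots_expr ?rmorph0 ?mul0r//.
  by rewrite ltn_ord andbT lt0n; apply: contra i0 => /eqP i0; apply/eqP/val_inj.
pose s := \sum_(i < M) (t / r) ^+ i.
have H : gle B (\sum_(w <- unit_roots m | w \in unit_roots m)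
    (\sum_(i < M) (iota w * x) ^+ i) * err w)
    (\sum_(w <- unit_roots m | w \in @unit_roots R m) s * e).
  apply: (gle_sum gB) => w wU; apply: (gleM gB); last exact: be.
  apply: (gle_sum gB) => i _; apply: (gleX gB).
  rewrite -[t / r]mul1r; apply: gleZ'; first by rewrite (modulus_unit_roots wU).
  rewrite mulrC; apply: gleZ' => //.
  by rewrite modulusV modulus_RtoC_ge0// ltW.
rewrite -!big_seq in H.
have cM : modulus (M%:R^-1 : C) <= M%:R^-1 by rewrite modulusV modulus_natr.
have := gleZ' cM H.
apply: gle_le; rewrite big_const_seq count_predT size_unit_roots iter_addr_0 -/M.
have MR : (M%:R : R) != 0 by rewrite pnatr_eq0 expn_eq0.
by rewrite -(mulr_natr (s * e)) mulrCA mulVf// mulr1 mulrC.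
Qed.


(* [a] has spectral radius less than [r] *)
Definition radius_lt (a : A) (r : R) := exists2 M, (0 < M)%N & B (a ^+ M) (r ^+ M).

Lemma radius_lt_le a r s : 0 < r -> r <= s -> radius_lt a r -> radius_lt a s.
Proof.
move=> r0 rs [M M0 H]; exists M => //; apply: (gauge_le gB) H.
by rewrite lerXn2r ?nnegrE//; lra.
Qed.

(** The mean [T p m] over the circle of radius p approximates (1 - (a/p)^M)^-1. It is near 1 for p =
    q + 2d, where (a/p)^M is small. By the resolvent equation it varies little from there to p = q,
    so it is near 1 at q too, and (a/q)^M has norm less than 1. As [d0] does not depend on q, the
    step can be iterated. *)
Lemma radius_step a r s b : 0 < r -> 0 < b ->
  resolvent_bound a b [set l | r <= modulus l /\ modulus l <= s] ->
  exists2 d0, 0 < d0 & forall d q, 0 < d -> d <= d0 -> r <= q -> q + 2 * d <= s ->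
    radius_lt a (q + d) -> radius_lt a q.
Proof.
move=> r0 b0 Hb.
pose S := `|s| + 1.
have S0 : 0 < S by rewrite /S; have := normr_ge0 s; lra.
have sS : s <= S by rewrite /S; have := ler_norm s; lra.
(* Up to the defects of the approximate inverses, a Lipschitz constant of l |-> l (l - a)^-1 on the
   annulus. *)
pose k := S * b ^+ 2 + b.
have k0 : 0 < k by rewrite /k addr_gt0// mulr_gt0// exprn_gt0.
exists (32 * k)^-1 => [|d q d0 dk' rq qs [n n0 Hn]]; first by rewrite invr_gt0; lra.
have dk : 2 * d * k <= 1 / 16.
  have kk : (32 * k)^-1 * k = 1 / 32 by field; rewrite gt_eqF.
  by have := ler_wpM2r (ltW k0) dk'; rewrite kk; lra.
have q0 : 0 < q by lra.
pose q1 := q + 2 * d.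
have [t t0 Ht] := gle_total gB a.
have Hp := gle_pow gB Ht (ltr_wpDl (ltW q0) d0) n0 Hn.
set K := (1 + _) ^+ n in Hp.
have K0 : 0 < K by rewrite exprn_gt0// ltr_wpDr// divr_ge0; lra.
have w0 : 0 <= (q + d) / q1 by rewrite divr_ge0 /q1; lra.
have w1 : (q + d) / q1 < 1 by rewrite ltr_pdivrMr /q1; lra.
have e0 : 0 < (16 * K * S * b)^-1 by rewrite invr_gt0 !mulr_gt0.
have [m Hm] := expr_small w0 w1 e0.
have {}Hm : ((q + d) / q1) ^+ (2 ^ m) < (16 * K * S * b)^-1.
  by apply: Hm; apply: ltnW; apply: ltn_expl.
pose M := (2 ^ m)%N.
pose sg (q : R) := \sum_(i < M) (t / q) ^+ i.
have sg0 p : 0 < p -> 0 <= sg p.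
  by move=> p0; apply: sumr_ge0 => i _; rewrite exprn_ge0// divr_ge0 ?ltW.
pose e := (16 * (1 + sg q + sg q1 + 2 * S * b))^-1.
have [sgq sgq1] : 0 <= sg q /\ 0 <= sg q1 by split; apply: sg0; rewrite /q1; lra.
have Sb0 : 0 < S * b by rewrite mulr_gt0.
have e'0 : 0 < e by rewrite invr_gt0; lra.
have eE : e * (1 + sg q + sg q1 + 2 * S * b) = 1 / 16.
  by rewrite /e; field; lra.
have esq : e * sg q <= 1 / 16 by nra.
have esq1 : e * sg q1 <= 1 / 16 by nra.
have eSb : 2 * S * b * e <= 1 / 16 by nra.
have /choice[c Hc] : forall l, exists c, r <= modulus l /\ modulus l <= s ->
    gle B (1 - (iota l - a) * c) e /\ gle B c b.
  move=> l; have [H|H] := pselect (r <= modulus l /\ modulus l <= s).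
    by have [c Hc] := Hb _ e'0 l H; exists c.
  by exists 0.
have modl p w : 0 < p -> w \in unit_roots m -> modulus (RtoC p / w) = p.
  move=> p0 /modulus_unit_roots wm.
  by rewrite modulusM modulusV wm invr1 mulr1 modulus_RtoC_ge0// ltW.
have q1q : r <= q1 /\ q1 <= s by rewrite /q1; lra.
have qq : r <= q /\ q <= s by lra.
have q10 : 0 < q1 by lra.
have Hcq p w : r <= p /\ p <= s -> w \in unit_roots m ->
    gle B (1 - (iota (RtoC p / w) - a) * c (RtoC p / w)) e /\
    gle B (c (RtoC p / w)) b.
  by move=> ps wU; apply: Hc; rewrite modl//; lra.
set T := circle_mean c.
have TI p : r <= p /\ p <= s ->
    gle B (1 - (1 - (iota (RtoC p)^-1 * a) ^+ M) * T p m) (e * sg p).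
  by move=> ps; apply: circle_mean_inverse => // [|w wU]; [lra|have [] := Hcq _ _ ps wU].
have gmean (F : C -> A) f : (forall w, w \in unit_roots m -> gle B (F w) f) ->
    gle B (iota (2 ^ m)%:R^-1 * \sum_(w <- unit_roots m) F w) f.
  move=> HF.
  have H : gle B (\sum_(w <- unit_roots m | w \in unit_roots m) F w)
      (\sum_(w <- unit_roots m | w \in @unit_roots R m) f).
    by apply: (gle_sum gB).
  rewrite -!big_seq in H.
  have cM : modulus ((2 ^ m)%:R^-1 : C) <= (2 ^ m)%:R^-1.
    by rewrite modulusV modulus_natr.
  have := gleZ' cM H.
  apply: gle_le; rewrite big_const_seq count_predT size_unit_roots iter_addr_0.
  have MR : ((2 ^ m)%:R : R) != 0 by rewrite pnatr_eq0 expn_eq0.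
  by rewrite -(mulr_natr f) mulrCA mulVf// mulr1.
have T1b : gle B (T q1 m) (q1 * b).
  apply: gmean => w wU; have [_ H] := Hcq _ _ q1q wU.
  by apply: gleZ'; rewrite ?modl.
have dT : gle B (T q1 m - T q m) (1 / 8).
  rewrite /T /circle_mean -mulrBr -sumrB; apply: gmean => w wU.
  have [H1 H2] := Hcq _ _ q1q wU; have [H3 H4] := Hcq _ _ qq wU.
  set l1 := RtoC q1 / w in H1 H2 *; set l := RtoC q / w in H3 H4 *.
  have ll : modulus (l1 - l) = 2 * d.
    rewrite /l1 /l -mulrBl -rmorphB /= modl//; first by rewrite /q1; ring.
    by rewrite /q1; lra.
  (* The resolvent equation, corrected by the defects of [c l] and [c l1]. *)
  have -> : iota l1 * c l1 - iota l * c l =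
      iota l1 * (iota (l - l1) * (c l1 * c l) + c l1 * (1 - (iota l - a) * c l)
         - c l * (1 - (iota l1 - a) * c l1)) + iota (l1 - l) * c l.
    by rewrite !rmorphB/=; ring.
  have N1 : gle B (iota (l - l1) * (c l1 * c l)) (2 * d * (b * b)).
    by apply: gleZ'; [rewrite modulusBC ll|apply: (gleM gB)].
  have N2 := gleB gB (gleD gB N1 (gleM gB H2 H3)) (gleM gB H4 H1).
  have ml1 : modulus l1 <= q1 by rewrite modl.
  have mll : modulus (l1 - l) <= 2 * d by rewrite ll.
  have := gleD gB (gleZ' ml1 N2) (gleZ' mll H4).
  apply: gle_le.
  have q1S : q1 <= S by lra.
  have : q1 * (2 * d * (b * b) + b * e + b * e) <= S * (2 * d * (b * b) + b * e + b * e).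
    by apply: ler_wpM2r => //; rewrite !addr_ge0 ?mulr_ge0; lra.
  by move: dk; rewrite /k expr2; lra.
have xq1 : gle B ((iota (RtoC q1)^-1 * a) ^+ M) (16 * S * b)^-1.
  rewrite exprMn -(rmorphXn iota).
  have c1 : modulus ((RtoC q1)^-1 ^+ M) <= q1^-1 ^+ M.
    by rewrite modulusX modulusV modulus_RtoC_ge0// ltW.
  apply: gle_le (gleZ' c1 (Hp M)).
  rewrite mulrCA -exprMn [_^-1 * _]mulrC.
  have := ler_wpM2l (ltW K0) (ltW Hm); move/le_trans; apply.
  rewrite [leLHS](_ : _ = (16 * S * b)^-1)//; field.
  by rewrite !gt_eqF.
have T11 : gle B (T q1 m - 1) (1 / 8).
  have -> : T q1 m - 1 = (iota (RtoC q1)^-1 * a) ^+ M * T q1 m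
      - (1 - (1 - (iota (RtoC q1)^-1 * a) ^+ M) * T q1 m) by ring.
  apply: gle_le (gleB gB (gleM gB xq1 T1b) (TI _ q1q)).
  have : (16 * S * b)^-1 * (q1 * b) <= (16 * S * b)^-1 * (S * b).
    by rewrite ler_wpM2l ?invr_ge0 ?ler_wpM2r ?mulr_ge0//; lra.
  rewrite [X in _ <= X -> _](_ : _ = 1 / 16); first lra.
  by field; rewrite !gt_eqF.
pose u := T q m - 1.
have Hu : gle B u (1 / 4).
  have -> : u = (T q1 m - 1) - (T q1 m - T q m) by rewrite /u; ring.
  by apply: gle_le (gleB gB T11 dT); lra.
pose y := (iota (RtoC q)^-1 * a) ^+ M.
(* This equation contracts [y] by the factor 1/4, so iteration improves any a priori bound [y0] to
   one below 1. *)
have yE : y = u + (1 - (1 - y) * T q m) - y * u by rewrite /u; ring.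
have [y0 y00 Hy0] := gle_total gB y.
have Hy j : gle B y (1 / 2 + y0 * (1 / 4) ^+ j).
  elim: j => [|j IH]; first by apply: gle_le Hy0; rewrite expr0; lra.
  rewrite yE; apply: gle_le (gleB gB (gleD gB Hu (TI _ qq)) (gleM gB IH Hu)).
  by rewrite exprS; lra.
have [j Hj] : exists n, forall m, (n <= m)%N -> (1 / 4 : R) ^+ m < 1 / 4 / y0.
  by apply: expr_small; rewrite ?divr_gt0//; lra.
have {}Hj := Hj j (leqnn j).
have y1 : B y 1.
  apply: gle_lt (Hy j) _.
  by move: Hj; rewrite ltr_pdivlMr// mulrC; lra.
exists M; first by rewrite expn_gt0.
have c2 : modulus (RtoC q ^+ M) <= q ^+ M.
  by rewrite modulusX modulus_RtoC_ge0// ltW.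
have [z [z0 z1 Hz]] := glt_ex gB y1.
have := gleZ' c2 Hz; rewrite /y exprMn -(rmorphXn iota) mulrA -rmorphM -exprMn.
rewrite divff ?expr1n ?rmorph1 ?mul1r ?(fmorph_eq0 RtoC) ?gt_eqF// => /gle_lt; apply.
by rewrite gtr_pMr// exprn_gt0.
Qed.

End GelfandMazur.

(** * Characters: Gelfand-Mazur and the spectral radius formula *)

Section Spectrum.
Context {R : realType} {A : comNzRingType} (iota : {rmorphism Cx R -> A}).
Local Notation C := (Cx R).
Implicit Types (B : A -> R -> Prop) (a b : A).

(** Otherwise the approximate resolvent is bounded on the annulus from [r] to [s], and [radius_step]
    lowers a bound for the spectral radius from [s0] > N a down to [r] by steps of a fixed size. *)
Lemma gelfand_mazur_radius B a r : gauge iota B -> ~ B 1 1 -> 0 < r ->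
  ~ radius_lt B a r ->
  exists2 l, r <= modulus l & ~ gquot B (a - iota l) 1 1.
Proof.
move=> gB B1 r0 nr; apply: contrapT => H.
have [t t0 Ht] := gle_total gB a.
pose s0 := t + r + 1; pose s := s0 + 1.
have [l rl _|b b0 Hb] := @resolvent_bounded _ _ iota B gB a r s.
  by apply: contrapT => nl; apply: H; exists l.
have [d d0 Hd] := radius_step gB r0 b0 Hb.
(* The bound 1/4 keeps q + 2 d' below [s]. *)
pose d' := Num.min d (1 / 4).
have d'0 : 0 < d' by rewrite lt_min d0; lra.
have [d'd d'1] : d' <= d /\ d' <= 1 / 4 by rewrite !ge_min !lexx orbT.
apply: nr.
have Hn n : radius_lt B a (Num.max r (s0 - n%:R * d')).
  elim: n => [|n IH].
    exists 1%N => //; rewrite !expr1 mul0r subr0; apply: gle_lt Ht _.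
    by rewrite lt_max; apply/orP; right; rewrite /s0; lra.
  set q := Num.max r (s0 - n.+1%:R * d').
  have qr : r <= q by rewrite le_max lexx.
  have qs0 : q <= s0.
    by rewrite ge_max /s0 lerBlDr lerDl mulr_ge0// ?(ltW d'0)// andbT; lra.
  apply: (Hd d') => //; first by rewrite /s; lra.
  apply: (radius_lt_le gB) IH; first by rewrite lt_max r0.
  rewrite ge_max; apply/andP; split; first lra.
  have : s0 - n.+1%:R * d' <= q by rewrite le_max lexx orbT.
  by rewrite -natr1; lra.
have [n Hnn] : exists n : nat, s0 / d' <= n%:R.
  exists (Num.Def.archi_bound (s0 / d')).
  by apply/ltW/archi_boundP; rewrite divr_ge0 ?(ltW d'0)// /s0; lra.
have := Hn n; rewrite max_l//.
by move: Hnn; rewrite ler_pdivrMr//; lra.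
Qed.

(** If the spectral radius of [a] is at least some r > 0, [gelfand_mazur_radius] applies. If it is
    0, take l = 0: a quasi-nilpotent element is invertible only for the zero seminorm. *)
Lemma gelfand_mazur B a : gauge iota B -> ~ B 1 1 ->
  exists l, ~ gquot B (a - iota l) 1 1.
Proof.
move=> gB B1.
have [[r [r0 nr]]|H] := pselect (exists r, 0 < r /\ ~ radius_lt B a r).
  by have [l _ nl] := gelfand_mazur_radius gB B1 r0 nr; exists l.
exists 0 => -[b]; rewrite rmorph0 subr0 => Hb.
have [r [r0 r1 Hr]] := glt_ex gB Hb.
have [t t0 Ht] := gle_total gB b.
pose u := 1 + a * b; rewrite -/u in Hr.
have abE : a * b = - (1 - u) by rewrite /u; ring.
pose g := (1 - r)^-1.
have g0 : 0 < g by rewrite invr_gt0; lra.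
have tg0 : 0 < 1 / 4 / (t * g) by rewrite divr_gt0 ?mulr_gt0//; lra.
have [M M0 HM] : radius_lt B a (1 / 4 / (t * g)).
  by apply: contrapT => nr; apply: H; exists (1 / 4 / (t * g)).
(* [1 = u^n + (1 - u) S_n], where [(1 - u)^M] is small *)
pose S n := \sum_(i < n) u ^+ i.
have SE n : 1 - u ^+ n = - (a * b * S n).
  by rewrite abE -mulNr opprK /S; have := subrX1 u n => /(congr1 -%R);
    rewrite -mulNr !opprB.
have small n : gle B ((1 - u ^+ n) ^+ M) ((1 / 4) ^+ M).
  rewrite SE exprNn !exprMn -(rmorph1 iota) -rmorphN -rmorphXn.
  have cM : modulus ((-1) ^+ M : C) <= 1 by rewrite modulusX modulusN modulus1 expr1n.
  have := gleM gB (gleM gB (gltW gB HM) (gleX gB M Ht)) (gleX gB M (gle_geometric gB n Hr r1)).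
  move=> /(gleZ gB cM); rewrite -!exprMn mul1r; apply: gle_le.
  rewrite -/g [X in X ^+ M](_ : _ = 1 / 4)//.
  by field; rewrite !gt_eqF.
pose K := \sum_(i < M) (2 : R) ^+ i.
have K0 : 0 < K.
  case: (M) M0 @K => // m _; rewrite /= big_ord_recl expr0.
  by rewrite ltr_pwDl// sumr_ge0.
have [n Hn] : exists n, forall m, (n <= m)%N -> r ^+ m < 1 / 2 / K.
  by apply: expr_small; rewrite ?divr_gt0//; lra.
have {}Hn := Hn n (leqnn n).
have Hun := gleX gB n Hr.
have d2 : gle B (1 - u ^+ n) 2.
  apply: gle_le (gleB gB (gle1 gB) Hun).
  by have := exprn_ile1 n r0 (ltW r1); lra.
set v := 1 - u ^+ n in small d2.
have vE : 1 = v ^+ M + u ^+ n * \sum_(i < M) v ^+ i.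
  have uE : u ^+ n = 1 - v by rewrite /v; ring.
  have -> : v ^+ M = 1 + (v - 1) * \sum_(i < M) v ^+ i by rewrite -subrX1; ring.
  by rewrite uE; ring.
have Hsum : gle B (\sum_(i < M) v ^+ i) K.
  by apply: (gle_sum gB) => i _; apply: (gleX gB).
have /gle_lt : gle B 1 ((1 / 4) ^+ M + r ^+ n * K).
  by rewrite {1}vE; apply: (gleD gB (small n) (gleM gB Hun Hsum)).
move=> /(_ 1) H1; apply: B1; apply: H1.
have : (1 / 4 : R) ^+ M <= 1 / 4.
  by case: (M) M0 => // m _; rewrite exprS ler_piMr ?exprn_ile1//; lra.
by move: Hn; rewrite ltr_pdivlMr//; lra.
Qed.


(** [A] is to behave like a polynomial ring with variables [x]: the points of C^J give characters,
    and by [taylor] the kernel of [ev z] is generated by the x_j - z_j. *)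
Variables (J : finType) (x : J -> A) (ev : (J -> C) -> {rmorphism A -> C}).
Hypothesis ev_iota : forall z c, ev z (iota c) = c.
Hypothesis taylor : forall a z, exists b : J -> A,
  a = iota (ev z a) + \sum_j (x j - iota (z j)) * b j.

Definition spectrum B : set (J -> C) :=
  [set z | forall a r, B a r -> modulus (ev z a) < r].

Lemma spectrum_sub B B' : (forall a r, B a r -> B' a r) ->
  spectrum B' `<=` spectrum B.
Proof. by move=> BB' z zB a r /BB'; apply: zB. Qed.

Lemma spectrum_gle B z a r : gauge iota B -> spectrum B z -> gle B a r ->
  modulus (ev z a) <= r.
Proof.
move=> gB zB Ba; rewrite leNgt; apply/negP => ra.
by have := zB _ _ (gle_lt Ba ra); rewrite ltxx.
Qed.

(** Impose the relations x_j = z_j one after the other, with z_j from [gelfand_mazur], so that the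
    quotient seminorm remains nonzero. At the end [taylor] makes every [a] equivalent to the scalar
    [ev z a]. *)
Lemma spectrum_nonempty B : gauge iota B -> ~ B 1 1 -> exists z, spectrum B z.
Proof.
move=> gB B1.
have [z [B' [gB' B'1 BB' Hz]]] : exists z B', [/\ gauge iota B', ~ B' 1 1,
    forall a r, B a r -> B' a r &
    forall j b, j \in enum J -> gle B' ((x j - iota (z j)) * b) 0].
  elim: (enum J) => [|j s [z [B' [gB' B'1 BB' Hz]]]].
    by exists (fun=> 0), B; split.
  have [l nl] := gelfand_mazur (x j) gB' B'1.
  exists (fun i => if i == j then l else z i), (gquot B' (x j - iota l)); split=> //.
  - exact: gquot_gauge.
  - by move=> a r /BB'; apply: gquotW.
  - move=> i b; rewrite inE; case: eqP => [->|_ /=] => [_|js].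
      exact: gquot_ideal gB'.
    by apply: gle_gquot; apply: Hz.
exists z => a r Ba; rewrite ltNge; apply/negP => ra.
have r0 := gauge_gt0 gB Ba.
have [s [s0 sr Hs]] := glt_ex gB' (BB' _ _ Ba).
have [b bE] := taylor a z.
have : gle B' (iota (ev z a)) s.
  rewrite (_ : iota _ = a - \sum_j (x j - iota (z j)) * b j).
    have : gle B' (\sum_j (x j - iota (z j)) * b j) (\sum_(j : J) 0).
      by apply: (gle_sum gB') => j _; apply: Hz; rewrite mem_enum.
    by rewrite sumr_const mul0rn => H; have := gleB gB' Hs H; rewrite addr0.
  by rewrite [in RHS]bE addrK.
move=> /(gleZ gB' (lexx (modulus (ev z a)^-1))).
have e0 : ev z a != 0 by rewrite -modulus_gt0; lra.
rewrite -rmorphM mulVf// rmorph1 modulusV => /gle_lt H; apply: B'1; apply: H.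
by rewrite mulrC ltr_pdivrMr ?modulus_gt0// mul1r; lra.
Qed.

Lemma spectrum_gquot B y z : gauge iota B -> spectrum (gquot B y) z ->
  spectrum B z /\ ev z y = 0.
Proof.
move=> gB Hz; split; first by apply: spectrum_sub Hz => a r; apply: gquotW.
apply/eqP; rewrite -modulus_eq0 eq_le modulus_ge0 andbT.
have := spectrum_gle (gquot_gauge y gB) Hz (gquot_ideal y 1 gB).
by rewrite mulr1.
Qed.

(* the spectral radius formula *)
Lemma spectral_radius B y p r : gauge iota B -> 0 < r ->
  (forall z, spectrum B z -> ev z y = 0 -> modulus (ev z p) < r) ->
  radius_lt (gquot B y) p r.
Proof.
move=> gB r0 H; have gBy := gquot_gauge y gB.
have [B1|B1] := pselect (gquot B y 1 1).
  by exists 1%N => //; rewrite !expr1; apply: (gauge_degenerate gBy).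
apply: contrapT => nr.
(* A character of the further quotient by p - l is a point of the spectrum where [y] is 0 and [p] is
   l, with |l| >= r. *)
have [l rl nl] := gelfand_mazur_radius gBy B1 r0 nr.
have [z Hz] := spectrum_nonempty (gquot_gauge (p - iota l) gBy) nl.
have [/(spectrum_gquot gB)[zB zy]] := spectrum_gquot gBy Hz.
rewrite rmorphB/= ev_iota => /eqP; rewrite subr_eq0 => /eqP pl.
by have := H _ zB zy; rewrite pl; lra.
Qed.

End Spectrum.

(** * Sharpening of approximate idempotents *)

Section Sharpening.
Context {A : comNzRingType}.
Implicit Types a b f h : A.

(** The first half of the binomial expansion of (a + b)^(2k+1), divided by a^(k+1). *)
Definition bernstein k a b : A :=
  \sum_(i < k.+1) (a ^+ (k - i) * b ^+ i) *+ 'C(k.*2.+1, i).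

Lemma bernstein_split k a b : a + b = 1 ->
  a ^+ k.+1 * bernstein k a b + b ^+ k.+1 * bernstein k b a = 1.
Proof.
move=> ab; rewrite -[RHS](expr1n _ k.*2.+1) -ab exprDn.
rewrite -(big_mkord xpredT (fun i => (a ^+ (k.*2.+1 - i) * b ^+ i) *+ 'C(k.*2.+1, i))).
rewrite (big_cat_nat (n := k.+1))//=; last by lia.
congr (_ + _).
  rewrite mulr_sumr -(big_mkord xpredT (fun i => a ^+ k.+1 *
    ((a ^+ (k - i) * b ^+ i) *+ 'C(k.*2.+1, i)))) big_nat [RHS]big_nat.
  apply: eq_bigr => i /andP[_ ik]; rewrite mulrnAr mulrA -exprD.
  by congr (_ ^+ _ * _ *+ _); lia.
have shift (F : nat -> A) : \sum_(k.+1 <= i < k.*2.+2) F i =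
    \sum_(0 <= i < k.+1) F (i + k.+1)%N.
  rewrite -{1}[k.+1]add0n big_addn (_ : (k.*2.+2 - k.+1)%N = k.+1)//.
  by lia.
rewrite shift mulr_sumr -(big_mkord xpredT (fun i => b ^+ k.+1 *
  ((b ^+ (k - i) * a ^+ i) *+ 'C(k.*2.+1, i)))).
rewrite big_nat_rev/= big_nat [RHS]big_nat.
apply: eq_bigr => i /andP[_ ik]; rewrite mulrnAr mulrA -exprD mulrC.
have -> : ('C(k.*2.+1, 0 + k.+1 - i.+1) = 'C(k.*2.+1, i + k.+1))%N.
  by rewrite -[RHS]bin_sub; [congr 'C(_, _); lia|lia].
by congr (_ ^+ _ * _ ^+ _ *+ _); lia.
Qed.

(* an approximation of [1] near [a = 1] and of [0] near [a = 0] *)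
Definition sharp k a : A := a ^+ k.+1 * bernstein k a (1 - a).

Lemma sharpC k a : sharp k (1 - a) = 1 - sharp k a.
Proof.
have /(bernstein_split k) E : a + (1 - a) = 1 by ring.
rewrite /sharp (_ : 1 - (1 - a) = a); last by ring.
by rewrite -[X in _ = X - _]E; ring.
Qed.

(** The difference of u and v is u (1 - v) - (1 - u) v, and by [sharpC] the factors 1 - u and 1 - v
    contain powers of 1 - f and 1 - h. So it is controlled by f (1 - h) and (1 - f) h. *)
Lemma sharpB k l f h : sharp k f - sharp l h =
  (f ^+ k.+1 * (1 - h) ^+ l.+1) * (bernstein k f (1 - f) * bernstein l (1 - h) h)
  - ((1 - f) ^+ k.+1 * h ^+ l.+1) * (bernstein k (1 - f) f * bernstein l h (1 - h)).
Proof.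
have sub1 a : 1 - (1 - a) = a by ring.
have := sharpC k f; have := sharpC l h; rewrite /sharp !sub1 => Eh Ef.
rewrite [X in _ = X - _](_ : _ = sharp k f * (1 - sharp l h)); last first.
  by rewrite /sharp -Eh; ring.
rewrite [X in _ = _ - X](_ : _ = (1 - sharp k f) * sharp l h); last first.
  by rewrite /sharp -Ef; ring.
by rewrite /sharp; ring.
Qed.

End Sharpening.

Lemma rmorph_bernstein (A A' : comNzRingType) (u : {rmorphism A -> A'}) k a b :
  u (bernstein k a b) = bernstein k (u a) (u b).
Proof.
rewrite rmorph_sum; apply: eq_bigr => i _.
by rewrite rmorphMn rmorphM !rmorphXn.
Qed.

Lemma rmorph_sharp (A A' : comNzRingType) (u : {rmorphism A -> A'}) k a :
  u (sharp k a) = sharp k (u a).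
Proof. by rewrite rmorphM rmorphXn rmorph_bernstein rmorphB rmorph1. Qed.

Section SharpeningNorm.
Context {R : realType} {A : comNzRingType} (iota : {rmorphism Cx R -> A}).
Local Notation C := (Cx R).
Variable B : A -> R -> Prop.
Hypothesis gB : gauge iota B.

Definition power_bound (a : A) K r := forall i, gle B (a ^+ i) (K * r ^+ i).

Lemma gleMn a r n : gle B a r -> gle B (a *+ n) (r *+ n).
Proof.
by move=> Ha; elim: n => [|n IH]; [exact: (gle0 gB)|rewrite !mulrS; apply: (gleD gB)].
Qed.

Lemma bernstein_bound k a b K r : power_bound a K r -> power_bound b K r ->
  gle B (bernstein k a b) (K ^+ 2 * r ^+ k * 2 ^+ k.*2.+1).
Proof.
move=> Ha Hb.
have K0 : 0 <= K by have := gle_ge0 gB (Ha 0%N); rewrite expr0 mulr1.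
have r0 : 0 <= K * r by have := gle_ge0 gB (Ha 1%N); rewrite expr1.
have H : gle B (bernstein k a b)
    (\sum_(i < k.+1) (K ^+ 2 * r ^+ k) *+ 'C(k.*2.+1, i)).
  apply: (gle_sum gB) => i _; apply: gleMn.
  apply: gle_le (gleM gB (Ha _) (Hb _)).
  by rewrite mulrACA -exprD -expr2 subnK// -ltnS.
apply: gle_le H; rewrite sumrMnr -(mulr_natr (K ^+ 2 * r ^+ k)).
have K20 : 0 <= K ^+ 2 * r ^+ k.
  have [->|Kn] := eqVneq K 0; first by rewrite expr0n mul0r.
  have Kp : 0 < K by rewrite lt_def Kn.
  by rewrite mulr_ge0 ?exprn_ge0// -(pmulr_rge0 _ Kp).
apply: ler_wpM2l => //; rewrite -natrX ler_nat.
have -> : (2 ^ k.*2.+1 = \sum_(i < k.*2.+2) 'C(k.*2.+1, i))%N.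
  by rewrite -[2%N]/(1 + 1)%N expnDn; apply: eq_bigr => i _; rewrite !exp1n !muln1.
rewrite -!(big_mkord xpredT (fun i => 'C(k.*2.+1, i))).
rewrite (big_cat_nat (n := k.+1) (p := k.*2.+2))//=; last by lia.
exact: leq_addr.
Qed.

(** Each of the two Bernstein sums costs (4 r)^k and the product gains rho^k, so there is geometric
    decay as soon as 16 r^2 rho < 1. *)
Lemma sharpB_bound k f h K r rho : 1 <= K -> 0 <= rho -> 0 <= r ->
  power_bound f K r -> power_bound (1 - f) K r ->
  power_bound h K r -> power_bound (1 - h) K r ->
  power_bound (f * (1 - h)) K rho -> power_bound (h * (1 - f)) K rho ->
  gle B (sharp k f - sharp k h) (8 * K ^+ 5 * rho * (16 * r ^+ 2 * rho) ^+ k).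
Proof.
move=> K1 rho0 r0 Hf Hf' Hh Hh' Hfh Hhf.
rewrite sharpB -!exprMn [(1 - f) * h]mulrC.
have E : (K * rho ^+ k.+1) * ((K ^+ 2 * r ^+ k * 2 ^+ k.*2.+1) * (K ^+ 2 * r ^+ k * 2 ^+ k.*2.+1))
   = 4 * K ^+ 5 * rho * (16 * r ^+ 2 * rho) ^+ k.
  rewrite !exprMn !exprS -muln2 !exprM (_ : (16 : R) = 2 ^+ 2 * 2 ^+ 2); last by rewrite -!natrX -natrM.
  rewrite !exprMn !expr0; move: (2 ^+ k) (r ^+ k) (rho ^+ k) => u v w; ring.
apply: gle_le (gleB gB
  (gleM gB (Hfh k.+1) (gleM gB (bernstein_bound k Hf Hf') (bernstein_bound k Hh' Hh)))
  (gleM gB (Hhf k.+1) (gleM gB (bernstein_bound k Hf' Hf) (bernstein_bound k Hh Hh')))).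
by rewrite !E; lra.
Qed.

Lemma sharpS_bound k f K r rho : 1 <= K -> 0 <= rho -> 0 <= r ->
  power_bound f K r -> power_bound (1 - f) K r -> power_bound (f * (1 - f)) K rho ->
  gle B (sharp k.+1 f - sharp k f)
    (32 * K ^+ 6 * r ^+ 2 * rho * (16 * r ^+ 2 * rho) ^+ k).
Proof.
move=> K1 rho0 r0 Hf Hf' Hff.
move E0: (32 * K ^+ 6 * r ^+ 2 * rho * (16 * r ^+ 2 * rho) ^+ k) => T.
rewrite sharpB ![_ ^+ k.+2]exprS -![_ * _ ^+ k.+1 * _]mulrA -!exprMn.
rewrite [(1 - f) * f]mulrC -!mulrA.
have E : (K * r ^+ 1) * ((K * rho ^+ k.+1) * ((K ^+ 2 * r ^+ k.+1 * 2 ^+ k.+1.*2.+1) * (K ^+ 2 * r ^+ k * 2 ^+ k.*2.+1)))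
   = 16 * K ^+ 6 * r ^+ 2 * rho * (16 * r ^+ 2 * rho) ^+ k.
  rewrite doubleS !exprMn !exprS -muln2 !exprM (_ : (16 : R) = 2 ^+ 2 * 2 ^+ 2); last by rewrite -!natrX -natrM.
  rewrite !exprMn !expr0; move: (2 ^+ k) (r ^+ k) (rho ^+ k) => u v w; ring.
have := gleB gB
  (gleM gB (Hf 1%N) (gleM gB (Hff k.+1) (gleM gB (bernstein_bound k.+1 Hf Hf') (bernstein_bound k Hf' Hf))))
  (gleM gB (Hf' 1%N) (gleM gB (Hff k.+1) (gleM gB (bernstein_bound k.+1 Hf' Hf) (bernstein_bound k Hf Hf')))).
by rewrite !E (expr1 f) (expr1 (1 - f)); apply: gle_le; rewrite -E0; lra.
Qed.

End SharpeningNorm.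

Section Scalars.
Context {R : realType}.
Local Notation C := (Cx R).

Lemma modulus_gauge : gauge (@idfun C) (fun c r => modulus c < r).
Proof.
split.
- by move=> a r; apply: le_lt_trans; apply: modulus_ge0.
- by move=> a b r s ar bs; apply: le_lt_trans (modulusD _ _) _; apply: ltrD.
- by move=> a b r s ar bs; rewrite modulusM ltr_pM ?modulus_ge0.
- by [].
- by move=> a r s rs ar; apply: lt_le_trans ar rs.
- move=> a r ar; exists ((modulus a + r) / 2); lra.
- by move=> a; exists (modulus a + 1); lra.
Qed.

Lemma modulus_gle c r : modulus c <= r <-> gle (fun c r => modulus c < r) (c : C) r.
Proof.
split=> [cr e e0|H]; first lra.
by rewrite leNgt; apply/negP => rc; have := H (modulus c - r); lra.
Qed.

(* kept abstract, to protect it from computation *)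
Definition tol : R := locked (1 / 50).

Lemma tolE : 50 * tol = 1.
Proof. by rewrite /tol -lock mulrCA divff ?mulr1// pnatr_eq0. Qed.

Definition near01 (e : C) (b : bool) := modulus (e - b%:R) <= tol.

(** [sharp k] vanishes to order k + 1 at 0, and [sharpC] exchanges 0 and 1. *)
Lemma sharp_near01 k e b : near01 e b ->
  modulus (sharp k e - b%:R) <= (1 / 8) ^+ k / 20.
Proof.
have tE := tolE.
have sharp0 (c : C) : modulus c <= tol -> modulus (sharp k c) <= (1 / 8) ^+ k / 20.
  move=> c0; rewrite modulusM modulusX.
  have c1 : modulus (1 - c) <= 11 / 10.
    by have := modulusB 1 c; rewrite modulus1; lra.
  have cp : power_bound (fun c r => modulus c < r) c 1 (11 / 10).
    move=> i; rewrite mul1r; apply: (modulus_gle _ _).1.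
    by rewrite modulusX lerXn2r ?nnegrE ?modulus_ge0//; lra.
  have cp' : power_bound (fun c r => modulus c < r) (1 - c) 1 (11 / 10).
    move=> i; rewrite mul1r; apply: (modulus_gle _ _).1.
    by rewrite modulusX lerXn2r ?nnegrE ?modulus_ge0//; lra.
  have H := (modulus_gle _ _).2 (bernstein_bound modulus_gauge k cp cp').
  have t0 : 0 <= tol by lra.
  apply: (@le_trans _ _ (tol ^+ k.+1 * (1 ^+ 2 * (11 / 10) ^+ k * 2 ^+ k.*2.+1))).
    by apply: ler_pM; rewrite ?exprn_ge0 ?modulus_ge0// lerXn2r ?nnegrE ?modulus_ge0.
  rewrite expr1n mul1r !exprS -muln2 mulnC exprM.
  rewrite [leLHS](_ : _ = 2 * tol * (tol * (11 / 10) * (2 ^+ 2)) ^+ k); last first.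
    by rewrite !exprMn; ring.
  have e1 : 0 <= tol * (11 / 10) * 2 ^+ 2 by rewrite !mulr_ge0//; lra.
  have e2 : tol * (11 / 10) * 2 ^+ 2 <= 1 / 8 by rewrite expr2; lra.
  apply: (@le_trans _ _ (2 * tol * (1 / 8) ^+ k)).
    apply: ler_wpM2l; first lra.
    by rewrite lerXn2r ?nnegrE//; lra.
  have : 0 <= (1 / 8 : R) ^+ k by rewrite exprn_ge0//; lra.
  move: (_ ^+ k) => u u0.
  have -> : tol = 1 / 50 by lra.
  by lra.
rewrite /near01; case: b => /=; last by rewrite mulr0n !subr0; apply: sharp0.
rewrite mulr1n modulusBC => H; rewrite modulusBC -sharpC; exact: sharp0.
Qed.

End Scalars.

(** * Means over circles of the scalar Cauchy kernel *)

Section Averages.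
Context {R : realType}.
Local Notation C := (Cx R).

(** [circle_mean_inverse] for scalars, with exact inverses and hence no error. *)
Lemma mean_geometric m r (X : C) : 0 < r -> modulus X != r ->
  (2 ^ m)%:R^-1 * \sum_(w <- unit_roots m) (RtoC r / w) * (RtoC r / w - X)^-1 =
  (1 - (X / RtoC r) ^+ (2 ^ m))^-1.
Proof.
move=> r0 Xr.
have HX : gle (fun (c : C) s => modulus c < s) X (modulus X).
  exact: (modulus_gle _ _).1.
have := @circle_mean_inverse _ _ _ _ (@modulus_gauge R) X
  (fun l => (l - X)^-1) r (modulus X) 0 m r0 HX.
set T := circle_mean _ _ _ _ => H.
have {}H : 1 - (1 - (idfun (RtoC r)^-1 * X) ^+ (2 ^ m)) * T = 0.
  apply/eqP; rewrite -modulus_eq0 eq_le modulus_ge0 andbT.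
  apply: (modulus_gle _ _).2; rewrite -(mul0r (\sum_(i < 2 ^ m) (modulus X / r) ^+ i)).
  apply: H => w wU /=; apply: (modulus_gle _ _).1.
  rewrite divff ?subrr ?modulus0// subr_eq0; apply: contra Xr => /eqP <-.
  rewrite modulusM modulusV (modulus_unit_roots wU) invr1 mulr1.
  by rewrite modulus_RtoC_ge0// ltW.
rewrite -[LHS]/T.
move/eqP: H; rewrite subr_eq0 [X in _ == (1 - X ^+ _) * _]mulrC => /eqP H.
have n0 : 1 - (X / RtoC r) ^+ (2 ^ m) != 0.
  by apply: contra_eqN H => /eqP ->; rewrite mul0r oner_eq0.
by apply: (mulfI n0); rewrite divff.
Qed.

Lemma parallelogram (a b : C) :
  modulus (a + b) ^+ 2 + modulus (a - b) ^+ 2 = 2 * (modulus a ^+ 2 + modulus b ^+ 2).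
Proof. by rewrite !modulus_sqr; case: a => a1 a2; case: b => b1 b2 /=; ring. Qed.

(** The discrete Poisson kernel. By the parallelogram law the terms of opposite roots combine into
    one term for the squares, with the factor 2 (r^2 + |X|^2) that turns r^2 - |X|^2 into r^4 -
    |X|^4. *)
Lemma sum_inv_sqr_dist m r (X : C) : 0 < r -> modulus X != r ->
  (\sum_(w <- unit_roots m) (modulus (RtoC r - w * X) ^+ 2)^-1)
    * (r ^+ 2 - modulus X ^+ 2) * modulus (RtoC r ^+ (2 ^ m) - X ^+ (2 ^ m)) ^+ 2
  = (2 ^ m)%:R * ((r ^+ 2) ^+ (2 ^ m) - (modulus X ^+ 2) ^+ (2 ^ m)).
Proof.
elim: m r X => [|m IH] r X r0 Xr.
  rewrite /= big_seq1 !expr1 mul1r mulrAC mulVf ?mul1r//.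
  rewrite expf_eq0/= modulus_eq0 subr_eq0; apply: contra Xr => /eqP <-.
  by rewrite modulus_RtoC_ge0// ltW.
have Xr2 : modulus (X ^+ 2) != r ^+ 2.
  by rewrite modulusX eqrXn2 ?modulus_ge0// ltW.
have := IH (r ^+ 2) (X ^+ 2) (exprn_gt0 _ r0) Xr2.
set S := (\sum_(w <- _) _) => E.
rewrite /= big_cat !big_map/= -big_split/=.
rewrite (@eq_big_seq _ _ _ _ _ _ (fun w => 2 * (r ^+ 2 + modulus X ^+ 2)
    * (modulus (RtoC (r ^+ 2) - w * X ^+ 2) ^+ 2)^-1)); last first.
  move=> w wU /=; rewrite mulNr opprK.
  have mw : modulus (Csqrt w) = 1.
    apply/eqP; rewrite -(pexpr_eq1 (n := 2))// ?modulus_ge0// -modulusX sqr_Csqrt.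
    by rewrite (modulus_unit_roots wU).
  have mX : modulus (Csqrt w * X) = modulus X by rewrite modulusM mw mul1r.
  have mr : modulus (RtoC r) = r by rewrite modulus_RtoC_ge0// ltW.
  have := parallelogram (RtoC r) (Csqrt w * X); rewrite mX mr => P.
  have -> : RtoC (r ^+ 2) - w * X ^+ 2 = (RtoC r + Csqrt w * X) * (RtoC r - Csqrt w * X).
    by rewrite -[in LHS](sqr_Csqrt w) rmorphXn /=; ring.
  have n1 : modulus (RtoC r + Csqrt w * X) != 0.
    rewrite modulus_eq0 addr_eq0; apply: contra Xr => /eqP H.
    by rewrite -mX -modulusN -H mr.
  have n2 : modulus (RtoC r - Csqrt w * X) != 0.
    rewrite modulus_eq0 subr_eq0; apply: contra Xr => /eqP H.
    by rewrite -mX -H mr.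
  by rewrite -P modulusM; field; apply/andP.
rewrite -mulr_sumr -/S.
rewrite !expnS !(exprM _ 2 (2 ^ m)) natrM -mulrA -(rmorphXn RtoC) /=.
by rewrite -[RHS]mulrA; move: E; rewrite modulusX => <-; ring.
Qed.

(** AM-GM bounds 1/t by 1/(2s) + s/(2 t^2) with s = sqrt D, and the discrete Poisson kernel gives
    the mean of 1/t^2. The hypothesis on powers keeps |r^M - X^M| comparable to the larger of r^M
    and |X|^M. *)
Lemma mean_inv_dist m r (X : C) (D := `|r - modulus X|) : 0 < r -> 0 < D ->
  2 * modulus X ^+ (2 ^ m) <= r ^+ (2 ^ m) \/ 2 * r ^+ (2 ^ m) <= modulus X ^+ (2 ^ m) ->
  (2 ^ m)%:R^-1 * (\sum_(w <- unit_roots m) (modulus (RtoC r / w - X))^-1)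
    <= (1 + 4 / r) / Num.sqrt D.
Proof.
have DE : D = `|r - modulus X| by [].
move=> r0 D0 far; have x0 := modulus_ge0 X.
have Xr : modulus X != r.
  by apply: contraTneq D0 => Xr; rewrite DE Xr subrr normr0 ltxx.
set M := (2 ^ m)%N.
have M0 : 0 < M%:R :> R by rewrite ltr0n expn_gt0.
have mw (w : C) : w \in unit_roots m -> modulus (RtoC r / w - X) = modulus (RtoC r - w * X).
  move=> wU; have w1 := modulus_unit_roots wU.
  have w0 := unit_roots_neq0 wU.
  have -> : RtoC r - w * X = w * (RtoC r / w - X) by field.
  by rewrite modulusM w1 mul1r.
pose S := \sum_(w <- unit_roots m) (modulus (RtoC r - w * X) ^+ 2)^-1.
have S0 : 0 <= S by apply: sumr_ge0 => w _; rewrite invr_ge0 sqr_ge0.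
have Dr0 : 0 < D * r by rewrite mulr_gt0.
have HS : M%:R^-1 * S <= 4 / (D * r).
  rewrite mulrC ler_pdivrMr// mulrAC ler_pdivlMr//.
  have := sum_inv_sqr_dist m r0 Xr; rewrite -/S -/M.
  set Z := modulus (_ - _); rewrite !(exprAC _ 2 M) => E.
  have rR : modulus (RtoC r ^+ M) = r ^+ M.
    by rewrite modulusX modulus_RtoC_ge0// ltW.
  have Z1 := modulus_lb (RtoC r ^+ M) (X ^+ M).
  have Z2 := modulus_lb (X ^+ M) (RtoC r ^+ M).
  rewrite rR modulusX in Z1 Z2; rewrite modulusBC -/Z in Z2; rewrite -/Z in Z1.
  have P0 : 0 < r ^+ M by rewrite exprn_gt0.
  have Q0 : 0 <= modulus X ^+ M by rewrite exprn_ge0.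
  have key V : 0 < V -> V <= 2 * Z -> S * (D * r) * Z ^+ 2 <= M%:R * V ^+ 2 ->
      S * (D * r) <= 4 * M%:R.
    move=> V0 VZ H; have Z0 : 0 < Z by lra.
    have Z20 : 0 < Z ^+ 2 by rewrite exprn_gt0.
    rewrite -(ler_pM2r Z20); apply: (le_trans H).
    have : V ^+ 2 <= 4 * Z ^+ 2 by rewrite !expr2; nra.
    by move=> H4; have := ler_wpM2l (ltW M0) H4; lra.
  have Z20 : 0 <= Z ^+ 2 by rewrite sqr_ge0.
  case: far => far.
    have xr : modulus X < r.
      rewrite ltNge; apply/negP => rx.
      have : r ^+ M <= modulus X ^+ M by rewrite lerXn2r ?nnegrE// ltW.
      by rewrite -/M in far; lra.
    apply: (key (r ^+ M)) => //; first by rewrite -/M in far; lra.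
    rewrite DE ger0_norm; last by lra.
    have : S * ((r - modulus X) * r) * Z ^+ 2 <= S * (r ^+ 2 - modulus X ^+ 2) * Z ^+ 2.
      by apply: ler_wpM2r => //; apply: ler_wpM2l => //; rewrite !expr2; nra.
    have : M%:R * (modulus X ^+ M) ^+ 2 >= 0 by rewrite mulr_ge0 ?sqr_ge0 ?(ltW M0).
    lra.
  have xr : r < modulus X.
    rewrite ltNge; apply/negP => rx.
    have : modulus X ^+ M <= r ^+ M by rewrite lerXn2r ?nnegrE// ltW.
    by rewrite -/M in far; lra.
  rewrite -/M in far.
  apply: (key (modulus X ^+ M)) => //; [lra|lra|].
  rewrite DE ltr0_norm; last by lra.
  have : S * (- (r - modulus X) * r) * Z ^+ 2 <= S * (modulus X ^+ 2 - r ^+ 2) * Z ^+ 2.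
    by apply: ler_wpM2r => //; apply: ler_wpM2l => //; rewrite !expr2; nra.
  have : M%:R * (r ^+ M) ^+ 2 >= 0 by rewrite mulr_ge0 ?sqr_ge0 ?(ltW M0).
  lra.
set s := Num.sqrt D.
have s0 : 0 < s by rewrite sqrtr_gt0.
have s2 : s * s = D by rewrite -expr2 sqr_sqrtr// ltW.
have amgm : \sum_(w <- unit_roots m) (modulus (RtoC r / w - X))^-1 <=
    \sum_(w <- unit_roots m) (s^-1 / 2 + s / 2 * (modulus (RtoC r - w * X) ^+ 2)^-1).
  rewrite big_seq [leRHS]big_seq; apply: ler_sum => w wU.
  rewrite mw//; set t := modulus _.
  have t0 : 0 < t.
    rewrite lt_def modulus_ge0 andbT modulus_eq0 subr_eq0.
    apply: contra Xr => /eqP H; rewrite -(mul1r (modulus X)).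
    by rewrite -(modulus_unit_roots wU) -modulusM -H modulus_RtoC_ge0// ltW.
  rewrite -subr_ge0 (_ : _ - _ = (t - s) ^+ 2 / (2 * s * t ^+ 2)).
    by rewrite divr_ge0 ?sqr_ge0// !mulr_ge0 ?sqr_ge0// ltW.
  by field; rewrite !gt_eqF.
have Mi0 : 0 <= M%:R^-1 :> R by rewrite invr_ge0 ltW.
apply: (le_trans (ler_wpM2l Mi0 amgm)).
have -> : \sum_(w <- unit_roots m)
    (s^-1 / 2 + s / 2 * (modulus (RtoC r - w * X) ^+ 2)^-1) =
    M%:R * (s^-1 / 2) + s / 2 * S.
  rewrite big_split/= /S [in RHS]mulr_sumr; congr (_ + _).
  by rewrite big_const_seq count_predT size_unit_roots iter_addr_0 mulr_natl.
rewrite mulrDr mulKf ?gt_eqF//.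
have -> : M%:R^-1 * (s / 2 * S) = s / 2 * (M%:R^-1 * S) by rewrite mulrCA.
have h : s / 2 * (M%:R^-1 * S) <= s / 2 * (4 / (D * r)).
  by apply: ler_wpM2l HS; rewrite divr_ge0// ltW.
have e : s / 2 * (4 / (D * r)) = 2 / r / s.
  by rewrite -s2; field; rewrite !gt_eqF.
rewrite e in h.
have i0 : 0 < s^-1 by rewrite invr_gt0.
have ri0 : 0 < r^-1 by rewrite invr_gt0.
apply: (le_trans (lerD (lexx _) h)); rewrite mulrDl.
have : 0 < r^-1 * s^-1 by rewrite mulr_gt0.
lra.
Qed.

(** Comparison with an integral: [phi] is a primitive of |t|^(-1/2) / 2. *)
Lemma sum_inv_sqrt L (y : R) :
  \sum_(l < L | 1 / 2 <= `|l%:R - y|) (Num.sqrt `|l%:R - y|)^-1 <= 6 * Num.sqrt L%:R.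
Proof.
pose phi (t : R) := if 0 <= t then Num.sqrt t else - Num.sqrt (- t).
have sq (t : R) : 0 <= t -> Num.sqrt t * Num.sqrt t = t.
  by move=> t0; rewrite -expr2 sqr_sqrtr.
have mono t : phi t <= phi (t + 1).
  rewrite /phi; case: (leP 0 t) => t0; case: (leP 0 (t + 1)) => t1.
  - by rewrite ler_wsqrtr//; lra.
  - lra.
  - by have := sqrtr_ge0 (- t); have := sqrtr_ge0 (t + 1); lra.
  - by rewrite lerN2 ler_wsqrtr//; lra.
have incr t : 1 / 2 <= `|t| -> (Num.sqrt `|t|)^-1 <= 3 * (phi (t + 1) - phi t).
  move=> ht; have s0 : 0 < Num.sqrt `|t| by rewrite sqrtr_gt0; lra.
  rewrite -(ler_pM2r s0) mulVf ?gt_eqF// /phi.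
  have w0 := sqrtr_ge0 (t + 1); have w'0 := sqrtr_ge0 (- (t + 1)).
  case: (leP 0 t) => t0.
    rewrite ger0_norm// in ht s0 *; rewrite ifT; last lra.
    have u2 := sq t t0; have w2 := sq (t + 1) (ltac:(lra)).
    move: (Num.sqrt t) (Num.sqrt (t + 1)) s0 w0 u2 w2 => u w u0 w0 u2 w2.
    have wu : w <= 2 * u.
      by rewrite leNgt; apply/negP => wu; nra.
    nra.
  rewrite ltr0_norm// in ht s0 *.
  have u2 := sq (- t) (ltac:(lra)).
  case: (leP 0 (t + 1)) => t1; first nra.
  have w2 := sq (- (t + 1)) (ltac:(lra)).
  move: (Num.sqrt (- t)) (Num.sqrt (- (t + 1))) s0 w'0 u2 w2 => u w u0 w'0 u2 w2.
  have wu : w <= u.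
    by rewrite leNgt; apply/negP => wu; nra.
  nra.
have tele n : \sum_(l < n | 1 / 2 <= `|l%:R - y|) (Num.sqrt `|l%:R - y|)^-1 <=
    3 * (phi (n%:R - y) - phi (- y)).
  elim: n => [|n IH]; first by rewrite big_ord0 sub0r; lra.
  rewrite big_mkcond big_ord_recr -big_mkcond /=.
  have m1 := mono (n%:R - y); have := incr (n%:R - y).
  have -> : n.+1%:R - y = n%:R - y + 1 by rewrite -natr1; ring.
  by case: ifP => _ => [/(_ isT)|_]; lra.
apply: (le_trans (tele L)).
have L0 : 0 <= L%:R :> R by [].
have l2 := sq _ L0; have l0 := sqrtr_ge0 (L%:R : R).
have : phi (L%:R - y) - phi (- y) <= 2 * Num.sqrt L%:R; last lra.
rewrite /phi opprK.
have a0 := sqrtr_ge0 (L%:R - y); have b0 := sqrtr_ge0 (- y).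
have c0 := sqrtr_ge0 (- (L%:R - y)); have d0 := sqrtr_ge0 y.
case: (leP 0 (L%:R - y)) => h1; case: (leP 0 (- y)) => h2.
- have a2 := sq _ h1; have b2 := sq _ h2; nra.
- have a2 := sq _ h1; have d2 := sq y (ltac:(lra)).
  suff : Num.sqrt (L%:R - y) <= Num.sqrt L%:R /\ Num.sqrt y <= Num.sqrt L%:R by lra.
  by split; apply: ler_wsqrtr; lra.
- lra.
- have c2 := sq (- (L%:R - y)) (ltac:(lra)); have d2 := sq y (ltac:(lra)).
  suff : Num.sqrt y <= Num.sqrt L%:R + Num.sqrt (- (L%:R - y)) by lra.
  rewrite leNgt; apply/negP => H; nra.
Qed.

End Averages.

Lemma annulus_ind (R : realType) (P : set (Cx R) -> Prop) (r s : R) :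
  (forall U V, U `<=` V -> P V -> P U) ->
  (forall U V, P U -> P V -> P (U `|` V)) -> P set0 ->
  (forall p, r <= modulus p -> modulus p <= s ->
     exists2 e, 0 < e & P [set q | modulus (q - p) < e]) ->
  P [set q | r <= modulus q <= s].
Proof.
move=> Psub PU P0 Ploc.
pose Q U := P (U `&` [set q | r <= modulus q <= s]).
suff : Q [set q | modulus q <= s].
  by apply: Psub => q /= /andP[rq qs]; split=> //=; rewrite rq.
apply: disc_ind => [U V UV|U V|p]; rewrite /Q.
- by apply: Psub => q [/UV].
- by rewrite setIUl; apply: PU.
- have [pr|rp] := ltP (modulus p) r.
    exists (r - modulus p); first by lra.
    apply: Psub P0 => q [/= qp /andP[rq _]].
    by have := modulus_lb q p; lra.
  have [sp|ps] := ltP s (modulus p).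
    exists (modulus p - s); first by lra.
    apply: Psub P0 => q [/= qp /andP[_ qs]].
    by have := modulus_lb p q; rewrite modulusBC; lra.
  have [e e0 Pe] := Ploc _ rp ps; exists e => //.
  by apply: Psub Pe => q [].
Qed.

Section Near01.
Context {R : realType}.
Implicit Types e : Cx R.

Lemma near01_le e b : near01 e b -> modulus e <= 51 / 50.
Proof.
have tE := @tolE R; rewrite /near01 => H.
have := modulus_lb e b%:R; have : modulus (b%:R : Cx R) <= 1.
  by rewrite modulus_natr; case: b {H}.
lra.
Qed.

Lemma near01C e b : near01 e b -> near01 (1 - e) (~~ b).
Proof.
rewrite /near01 (_ : 1 - e - (~~ b)%:R = - (e - b%:R)) ?modulusN//.
by case: b => /=; rewrite ?mulr1n ?mulr0n; ring.
Qed.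

Lemma near01_false e : near01 e false -> modulus e <= 1 / 50.
Proof. by have := @tolE R; rewrite /near01 mulr0n subr0; lra. Qed.

Lemma near01_mulC e e' b : near01 e b -> near01 e' b ->
  modulus (e * (1 - e')) < 1 / 48.
Proof.
move=> He He'; rewrite modulusM.
have He'C := near01C He'.
have := near01_le He; have := near01_le He'C.
have a0 := modulus_ge0 e; have b0 := modulus_ge0 (1 - e').
case: b He He'C {He'} => /= He He'.
  by have := near01_false He'; nra.
by have := near01_false He; nra.
Qed.

End Near01.

(** * Gluing approximate indicators across an annulus *)

Section Merge.
Context {R : realType} {A : comNzRingType} (iota : {rmorphism Cx R -> A}).
Local Notation C := (Cx R).
Variables (J : finType) (x : J -> A) (ev : (J -> C) -> {rmorphism A -> C}).
Hypothesis ev_iota : forall z c, ev z (iota c) = c.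
Hypothesis taylor : forall a z, exists b : J -> A,
  a = iota (ev z a) + \sum_j (x j - iota (z j)) * b j.
Variables (B : A -> R -> Prop) (x0 : A) (r1 r2 : R).
Hypothesis gB : gauge iota B.
Hypothesis r10 : 0 < r1.
Hypothesis r12 : r1 < r2.
Local Notation Bq l := (gquot B (x0 - iota l)).
Local Notation spec := (spectrum ev B).

Lemma gquot_shift l a r t b : B (a + (x0 - iota l) * b) r -> gle B b t ->
  0 < t -> exists2 e : R, 0 < e & forall l', modulus (l' - l) < e ->
    B (a + (x0 - iota l') * b) r.
Proof.
move=> H Hb t0; have [s [s0 sr Hs]] := glt_ex gB H.
exists ((r - s) / t) => [|l1 ll]; first by rewrite divr_gt0//; lra.
have -> : a + (x0 - iota l1) * b = a + (x0 - iota l) * b + iota (l - l1) * b.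
  by rewrite rmorphB/=; ring.
apply: gle_lt (gleD gB Hs (gleZ gB (lexx _) Hb)) _.
by move: ll; rewrite modulusBC ltr_pdivlMr//; lra.
Qed.

(** For each [l], |p| < r on the part of the spectrum where x0 = l, so [spectral_radius] bounds a
    power of [p] in the quotient by x0 - l. The same witness serves for nearby [l], and the annulus
    is compact. *)
Lemma uniform_power p r : 0 < r ->
  (forall z, spec z -> r1 <= modulus (ev z x0) <= r2 -> modulus (ev z p) < r) ->
  exists2 K, 1 <= K & forall l, r1 <= modulus l <= r2 -> power_bound (Bq l) p K r.
Proof.
move=> r0 Hp; have [t t0 Ht] := gle_total gB p.
pose P U := exists2 K, 1 <= K & forall l, U l -> power_bound (Bq l) p K r.
suff : P [set l | r1 <= modulus l <= r2] by [].
apply: annulus_ind.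
- by move=> U V UV [K K1 HK]; exists K => // l /UV; apply: HK.
- move=> U V [K K1 HK] [K' K'1 HK']; exists (K + K'); first lra.
  have r_ge0 i : 0 <= r ^+ i by rewrite exprn_ge0// ltW.
  move=> l [/HK|/HK'] H i; apply: gle_le (H i).
    by have := r_ge0 i; nra.
  by have := r_ge0 i; nra.
- by exists 1.
- move=> l rl ls.
  have [M M0 [b Hb]] : radius_lt (Bq l) p r.
    apply: (spectral_radius ev_iota taylor gB r0) => z Hz /eqP.
    rewrite rmorphB/= ev_iota subr_eq0 => /eqP zl; apply: Hp => //.
    by rewrite zl rl.
  have [s s0 Hs] := gle_total gB b.
  have [e e0 He] := gquot_shift Hb Hs s0.
  exists e => //; exists ((1 + t / r) ^+ M).
    by rewrite exprn_ege1// lerDl divr_ge0// ltW.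
  move=> l' /= /He H i.
  by apply: (gle_pow (gquot_gauge _ gB) (gle_gquot _ Ht)) => //; exists b.
Qed.

Variables (chi : (J -> C) -> bool) (f h : A).
Hypothesis Hf : forall z, spec z -> modulus (ev z x0) <= r2 -> near01 (ev z f) (chi z).
Hypothesis Hh : forall z, spec z -> r1 <= modulus (ev z x0) -> near01 (ev z h) (chi z).

(** Over the annulus [f] and [h] approximate the same [chi], so f (1 - h) and h (1 - f) have
    spectral radius below 1/48 in every quotient, and 16 (11/10)^2 / 48 < 1/2. *)
Lemma sharp_close : exists2 K, 0 < K & forall l, r1 <= modulus l <= r2 ->
  forall k, gle (Bq l) (sharp k f - sharp k h) (K * (1 / 2) ^+ k).
Proof.
have both z : spec z -> r1 <= modulus (ev z x0) <= r2 ->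
    near01 (ev z f) (chi z) /\ near01 (ev z h) (chi z).
  by move=> zB /andP[? ?]; split; [apply: Hf|apply: Hh].
have h11 : 0 < (11 / 10 : R) by lra.
have h48 : 0 < (1 / 48 : R) by lra.
have lt11 (e : C) b : near01 e b -> modulus e < 11 / 10.
  by move=> /near01_le; lra.
have [||K1 K11 H1] := @uniform_power f (11 / 10) => //.
  by move=> z zB zr; have [/lt11] := both z zB zr.
have [||K2 K21 H2] := @uniform_power (1 - f) (11 / 10) => //.
  move=> z zB zr; have [/near01C/lt11] := both z zB zr.
  by rewrite rmorphB rmorph1.
have [||K3 K31 H3] := @uniform_power h (11 / 10) => //.
  by move=> z zB zr; have [_ /lt11] := both z zB zr.
have [||K4 K41 H4] := @uniform_power (1 - h) (11 / 10) => //.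
  move=> z zB zr; have [_ /near01C/lt11] := both z zB zr.
  by rewrite rmorphB rmorph1.
have [||K5 K51 H5] := @uniform_power (f * (1 - h)) (1 / 48) => //.
  move=> z zB zr; have [Hz1 Hz2] := both z zB zr.
  by rewrite rmorphM rmorphB rmorph1; apply: near01_mulC Hz1 Hz2.
have [||K6 K61 H6] := @uniform_power (h * (1 - f)) (1 / 48) => //.
  move=> z zB zr; have [Hz1 Hz2] := both z zB zr.
  by rewrite rmorphM rmorphB rmorph1; apply: near01_mulC Hz2 Hz1.
pose K := K1 + K2 + K3 + K4 + K5 + K6.
have le_pb l p (r K' : R) : 0 < r -> K' <= K -> power_bound (Bq l) p K' r ->
    power_bound (Bq l) p K r.
  move=> r0 KK H i; apply: gle_le (H i); apply: ler_wpM2r => //.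
  by rewrite exprn_ge0// ltW.
have K1' : 1 <= K by rewrite /K; lra.
exists (8 * K ^+ 5 * (1 / 48)).
  have Kp : 0 < K ^+ 5 by apply: exprn_gt0; lra.
  lra.
move=> l lr k.
have := @sharpB_bound _ _ _ _ (gquot_gauge (x0 - iota l) gB) k f h K (11 / 10) (1 / 48) K1' (ltW h48) (ltW h11).
move=> H; apply: gle_le (H _ _ _ _ _ _); last first.
- by apply: le_pb (H6 l lr); rewrite /K; lra.
- by apply: le_pb (H5 l lr); rewrite /K; lra.
- by apply: le_pb (H4 l lr); rewrite /K; lra.
- by apply: le_pb (H3 l lr); rewrite /K; lra.
- by apply: le_pb (H2 l lr); rewrite /K; lra.
- by apply: le_pb (H1 l lr); rewrite /K; lra.
have K50 : 0 <= 8 * K ^+ 5 * (1 / 48).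
  have Kp : 0 <= K ^+ 5 by apply: exprn_ge0; lra.
  lra.
by apply: (ler_wpM2l K50); rewrite lerXn2r ?nnegrE// expr2; lra.
Qed.


Lemma uniform_lift c r s : r < s -> (forall l, r1 <= modulus l <= r2 -> gle (Bq l) c r) ->
  exists2 K, 0 < K & forall l, r1 <= modulus l <= r2 ->
    exists b, gle B (c + (x0 - iota l) * b) s /\ gle B b K.
Proof.
move=> rs H.
pose P (U : set C) := exists2 K, 0 < K & forall l, U l -> r1 <= modulus l <= r2 ->
    exists b, gle B (c + (x0 - iota l) * b) s /\ gle B b K.
suff [K K0 HK] : P [set l | r1 <= modulus l <= r2].
  by exists K => // l lr; apply: HK.
apply: annulus_ind.
- by move=> U V UV [K K0 HK]; exists K => // l /UV; apply: HK.
- move=> U V [K K1 HK] [K' K'1 HK']; exists (K + K'); first lra.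
  move=> l [Ul|Vl] lr.
    by have [b [H1 H2]] := HK _ Ul lr; exists b; split=> //; apply: gle_le H2; lra.
  by have [b [H1 H2]] := HK' _ Vl lr; exists b; split=> //; apply: gle_le H2; lra.
- by exists 1.
- move=> l rl lr; have [|b Hb] := gle_lt (H l _) rs; first by rewrite rl.
  have [t t0 Ht] := gle_total gB b.
  have [e e0 He] := gquot_shift Hb Ht t0.
  exists e => //; exists t => // l' /He H' _.
  by exists b; split=> //; apply: (gltW gB).
Qed.

End Merge.

Lemma geometric_near1 (R : realType) (z : Cx R) (e : R) : e <= 1 / 3 -> modulus z <= e ->
  modulus ((1 - z)^-1 - 1) <= 2 * e /\ modulus (1 - z)^-1 <= 2.
Proof.
move=> e3 ze; have z0 := modulus_ge0 z.
have h : 2 / 3 <= modulus (1 - z).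
  by have := modulus_lb 1 z; rewrite modulus1; lra.
have n0 : 1 - z != 0 by rewrite -modulus_gt0; lra.
have -> : (1 - z)^-1 - 1 = z / (1 - z) by field.
rewrite modulusM !modulusV; split.
  by rewrite ler_pdivrMr; nra.
by rewrite -[_^-1]mul1r ler_pdivrMr; lra.
Qed.

Lemma geometric_near0 (R : realType) (z : Cx R) (e : R) : 0 < e -> e <= 1 / 3 ->
  e^-1 <= modulus z -> modulus (1 - z)^-1 <= 2 * e /\ modulus (1 - z)^-1 <= 2.
Proof.
move=> e0 e3 ze.
have E : e * e^-1 = 1 by rewrite divff// gt_eqF.
have e'0 : 0 < e^-1 by rewrite invr_gt0.
have e'3 : 3 <= e^-1 by rewrite leNgt; apply/negP => H; nra.
have h : e^-1 - 1 <= modulus (1 - z).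
  by have := modulus_lb z 1; rewrite modulus1 modulusBC; lra.
have m0 : 0 < modulus (1 - z) by lra.
have H : (modulus (1 - z))^-1 <= 2 * e.
  by rewrite -[_^-1]mul1r ler_pdivrMr//; nra.
by rewrite modulusV; split=> //; lra.
Qed.

Lemma near_once (R : realType) L (y v : R) : 0 <= v ->
  \sum_(l < L | `|l%:R - y| < 1 / 2) v <= v.
Proof.
move=> v0; have [l0 hl0|H] := pickP (fun l : 'I_L => `|l%:R - y| < 1 / 2); last first.
  by rewrite big_pred0.
rewrite (bigD1 l0)//= big1 ?addr0// => l /andP[hl /negP[]].
have sep (i j : 'I_L) : (i < j)%N -> `|i%:R - y| < 1 / 2 -> `|j%:R - y| < 1 / 2 -> False.
  move=> ij; have : i.+1%:R <= j%:R :> R by rewrite ler_nat.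
  by rewrite -natr1 !ltr_norml; lra.
apply/eqP/val_inj => /=; case: (ltngtP l l0) => // ll; exfalso.
  exact: (sep _ _ ll).
exact: (sep _ _ ll).
Qed.

Section MergeEnd.
Context {R : realType} {A : comNzRingType} (iota : {rmorphism Cx R -> A}).
Local Notation C := (Cx R).
Variables (J : finType) (x : J -> A) (ev : (J -> C) -> {rmorphism A -> C}).
Hypothesis ev_iota : forall z c, ev z (iota c) = c.
Hypothesis taylor : forall a z, exists b : J -> A,
  a = iota (ev z a) + \sum_j (x j - iota (z j)) * b j.

Lemma ev_circle_mean z (b : C -> A) r m : ev z (circle_mean iota b r m) =
  (2 ^ m)%:R^-1 * \sum_(w <- unit_roots m) RtoC r / w * ev z (b (RtoC r / w)).
Proof.
rewrite rmorphM ev_iota rmorph_sum; congr (_ * _).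
by apply: eq_bigr => w _; rewrite rmorphM ev_iota.
Qed.

(* the contribution of the circle of radius [r] *)
Lemma circle_term z (x0 c : A) (b : C -> A) r m eta : 0 < r ->
  modulus (ev z x0) != r ->
  (forall w, w \in unit_roots m ->
     modulus (ev z (c + (x0 - iota (RtoC r / w)) * b (RtoC r / w))) <= eta) ->
  modulus (ev z (circle_mean iota b r m)
           - (1 - (ev z x0 / RtoC r) ^+ (2 ^ m))^-1 * ev z c)
    <= r * eta * ((2 ^ m)%:R^-1 *
         \sum_(w <- unit_roots m) (modulus (RtoC r / w - ev z x0))^-1).
Proof.
move=> r0 xr H; set X := ev z x0 in xr *.
rewrite -(mean_geometric m r0 xr) ev_circle_mean -mulrA -mulrBr mulr_suml -sumrB.
rewrite modulusM modulusV modulus_natr mulrCA.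
apply: ler_wpM2l; first by rewrite invr_ge0.
apply: (le_trans (modulus_sum _ _ _)); rewrite mulr_sumr big_seq [leRHS]big_seq.
apply: ler_sum => w wU; have {}H := H w wU.
have w1 := modulus_unit_roots wU.
have ml : modulus (RtoC r / w) = r.
  by rewrite modulusM modulusV w1 invr1 mulr1 modulus_RtoC_ge0// ltW.
set l := RtoC r / w in H ml *.
have lX : l - X != 0.
  by rewrite subr_eq0; apply: contra xr => /eqP <-; rewrite ml.
move: H; rewrite rmorphD rmorphM rmorphB ev_iota -/X => H.
have -> : l * ev z (b l) - l * (l - X)^-1 * ev z c =
    - l * (l - X)^-1 * (ev z c + (X - l) * ev z (b l)) by field.
rewrite !modulusM modulusN ml modulusV -mulrA [leRHS]mulrAC.
rewrite mulrA; apply: ler_wpM2l => //.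
by rewrite mulr_ge0 ?invr_ge0 ?modulus_ge0// ltW.
Qed.

End MergeEnd.

Lemma ratio_cases (R : realType) (r2 D rho X e : R) M :
  0 < D -> 0 < rho -> rho <= r2 -> 0 <= X -> D / 2 <= `|rho - X| ->
  (r2 / (r2 + D / 2)) ^+ M < e ->
  (X < rho /\ X ^+ M <= e * rho ^+ M) \/ (rho < X /\ rho ^+ M <= e * X ^+ M).
Proof.
move=> D0 rho0 rhor X0 far; set t := r2 / _ => te.
have rt : 0 < r2 + D / 2 by lra.
have t0 : 0 <= t by apply: divr_ge0; lra.
have pw (a b : R) : 0 <= a -> 0 <= b -> a <= t * b -> a ^+ M <= e * b ^+ M.
  move=> a0 b0 ab; apply: (@le_trans _ _ ((t * b) ^+ M)).
    by rewrite lerXn2r ?nnegrE//; apply: mulr_ge0.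
  by rewrite exprMn; apply: ler_wpM2r; [exact: exprn_ge0|exact: ltW].
have tb (a b : R) : a * (r2 + D / 2) <= r2 * b -> a <= t * b.
  by move=> ab; rewrite /t mulrAC ler_pdivlMr.
have [lt|ge] := ltP X rho; [left|right]; split=> //.
- apply: pw => //; first exact: ltW.
  by apply: tb; move: far; rewrite ger0_norm ?subr_ge0 ?(ltW lt)//; nra.
- rewrite lt_def ge andbT; apply: contraTN far => /eqP ->.
  by rewrite subrr normr0 -ltNge; lra.
- apply: pw => //; first exact: ltW.
  by apply: tb; move: far; rewrite ler0_norm ?subr_le0//; nra.
Qed.

(** The weight (1 - (X/rho)^M)^-1 is near 1 inside the circle of radius rho and near 0 outside, so
    the combination follows [F] inside and [H] outside. In the annulus both are close to [n]. *)
Lemma glue_estimate (R : realType) (F H n X : Cx R) (r1 r2 rho d e Gm v : R) M :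
  r1 < rho -> rho < r2 -> 0 < rho -> 0 <= d -> 0 < e -> e <= 1 / 3 ->
  2 * (e * Gm) <= v -> 0 <= v -> modulus (F - H) <= Gm ->
  (modulus X < rho /\ modulus X ^+ M <= e * rho ^+ M) \/
    (rho < modulus X /\ rho ^+ M <= e * modulus X ^+ M) ->
  (modulus X <= r2 -> modulus (F - n) <= d) ->
  (r1 <= modulus X -> modulus (H - n) <= d) ->
  modulus (H + (1 - (X / RtoC rho) ^+ M)^-1 * (F - H) - n) <= 5 * d + v.
Proof.
move=> r1rho rhor2 rho0 d0 e0 e3 eG v0 cG cases goodf goodh.
have PM0 : 0 < rho ^+ M by exact: exprn_gt0.
set zz := (X / _) ^+ M.
have zzE : modulus zz = modulus X ^+ M / rho ^+ M.
  by rewrite /zz modulusX modulusM modulusV modulus_RtoC_ge0 ?(ltW rho0)// expr_div_n.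
have [s2 [s21 s20]] : modulus (1 - zz)^-1 <= 2 /\
    (modulus X < rho -> modulus ((1 - zz)^-1 - 1) <= 2 * e) /\
    (rho < modulus X -> modulus (1 - zz)^-1 <= 2 * e).
  case: cases => -[h1 h2].
    have [|g1 g2] := @geometric_near1 _ zz _ e3.
      by rewrite zzE ler_pdivrMr.
    by split=> //; split=> // h3; have := lt_trans h1 h3; rewrite ltxx.
  have [|g1 g2] := @geometric_near0 _ zz _ e0 e3.
    by rewrite zzE ler_pdivlMr// mulrC ler_pdivrMr// mulrC.
  by split=> //; split=> // h3; have := lt_trans h1 h3; rewrite ltxx.
clear cases zzE.
have [Xr1|Xr1] := ltP (modulus X) r1.
  have {}s21 := s21 (lt_trans Xr1 r1rho).
  have gf := goodf (ltW (lt_trans Xr1 (lt_trans r1rho rhor2))).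
  rewrite (_ : _ - n = (F - n) + ((1 - zz)^-1 - 1) * (F - H)); last by ring.
  have := modulusD (F - n) (((1 - zz)^-1 - 1) * (F - H)).
  rewrite modulusM => h1.
  have := ler_pM (modulus_ge0 _) (modulus_ge0 _) s21 cG.
  clear -h1 gf eG v0 d0; lra.
have gh := goodh Xr1.
rewrite (_ : _ - n = (H - n) + (1 - zz)^-1 * (F - H)); last by ring.
have h1 := modulusD (H - n) ((1 - zz)^-1 * (F - H)).
rewrite modulusM in h1.
have [Xr2|Xr2] := ltP r2 (modulus X).
  have {}s20 := s20 (lt_trans rhor2 Xr2).
  have := ler_pM (modulus_ge0 _) (modulus_ge0 _) s20 cG.
  clear -h1 gh eG v0 d0; lra.
have gf := goodf Xr2.
have c2 : modulus (F - H) <= 2 * d.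
  have := modulusB (F - n) (H - n); rewrite (_ : _ - n - _ = F - H); last by ring.
  clear -gf gh; lra.
have := ler_pM (modulus_ge0 _) (modulus_ge0 _) s2 c2.
clear -h1 gh v0; lra.
Qed.

Lemma glue_weight (R : realType) (r1 r2 rho eta D u : R) :
  0 < r1 -> r1 <= rho -> rho <= r2 -> 0 <= eta -> 0 <= D ->
  rho * eta * ((1 + 4 / rho) / Num.sqrt (D * u)) <=
  r2 * (1 + 4 / r1) * eta / Num.sqrt D * (Num.sqrt u)^-1.
Proof.
move=> r10 r1rho rhor2 eta0 D0.
have rho0 : 0 < rho by lra.
rewrite sqrtrM// -!mulrA -invfM !mulrA.
apply: ler_wpM2r; first by rewrite invr_ge0 mulr_ge0 ?sqrtr_ge0.
rewrite mulrAC; apply: ler_wpM2r => //.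
have -> : rho * (1 + 4 / rho) = rho + 4 by field; rewrite gt_eqF.
have : 1 <= r2 / r1 by rewrite ler_pdivlMr//; lra.
lra.
Qed.

Lemma glue_total (R : realType) (K0 D w L v : R) : 0 < D -> 0 < v ->
  1 <= L -> D * (L + 1) = w -> K0 * 6 = Num.sqrt (w / 2) * v ->
  K0 / Num.sqrt D * (6 * Num.sqrt L) <= L * v.
Proof.
move=> D0 v0 L1 DL KE.
have L0 : 0 < L by lra.
have sD0 : 0 < Num.sqrt D by rewrite sqrtr_gt0.
have sL2 : Num.sqrt L * Num.sqrt L = L by rewrite -expr2 sqr_sqrtr// ltW.
have sL0 := sqrtr_ge0 L.
have sw_le : Num.sqrt (w / 2) <= Num.sqrt D * Num.sqrt L.
  by rewrite -sqrtrM ?(ltW D0)// ler_wsqrtr//; nra.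
rewrite -[X in _ <= X * v]sL2 mulrAC mulrA ler_pdivrMr// KE.
have h1 : Num.sqrt (w / 2) * v <= Num.sqrt D * Num.sqrt L * v.
  by apply: ler_wpM2r => //; apply: ltW.
by have := ler_wpM2r sL0 h1; lra.
Qed.

Lemma glue_final (R : realType) (L d v q rb : R) : 0 <= L -> d <= v / 10 ->
  q <= L * (v / 8) -> 1 + rb <= L * (v / 8) -> 50 * v = 1 ->
  L * (5 * d + v / 8) + q + (d + rb) <= v * L.
Proof.
move=> L0 dv qL rL v50; have : L * (5 * d) <= L * (v / 2).
  by apply: ler_wpM2l => //; lra.
have : 0 <= L * v by apply: mulr_ge0 => //; lra.
lra.
Qed.

Section MergeTheorem.
Context {R : realType} {A : comNzRingType} (iota : {rmorphism Cx R -> A}).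
Local Notation C := (Cx R).
Variables (J : finType) (x : J -> A) (ev : (J -> C) -> {rmorphism A -> C}).
Hypothesis ev_iota : forall z c, ev z (iota c) = c.
Hypothesis taylor : forall a z, exists b : J -> A,
  a = iota (ev z a) + \sum_j (x j - iota (z j)) * b j.

(** An additive Cousin problem. Put c = sharp k f - sharp k h. For [l] in the annulus there is b(l)
    with c + (x0 - l) b(l) small, so that b(l) approximates c / (l - x0). Its mean over a circle of
    radius rho is then close to c where |x0| < rho and to 0 where |x0| > rho; added to sharp k h, it
    gives sharp k f inside and sharp k h outside. The error is only controlled by the inverse square
    root of the distance to the circle. So one averages over L equally spaced circles: at most one
    of them is too close to a given point, and the errors of the others sum to order sqrt L. *)
Lemma merge_near01 (B : A -> R -> Prop) (x0 : A) (r1 r2 : R) (chi : (J -> C) -> bool)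
    (f h : A) : gauge iota B -> 0 < r1 -> r1 < r2 ->
  (forall z, spectrum ev B z -> modulus (ev z x0) <= r2 -> near01 (ev z f) (chi z)) ->
  (forall z, spectrum ev B z -> r1 <= modulus (ev z x0) -> near01 (ev z h) (chi z)) ->
  exists g, forall z, spectrum ev B z -> near01 (ev z g) (chi z).
Proof.
move=> gB r10 r12 Hf Hh.
have [K K0 HK] := sharp_close ev_iota taylor gB Hf Hh.
pose w := r2 - r1.
have w0 : 0 < w by rewrite /w; lra.
pose sw := Num.sqrt (w / 2).
have sw0 : 0 < sw by rewrite sqrtr_gt0; lra.
have i1 : 0 < r1^-1 by rewrite invr_gt0.
have [tE tol0] : 50 * tol = 1 :> R /\ 0 < tol :> R by have := @tolE R; split=> //; lra.
have i14 : 0 < 1 + 4 / r1 by lra.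
have [C2 C20 C2E] : exists2 C2, 0 < C2 & C2 = r2 * (1 + 4 / r1) * (6 / sw).
  exists (r2 * (1 + 4 / r1) * (6 / sw)) => //.
  have i2 : 0 < 6 / sw by rewrite divr_gt0.
  by apply: mulr_gt0 => //; apply: mulr_gt0 => //; lra.
(* [eta] is the defect c + (x0 - l) b(l) that can be tolerated; [C2] collects the constants of
   [glue_weight] and [glue_total]. *)
have [eta eta0 etaE] : exists2 eta, 0 < eta & eta * C2 = tol / 8.
  exists (tol / 8 / C2); first by apply: divr_gt0 => //; lra.
  by rewrite mulfVK// gt_eqF.
have [k0 Hk0] : exists n, forall m, (n <= m)%N -> (1 / 2 : R) ^+ m < eta / K.
  by apply: expr_small; [lra|lra|exact: divr_gt0].
pose k := (k0 + 2)%N.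
have Kk : K * (1 / 2) ^+ k < eta.
  by rewrite mulrC -ltr_pdivlMr//; apply: Hk0; rewrite /k leq_addr.
pose d : R := (1 / 8) ^+ k / 20.
have d0 : 0 <= d by rewrite /d divr_ge0// exprn_ge0; lra.
have dk : d <= tol / 10.
  rewrite /d /k exprD; have : (1 / 8 : R) ^+ k0 <= 1 by apply: exprn_ile1; lra.
  have : 0 <= (1 / 8 : R) ^+ k0 by apply: exprn_ge0; lra.
  move: (_ ^+ k0) => u; rewrite expr2; lra.
pose c := sharp k f - sharp k h.
have [Gm Gm0 HGm] := gle_total gB c.
have [bt bt0 Hbt] := uniform_lift gB Kk (fun l lr => HK l lr k).
have /choice[b Hb] : forall l, exists b, r1 <= modulus l <= r2 ->
    gle B (c + (x0 - iota l) * b) eta /\ gle B b bt.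
  move=> l; have [H|H] := boolP (r1 <= modulus l <= r2).
    by have [b Hb] := Hbt l H; exists b.
  by exists 0.
have rbt : 0 < r2 * bt by apply: mulr_gt0 => //; lra.
(* So many circles that the closest one, whose error is at most 1 + r2 * bt, contributes at most tol
   / 8 to the average. *)
have [L Lb] : exists L : nat, (1 + r2 * bt) / (tol / 8) <= L%:R.
  exists (Num.Def.archi_bound ((1 + r2 * bt) / (tol / 8))).
  by apply/ltW/archi_boundP; apply: divr_ge0; lra.
have {}Lb : 1 + r2 * bt <= L%:R * (tol / 8) by move: Lb; rewrite ler_pdivrMr//; lra.
have L0 : 0 < L%:R :> R.
  by rewrite lt_def ler0n andbT; apply/eqP => L0; rewrite L0 mul0r in Lb; lra.
pose D := w / L.+1%:R.
have DL : D * (L%:R + 1) = w.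
  by rewrite /D -natr1 mulfVK// gt_eqF//; lra.
have D0 : 0 < D by rewrite divr_gt0// ltr0n.
pose rho (l : nat) := r1 + D * (l%:R + 1).
have rhoP (l : 'I_L) : r1 + D <= rho l /\ rho l <= r2 - D.
  have l0 : 0 <= (l : nat)%:R :> R by [].
  have lL : (l : nat)%:R + 1 <= L%:R :> R by rewrite natr1 ler_nat.
  by rewrite /rho; move: DL; rewrite /w; nra.
have rhoP' (l : 'I_L) : r1 < rho l /\ rho l < r2.
  by have [h1 h2] := rhoP l; clear -h1 h2 D0; split; lra.
pose t := r2 / (r2 + D / 2).
have rt : 0 < r2 + D / 2 by clear -D0 r10 r12; lra.
have t0 : 0 <= t by apply: divr_ge0; [apply: ltW; apply: lt_trans r12|apply: ltW].
have t1 : t < 1 by rewrite ltr_pdivrMr// mul1r ltrDl divr_gt0.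
have [e1 [e10 e13 e1G]] : exists e1 : R, [/\ 0 < e1, e1 <= 1 / 3 & e1 * Gm <= tol / 16].
  exists (Num.min (1 / 3) (tol / 16 / Gm)); split.
  - by rewrite lt_min; apply/andP; split; [lra|apply: divr_gt0 => //; lra].
  - by rewrite ge_min lexx.
  - by rewrite -ler_pdivlMr// ge_min lexx orbT.
have [m Hm] := expr_small t0 t1 e10.
have {}Hm : t ^+ (2 ^ m) < e1.
  by apply: Hm; apply: ltnW; apply: ltn_expl.
have e1G2 : 2 * (e1 * Gm) <= tol / 8 by lra.
have tol80 : 0 <= tol / 8 :> R by lra.
pose M := (2 ^ m)%N.
pose G l := circle_mean iota b (rho l) m.
exists (sharp k h + iota (L%:R^-1) * \sum_(l < L) G l) => z zB.
pose X := ev z x0; pose n := chi z.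
have cG : modulus (ev z c) <= Gm := spectrum_gle gB zB HGm.
have cE : ev z c = sharp k (ev z f) - sharp k (ev z h).
  by rewrite rmorphB !rmorph_sharp.
(* The position of |X| among the radii: [rho] would take the value |X| at the real index [y]. *)
pose y := (modulus X - r1) / D - 1.
have rhoX (l : nat) : rho l - modulus X = D * (l%:R - y).
  by rewrite /rho /y; field; rewrite gt_eqF.
pose T (l : 'I_L) := modulus (sharp k (ev z h) + ev z (G l) - n%:R).
pose Q := 5 * d + tol / 8.
pose q0 := r2 * (1 + 4 / r1) * eta / Num.sqrt D.
have q00 : 0 <= q0.
  rewrite /q0; apply: divr_ge0; last exact: sqrtr_ge0.
  apply: mulr_ge0; last exact: ltW.
  by apply: mulr_ge0; apply: ltW => //; apply: lt_trans r12.
have goodf : modulus X <= r2 -> modulus (sharp k (ev z f) - n%:R) <= d.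
  by move=> Xr; apply: sharp_near01; apply: Hf.
have goodh : r1 <= modulus X -> modulus (sharp k (ev z h) - n%:R) <= d.
  by move=> Xr; apply: sharp_near01; apply: Hh.
have ml p w' : 0 < p -> w' \in unit_roots m -> modulus (RtoC p / w') = p.
  move=> p0 /modulus_unit_roots w1.
  by rewrite modulusM modulusV w1 invr1 mulr1 modulus_RtoC_ge0// ltW.
have DE2 (u : R) : 1 / 2 <= u -> D / 2 <= D * u by move=> u2; clear -u2 D0; nra.
have far (l : 'I_L) : 1 / 2 <= `|l%:R - y| ->
    T l <= Q + q0 * (Num.sqrt `|l%:R - y|)^-1.
  move=> ly; have [rl1 rl2] := rhoP' l; have rX := rhoX l.
  have rl0 : 0 < rho l := lt_trans r10 rl1.
  have dlE : `|rho l - modulus X| = D * `|l%:R - y|.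
    by rewrite rX normrM ger0_norm// ltW.
  have dl2 : D / 2 <= `|rho l - modulus X| by rewrite dlE; apply: DE2.
  have dl0 : 0 < `|rho l - modulus X| by apply: lt_le_trans dl2; apply: divr_gt0.
  have Xr : modulus X != rho l by rewrite eq_sym -subr_eq0 -normr_gt0.
  have cases := ratio_cases D0 rl0 (ltW rl2) (modulus_ge0 X) dl2 Hm.
  have Q1 : modulus (ev z (G l) - (1 - (X / RtoC (rho l)) ^+ M)^-1 * ev z c)
      <= q0 * (Num.sqrt `|l%:R - y|)^-1.
    have hh : 2 * modulus X ^+ M <= rho l ^+ M \/ 2 * rho l ^+ M <= modulus X ^+ M.
      have XM0 : 0 <= modulus X ^+ M := exprn_ge0 _ (modulus_ge0 X).
      have PM0 : 0 < rho l ^+ M := exprn_gt0 _ rl0.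
      by case: cases => -[_ hM]; [left|right]; clear -hM XM0 PM0 e13; nra.
    have md := mean_inv_dist rl0 dl0 hh.
    have ct := @circle_term _ _ _ _ _ ev_iota z x0 c b (rho l) m eta rl0 Xr.
    apply: (le_trans (ct _)).
      move=> w' wU; apply: (spectrum_gle gB zB).
      by have [|] := Hb (RtoC (rho l) / w'); first by rewrite ml// !ltW.
    have re0 : 0 <= rho l * eta by apply: mulr_ge0; apply: ltW.
    apply: (le_trans (ler_wpM2l re0 md)); rewrite dlE.
    by apply: glue_weight => //; apply: ltW.
  have S1 : modulus (sharp k (ev z h) + (1 - (X / RtoC (rho l)) ^+ M)^-1 * ev z c - n%:R) <= Q.
    rewrite cE in cG *.
    by apply: (glue_estimate rl1 rl2 rl0 d0 e10 e13 e1G2 tol80 cG cases goodf goodh).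
  rewrite /T.
  rewrite (_ : _ - n%:R = (sharp k (ev z h) + (1 - (X / RtoC (rho l)) ^+ M)^-1 * ev z c - n%:R)
     + (ev z (G l) - (1 - (X / RtoC (rho l)) ^+ M)^-1 * ev z c)); last by ring.
  by apply: (le_trans (modulusD _ _)); apply: lerD.
have near (l : 'I_L) : `|l%:R - y| < 1 / 2 -> T l <= d + r2 * bt.
  move=> ly; have [rl1 rl2] := rhoP l; have rX := rhoX l.
  have [rl1' rl2'] := rhoP' l.
  have rl0 : 0 < rho l := lt_trans r10 rl1'.
  have : `|rho l - modulus X| < D.
    rewrite rX normrM ger0_norm ?(ltW D0)//.
    by rewrite -[ltRHS]mulr1 ltr_pM2l//; clear -ly; lra.
  rewrite ltr_norml => /andP[h1 h2].
  rewrite /T addrAC; apply: (le_trans (modulusD _ _)); apply: lerD.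
    by apply: goodh; clear -h1 h2 rl1; lra.
  apply: (@le_trans _ _ (rho l * bt)); last by apply: ler_wpM2r; apply: ltW.
  rewrite (ev_circle_mean ev_iota) modulusM modulusV modulus_natr mulrC.
  rewrite ler_pdivrMr ?ltr0n ?expn_gt0//.
  apply: (le_trans (modulus_sum _ _ _)).
  apply: (@le_trans _ _ (\sum_(w <- @unit_roots R m) rho l * bt)).
    rewrite big_seq [leRHS]big_seq; apply: ler_sum => w' wU.
    rewrite modulusM ml//; apply: ler_wpM2l; first exact: ltW.
    apply: (spectrum_gle gB zB).
    by have [|] := Hb (RtoC (rho l) / w'); first by rewrite ml// !ltW.
  by rewrite big_const_seq count_predT size_unit_roots iter_addr_0 mulr_natr.
have ET : modulus (ev z (sharp k h + iota L%:R^-1 * \sum_(l < L) G l) - n%:R)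
    <= L%:R^-1 * \sum_(l < L) T l.
  rewrite rmorphD rmorphM ev_iota rmorph_sum rmorph_sharp.
  have LC : (L%:R : C) != 0 by rewrite pnatr_eq0 -(pnatr_eq0 R) gt_eqF.
  rewrite (_ : _ - n%:R = L%:R^-1 * \sum_(l < L) (sharp k (ev z h) + ev z (G l) - n%:R)).
    rewrite modulusM modulusV modulus_natr; apply: ler_wpM2l.
      by rewrite invr_ge0 ltW.
    exact: modulus_sum.
  rewrite sumrB big_split/= !sumr_const card_ord mulrBr mulrDr.
  by rewrite -(mulr_natl (sharp k (ev z h)) L) -(mulr_natl n%:R L) !mulKf.
have ST : \sum_(l < L) T l <= L%:R * Q + q0 * (6 * Num.sqrt L%:R) + (d + r2 * bt).
  rewrite (bigID (fun l : 'I_L => 1 / 2 <= `|l%:R - y|))/=; apply: lerD.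
    apply: (@le_trans _ _ (\sum_(l < L | 1 / 2 <= `|l%:R - y|)
        (Q + q0 * (Num.sqrt `|l%:R - y|)^-1))).
      by apply: ler_sum => l; apply: far.
    rewrite big_split/=; apply: lerD.
      have Q0 : 0 <= Q by rewrite /Q; lra.
      apply: (@le_trans _ _ (\sum_(l < L) Q)).
        by rewrite big_mkcond; apply: ler_sum => l _; case: ifP.
      by rewrite sumr_const card_ord mulr_natl.
    by rewrite -mulr_sumr; apply: ler_wpM2l => //; exact: sum_inv_sqrt.
  apply: (@le_trans _ _ (\sum_(l < L | `|l%:R - y| < 1 / 2) (d + r2 * bt))).
    under eq_bigl do rewrite -ltNge.
    by apply: ler_sum => l; apply: near.
  by apply: near_once; lra.
rewrite /near01; apply: (le_trans ET).
rewrite mulrC ler_pdivrMr//; apply: (le_trans ST).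
have q6 : q0 * (6 * Num.sqrt L%:R) <= L%:R * (tol / 8).
  have L1 : 1 <= L%:R :> R.
    by rewrite (_ : 1 = 1%:R :> R)// ler_nat lt0n -(pnatr_eq0 R) gt_eqF.
  apply: (glue_total D0 _ L1 DL); first by apply: divr_gt0.
  by rewrite -etaE C2E -/sw; field; rewrite !gt_eqF.
exact: (glue_final (ltW L0) dk q6 Lb tE).
Qed.

End MergeTheorem.

(** * An approximate idempotent theorem after Shilov *)

Section Idempotents.
Context {R : realType} {A : comNzRingType} (iota : {rmorphism Cx R -> A}).
Local Notation C := (Cx R).
Variables (J : finType) (x : J -> A) (ev : (J -> C) -> {rmorphism A -> C}).
Hypothesis ev_iota : forall z c, ev z (iota c) = c.
Hypothesis ev_x : forall z j, ev z (x j) = z j.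
Hypothesis taylor : forall a z, exists b : J -> A,
  a = iota (ev z a) + \sum_j (x j - iota (z j)) * b j.

(* the largest seminorm below [B] for which [y] has norm at most 1 *)
Inductive adjoin (B : A -> R -> Prop) (y : A) : A -> R -> Prop :=
| adjoin_base a r : B a r -> adjoin B y a r
| adjoin_gen r : 1 < r -> adjoin B y y r
| adjoin_add a b r s : adjoin B y a r -> adjoin B y b s -> adjoin B y (a + b) (r + s)
| adjoin_mul a b r s : adjoin B y a r -> adjoin B y b s -> adjoin B y (a * b) (r * s)
| adjoin_le a r s : r <= s -> adjoin B y a r -> adjoin B y a s.

Lemma adjoin_gauge B y : gauge iota B -> gauge iota (adjoin B y).
Proof.
move=> gB; have gt0 a r : adjoin B y a r -> 0 < r.
  elim=> {a r} [a r /(gauge_gt0 gB)//|r|a b r s _ r0 _ s0|a b r s _ r0 _ s0|a r s rs _ r0].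
  - by move=> r1; lra.
  - exact: addr_gt0.
  - exact: mulr_gt0.
  - lra.
split=> //.
- exact: adjoin_add.
- exact: adjoin_mul.
- by move=> c r cr; apply: adjoin_base; exact: (gaugeC gB cr).
- by move=> a r s rs; exact: adjoin_le.
- move=> a r; elim=> {a r} [a r /(gauge_open gB)[s sr Bs]|r r1
      |a b r s _ [r' rr Hr] _ [s' ss Hs]|a b r s _ [r' rr Hr] _ [s' ss Hs]
      |a r s rs _ [r' rr Hr]].
  + by exists s => //; apply: adjoin_base.
  + by exists ((1 + r) / 2); [lra|apply: adjoin_gen; lra].
  + by exists (r' + s'); [lra|apply: adjoin_add].
  + exists (r' * s'); last exact: adjoin_mul.
    by rewrite ltr_pM// ltW// (gt0 _ _ Hr, gt0 _ _ Hs).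
  + by exists r' => //; lra.
- by move=> a; have [r Hr] := gauge_total gB a; exists r; apply: adjoin_base.
Qed.

Lemma spectrum_adjoin B y z :
  spectrum ev (adjoin B y) z <-> spectrum ev B z /\ modulus (ev z y) <= 1.
Proof.
split=> [H|[zB y1] a r].
  split; first by move=> a r Ba; apply: H; apply: adjoin_base.
  rewrite leNgt; apply/negP => y1.
  by have := H y _ (adjoin_gen B y y1); rewrite ltxx.
elim=> {a r} [a r /zB//|r r1|a b r s _ Hr _ Hs|a b r s _ Hr _ Hs|a r s rs _ Hr].
- by apply: le_lt_trans r1.
- by rewrite rmorphD; apply: le_lt_trans (modulusD _ _) _; apply: ltrD.
- by rewrite rmorphM modulusM ltr_pM ?modulus_ge0.
- exact: lt_le_trans Hr rs.
Qed.

Variables (B : A -> R -> Prop) (chi : (J -> C) -> bool).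
Hypothesis gB : gauge iota B.

(** [chi] can be approximated on every spectrum inside [S] of a seminorm below that of [B].
    Quantifying over [B'] lets [adjoin] cut the spectrum down further. *)
Definition separable (S : set (J -> C)) := forall B', gauge iota B' ->
  (forall a r, B a r -> B' a r) -> spectrum ev B' `<=` S ->
  exists e, forall z, spectrum ev B' z -> near01 (ev z e) (chi z).

Lemma separable_sub S S' : S' `&` spectrum ev B `<=` S -> separable S -> separable S'.
Proof.
move=> SS H B' gB' BB' HS'; apply: H => // z zB'; apply: SS; split; first exact: HS'.
exact: spectrum_sub BB' _ zB'.
Qed.

(* Half planes are approximated by large discs on the bounded set [spectrum B]. *)
Lemma separable_half S (y : A) (a d : R) : 0 < d ->
  separable [set z | S z /\ CRe (ev z y) <= a + d] ->
  separable [set z | S z /\ a - d <= CRe (ev z y)] -> separable S.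
Proof.
move=> d0 Hle Hge B' gB' BB' BS.
have [t t0 Ht] := gle_total gB' y.
pose q := t + `|a|.
have q0 : 0 <= q by rewrite /q; have := normr_ge0 a; lra.
(* The discs have radius r = La + d/2 and centres a - La and a + La. The bound 2 q^2 <= La d makes
   up for their curvature: where y is at distance at least La from the first centre, it lies in the
   second disc. *)
have [La [La0 Lad Laq]] : exists La, [/\ 0 < La, d <= La & 2 * q ^+ 2 <= La * d].
  exists (2 * q ^+ 2 / d + d); have : 0 <= 2 * q ^+ 2 / d.
    by rewrite divr_ge0 ?mulr_ge0 ?sqr_ge0// ltW.
  move=> H; split; try lra.
  have -> : (2 * q ^+ 2 / d + d) * d = 2 * q ^+ 2 + d * d by field; rewrite gt_eqF.
  by rewrite lerDl mulr_ge0// ltW.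
pose r := La + d / 2.
have r0 : 0 < r by rewrite /r; lra.
pose y1 := y - iota (RtoC (a - La)); pose y2 := y - iota (RtoC (a + La)).
have yE z : spectrum ev B' z -> exists u v : R, [/\ CRe (ev z y) = a + u,
    modulus (ev z y1) ^+ 2 = La ^+ 2 + 2 * La * u + v,
    modulus (ev z y2) ^+ 2 = La ^+ 2 - 2 * La * u + v, 0 <= v & v <= q ^+ 2].
  move=> zB'; have yt := spectrum_gle gB' zB' Ht.
  exists (CRe (ev z y) - a), (modulus (ev z y - RtoC a) ^+ 2); split.
  - by ring.
  - by rewrite rmorphB ev_iota !modulus_sqr; case: (ev z y) => u v /=; ring.
  - by rewrite rmorphB ev_iota !modulus_sqr; case: (ev z y) => u v /=; ring.
  - exact: sqr_ge0.
  - rewrite lerXn2r ?nnegrE ?modulus_ge0//.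
    by apply: le_trans (modulusB _ _) _; rewrite modulus_RtoC /q; lra.
have restrict y' : spectrum ev (adjoin B' (iota (RtoC r^-1) * y')) =
    [set z | spectrum ev B' z /\ modulus (ev z y') <= r].
  apply/seteqP; split=> z /=.
    move/spectrum_adjoin; rewrite rmorphM ev_iota modulusM.
    rewrite modulus_RtoC_ge0 ?invr_ge0 ?(ltW r0)//.
    by rewrite mulrC ler_pdivrMr// mul1r.
  move=> H; apply/spectrum_adjoin; rewrite rmorphM ev_iota modulusM.
  rewrite modulus_RtoC_ge0 ?invr_ge0 ?(ltW r0)//.
  by rewrite mulrC ler_pdivrMr// mul1r.
have sq_le (u v : R) : 0 <= u -> 0 <= v -> (u <= v) = (u ^+ 2 <= v ^+ 2).
  by move=> u0 v0; rewrite ler_pXn2r.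
have rE : r ^+ 2 = La ^+ 2 + La * d + d ^+ 2 / 4 by rewrite /r; field.
have d2 : d ^+ 2 / 4 <= La * d / 4 by rewrite expr2; nra.
have [||e1 He1] := Hle _ (adjoin_gauge (iota (RtoC r^-1) * y1) gB').
- by move=> b s /BB'; apply: adjoin_base.
- rewrite restrict => z /= [zB' zr]; split; first exact: BS.
  have [u [v [-> E1 _ v0 _]]] := yE z zB'.
  by move: zr; rewrite sq_le ?modulus_ge0 ?(ltW r0)// E1 rE lerD2l; nra.
have [||e2 He2] := Hge _ (adjoin_gauge (iota (RtoC r^-1) * y2) gB').
- by move=> b s /BB'; apply: adjoin_base.
- rewrite restrict => z /= [zB' zr]; split; first exact: BS.
  have [u [v [-> _ E2 v0 _]]] := yE z zB'.
  by move: zr; rewrite sq_le ?modulus_ge0 ?(ltW r0)// E2 rE; nra.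
apply: (@merge_near01 _ _ iota _ x ev ev_iota taylor B' y1 La r chi e1 e2) => //.
- by rewrite /r; lra.
- by move=> z zB' zr; apply: He1; rewrite restrict.
- move=> z zB' zr; apply: He2; rewrite restrict; split=> //.
  have [u [v [_ E1 E2 v0 vq]]] := yE z zB'.
  rewrite sq_le ?modulus_ge0 ?(ltW r0)// E2 rE.
  move: zr; rewrite sq_le ?modulus_ge0 ?(ltW La0)// E1.
  by have := sqr_ge0 d; lra.
Qed.

(** Grow a half plane by d/4 at a time, starting left of the spectrum and ending when it contains
    the spectrum. Each step joins, by [separable_half], the previous half plane and one slab. *)
Lemma separable_slabs S (y : A) (d : R) : 0 < d ->
  (forall a, separable [set z | S z /\ a <= CRe (ev z y) <= a + d]) -> separable S.
Proof.
move=> d0 H; have [t t0 Ht] := gle_total gB y.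
have ty z : spectrum ev B z -> - t <= CRe (ev z y) <= t.
  move=> zB; rewrite -ler_norml; apply: le_trans (CRe_le _) _.
  exact: spectrum_gle gB zB Ht.
have Hn n : separable [set z | S z /\ CRe (ev z y) <= - t - 1 + n%:R * (d / 4)].
  elim: n => [|n IH].
    move=> B' gB' BB' BS; exists 0 => z zB'; have [_ /=] := BS z zB'.
    by have := ty z (spectrum_sub BB' zB'); rewrite mul0r; lra.
  pose b := - t - 1 + n%:R * (d / 4).
  have bE : - t - 1 + n.+1%:R * (d / 4) = b + d / 4 by rewrite /b -natr1; ring.
  rewrite bE; apply: (@separable_half _ y (b - d / 4) (d / 4)).
  - lra.
  - by apply: separable_sub IH => z [[[Sz _] /= zb] _]; split=> //; rewrite -/b; lra.
  - apply: separable_sub (H (b - d / 2)) => z [[[/= Sz z1] z2] _]; split=> //=.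
    by lra.
have [n Hnn] : exists n : nat, (2 * t + 1) / (d / 4) <= n%:R.
  exists (Num.Def.archi_bound ((2 * t + 1) / (d / 4))).
  by apply/ltW/archi_boundP; apply: divr_ge0; lra.
apply: separable_sub (Hn n) => z [Sz /ty zt]; split=> //=.
by move: Hnn; rewrite ler_pdivrMr; lra.
Qed.

Lemma separable_boxes (K : eqType) (y : K -> A) (d : R) (s : seq K) S : 0 < d -> uniq s ->
  (forall a : K -> R, separable
     [set z | S z /\ forall k, k \in s -> a k <= CRe (ev z (y k)) <= a k + d]) ->
  separable S.
Proof.
move=> d0; elim: s S => [|k s IH] S /=.
  by move=> _ /(_ (fun=> 0)); apply: separable_sub => z [].
move=> /andP[ks us] H; apply: (separable_slabs (y := y k) d0) => a0.
apply: IH => // a.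
apply: separable_sub (H (fun k' => if k' == k then a0 else a k')) => z.
move=> [[[/= Sz z0] zs] _]; split=> //= k'.
rewrite inE; case: eqP => [->//|_] /= k's.
exact: zs.
Qed.

(** The real and imaginary parts of all coordinates cut the spectrum into boxes of side d/4, on each
    of which [chi] is constant, so that 0 or 1 will do; [separable_boxes] glues. *)
Theorem approximate_idempotent (d : R) : 0 < d ->
  (forall z z', spectrum ev B z -> spectrum ev B z' ->
     (forall j, modulus (z j - z' j) < d) -> chi z = chi z') ->
  exists e, forall z, spectrum ev B z -> near01 (ev z e) (chi z).
Proof.
move=> d0 Hchi.
suff H : separable setT by exact: (H B gB).
(* The real part of -i x_j is the imaginary part of x_j. *)
pose y (k : J * bool) := if k.2 then x k.1 else iota (Cmk 0 (-1)) * x k.1.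
have d40 : 0 < d / 4 by lra.
apply: (separable_boxes (y := y) (s := enum {: J * bool}) d40 (enum_uniq _)) => a.
move=> B' gB' BB' BS.
have [[z0 z0B]|H] := pselect (exists z, spectrum ev B' z); last first.
  by exists 0 => z zB; exfalso; apply: H; exists z.
exists (chi z0)%:R => z zB; rewrite /near01 rmorph_nat (Hchi z0 z).
- by rewrite subrr modulus0; have := @tolE R; lra.
- exact: spectrum_sub BB' _ z0B.
- exact: spectrum_sub BB' _ zB.
move=> j; have [_ /= Hz0] := BS _ z0B; have [_ /= Hz] := BS _ zB.
apply: le_lt_trans (modulus_le_ReIm _) _.
have := Hz0 (j, true) (mem_enum _ _); have := Hz0 (j, false) (mem_enum _ _).
have := Hz (j, true) (mem_enum _ _); have := Hz (j, false) (mem_enum _ _).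
rewrite /y /= !rmorphM !ev_iota !ev_x.
case: (z0 j) => u0 v0; case: (z j) => u v.
rewrite /CRe /CIm /= !mul0r !mulN1r !sub0r !opprK => h1 h2 h3 h4.
have [] : `|u0 - u| <= d / 4 /\ `|v0 - v| <= d / 4 by rewrite !ler_norml; lra.
lra.
Qed.

End Idempotents.

Section SharpBounded.
Context {R : realType} {A : comNzRingType} (iota : {rmorphism Cx R -> A}).
Local Notation C := (Cx R).
Variables (J : finType) (x : J -> A) (ev : (J -> C) -> {rmorphism A -> C}).
Hypothesis ev_iota : forall z c, ev z (iota c) = c.
Hypothesis taylor : forall a z, exists b : J -> A,
  a = iota (ev z a) + \sum_j (x j - iota (z j)) * b j.

Lemma spectral_power_bound B p r : gauge iota B -> 0 < r ->
  (forall z, spectrum ev B z -> modulus (ev z p) < r) ->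
  exists2 K, 1 <= K & power_bound B p K r.
Proof.
move=> gB r0 Hp; have [t t0 Ht] := gle_total gB p.
have [M M0 [b Hb]] : radius_lt (gquot B 0) p r.
  by apply: (spectral_radius ev_iota taylor gB r0) => z Hz _; apply: Hp.
exists ((1 + t / r) ^+ M).
  by rewrite exprn_ege1// lerDl divr_ge0// ltW.
by move=> i; apply: (gle_pow gB Ht) => //; rewrite mul0r addr0 in Hb.
Qed.

(** The differences of consecutive sharpenings are dominated by a geometric series, by
    [sharpS_bound] with f = e. That the bound holds for all [k] at once is essential in
    [no_strict_peak]. *)
Lemma sharp_bounded B chi e : gauge iota B ->
  (forall z, spectrum ev B z -> near01 (ev z e) (chi z)) ->
  exists2 b, 0 < b & forall k, gle B (sharp k e) b.
Proof.
move=> gB He.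
have h11 : 0 < (11 / 10 : R) by lra.
have h48 : 0 < (1 / 48 : R) by lra.
have lt11 (c : C) b : near01 c b -> modulus c < 11 / 10.
  by move=> /near01_le; lra.
have [|||K1 K11 H1] := @spectral_power_bound B e (11 / 10) => //.
  by move=> z /He/lt11.
have [|||K2 K21 H2] := @spectral_power_bound B (1 - e) (11 / 10) => //.
  by move=> z /He/near01C/lt11; rewrite rmorphB rmorph1.
have [|||K3 K31 H3] := @spectral_power_bound B (e * (1 - e)) (1 / 48) => //.
  by move=> z /He H; rewrite rmorphM rmorphB rmorph1; exact: (near01_mulC H H).
pose K := K1 + K2 + K3.
have le_pb p (r K' : R) : 0 < r -> K' <= K -> power_bound B p K' r ->
    power_bound B p K r.
  move=> r0 KK H i; apply: gle_le (H i); apply: ler_wpM2r => //.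
  by rewrite exprn_ge0// ltW.
have K1' : 1 <= K by rewrite /K; lra.
have [b0 b00 Hb0] := gle_total gB (sharp 0 e).
have [D D0 DE] : exists2 D, 0 <= D & D = 32 * K ^+ 6 * (11 / 10) ^+ 2 * (1 / 48).
  exists (32 * K ^+ 6 * (11 / 10) ^+ 2 * (1 / 48)) => //.
  have K6 : 0 <= K ^+ 6 by apply: exprn_ge0; lra.
  lra.
have HS k : gle B (sharp k.+1 e - sharp k e) (D * (1 / 2) ^+ k).
  have := @sharpS_bound _ _ _ _ gB k e K (11 / 10) (1 / 48) K1' (ltW h48) (ltW h11).
  move=> H; apply: gle_le (H _ _ _); last first.
  - by apply: le_pb H3; rewrite /K; lra.
  - by apply: le_pb H2; rewrite /K; lra.
  - by apply: le_pb H1; rewrite /K; lra.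
  - rewrite -DE; apply: ler_wpM2l => //.
    by rewrite lerXn2r ?nnegrE; lra.
exists (b0 + 2 * D); first lra.
suff H k : gle B (sharp k e) (b0 + D * (2 - 2 * (1 / 2) ^+ k)).
  move=> k; apply: gle_le (H k).
  have : 0 <= (1 / 2 : R) ^+ k by apply: exprn_ge0; lra.
  by move: (_ ^+ k) => u u0; nra.
elim: k => [|k IH]; first by rewrite expr0 mulr1 subrr mulr0 addr0.
have -> : sharp k.+1 e = (sharp k.+1 e - sharp k e) + sharp k e by ring.
apply: gle_le (gleD gB (HS k) IH).
by rewrite exprS; move: (_ ^+ k) => u; lra.
Qed.

End SharpBounded.

(** * Strict peaks on polynomial hulls *)

Section Truncation.
Context {R : realType}.
Local Notation C := (Cx R).
Variables (q : {poly C}) (rho : {poly R}) (theta b : R) (w : C) (J : nat).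
Hypotheses (q_rho : forall j, modulus q`_j <= rho`_j) (theta0 : 0 < theta).
Hypothesis rho_b : rho.[theta^-1] <= b.

Let term_ge0 j : 0 <= rho`_j * theta ^- j.
Proof.
apply: mulr_ge0; first exact: le_trans (modulus_ge0 _) (q_rho j).
by rewrite invr_ge0 exprn_ge0// ltW.
Qed.

Let sum_b n (P : pred nat) : \sum_(0 <= j < n | P j) rho`_j * theta ^- j <= b.
Proof.
apply: le_trans rho_b; rewrite (horner_coef_wide _ (leq_maxl (size rho) n)).
under [leRHS]eq_bigr do rewrite exprVn.
rewrite -(big_mkord xpredT (fun i => rho`_i * theta ^- i)).
rewrite [leRHS](big_cat_nat (n := n))//= ?leq_maxr//.
rewrite [X in _ <= X + _](bigID P)/= -addrA lerDl.
by rewrite addr_ge0// sumr_ge0.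
Qed.

(** The sum is the polynomial part of w^J q(w^-1). It has size theta^J for |w| <= theta; for |w| >=
    theta so does the part that is cut off, by [truncation_large]. *)
Lemma truncation_small : modulus w <= theta ->
  modulus (\sum_(j < J.+1) q`_j * w ^+ (J - j)) <= b * theta ^+ J.
Proof.
move=> wt; apply: le_trans (modulus_sum _ _ _) _.
apply: (@le_trans _ _ ((\sum_(0 <= j < J.+1) rho`_j * theta ^- j) * theta ^+ J)).
  rewrite big_mkord mulr_suml; apply: ler_sum => -[j /= jJ] _.
  rewrite modulusM modulusX -mulrA.
  apply: ler_pM; rewrite ?exprn_ge0 ?modulus_ge0 ?q_rho//.
  rewrite -{2}(subnK (_ : j <= J)%N)// exprD mulrC mulfK; last first.
    by rewrite expf_neq0// gt_eqF.
  by rewrite lerXn2r ?nnegrE ?modulus_ge0// ltW.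
by apply: ler_wpM2r; [rewrite exprn_ge0// ltW|exact: sum_b].
Qed.

Lemma truncation_large : theta <= modulus w ->
  modulus (\sum_(j < J.+1) q`_j * w ^+ (J - j) - w ^+ J * q.[w^-1])
    <= b * theta ^+ J.
Proof.
move=> tw; have w0 : w != 0 by rewrite -modulus_gt0; apply: lt_le_trans tw.
pose n := maxn (size q) J.+1.
rewrite (horner_coef_wide _ (leq_maxl (size q) J.+1)) -/n.
rewrite -(big_mkord xpredT (fun i => q`_i * w^-1 ^+ i)).
rewrite (big_cat_nat (n := J.+1))//= ?leq_maxr//.
rewrite big_mkord mulrDr.
have -> : w ^+ J * (\sum_(i < J.+1) q`_i * w^-1 ^+ i) =
    \sum_(j < J.+1) q`_j * w ^+ (J - j).
  rewrite mulr_sumr; apply: eq_bigr => -[j /= jJ] _.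
  rewrite -{1}(subnK (_ : j <= J)%N)// exprD exprVn mulrCA; congr (_ * _).
  by rewrite mulfK// expf_neq0.
rewrite opprD addrA subrr sub0r modulusN mulr_sumr.
apply: le_trans (modulus_sum _ _ _) _.
apply: (@le_trans _ _ (theta ^+ J * (\sum_(J.+1 <= j < n) rho`_j * theta ^- j))).
  rewrite mulr_sumr !big_nat; apply: ler_sum => j /andP[Jj _].
  rewrite !modulusM !modulusX modulusV mulrCA [leRHS]mulrCA.
  apply: ler_pM; rewrite ?q_rho ?modulus_ge0 ?mulr_ge0 ?exprn_ge0 ?invr_ge0 ?modulus_ge0//.
  have E (u : R) : 0 < u -> u ^+ J * u^-1 ^+ j = u^-1 ^+ (j - J).
    move=> u0; rewrite -{1}(subnK (ltnW Jj)) exprD mulrCA -exprMn mulfV ?gt_eqF//.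
    by rewrite expr1n mulr1.
  rewrite -exprVn !E ?modulus_gt0//.
  rewrite lerXn2r ?nnegrE ?invr_ge0 ?modulus_ge0//; first exact: ltW.
  by rewrite lef_pV2 ?posrE ?modulus_gt0.
rewrite mulrC; apply: ler_wpM2r; first by rewrite exprn_ge0// ltW.
by apply: le_trans (sum_b n (fun j => J < j)%N); rewrite (big_nat_widenl _ 0%N).
Qed.

End Truncation.

Lemma sum_option (V : nmodType) (J : finType) (F : option J -> V) :
  \sum_o F o = F None + \sum_j F (Some j).
Proof.
rewrite (bigD1 None)//= (reindex_omap Some id) => [|[]//].
by congr (_ + _); apply: eq_bigl => j; rewrite eqxx.
Qed.

Section Peak.
Context {R : realType} {P : comNzRingType} (iota : {rmorphism Cx R -> P}).
Local Notation C := (Cx R).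
Variables (J : finType) (x : J -> P) (ev : (J -> C) -> {rmorphism P -> C}).
Hypothesis ev_iota : forall z c, ev z (iota c) = c.
Hypothesis ev_x : forall z j, ev z (x j) = z j.
Hypothesis taylor : forall a z, exists b : J -> P,
  a = iota (ev z a) + \sum_j (x j - iota (z j)) * b j.

(** The new variable 'X, with index [None], will become the inverse of an element [g] in a
    quotient. *)
Definition iotaY : {rmorphism C -> {poly P}} := polyC \o iota.
Definition xY (o : option J) : {poly P} := if o is Some j then (x j)%:P else 'X.
Definition evY (z : option J -> C) : {rmorphism {poly P} -> C} :=
  (horner_eval (z None) : {poly C} -> C) \o map_poly (ev (z \o Some)).

Lemma evY_C z a : evY z a%:P = ev (z \o Some) a.
Proof. by rewrite /= /horner_eval map_polyC hornerC. Qed.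

Lemma evY_X z : evY z 'X = z None.
Proof. by rewrite /= /horner_eval map_polyX hornerX. Qed.

Lemma evY_iota z c : evY z (iotaY c) = c.
Proof. exact: etrans (evY_C z (iota c)) (ev_iota _ _). Qed.

Lemma evY_x z o : evY z (xY o) = z o.
Proof. by case: o => [j|]; rewrite /xY ?evY_X// evY_C ev_x. Qed.

Lemma taylorY a z : exists b : option J -> {poly P},
  a = iotaY (evY z a) + \sum_o (xY o - iotaY (z o)) * b o.
Proof.
elim/poly_ind: a => [|a c [b Hb]].
  by exists (fun=> 0); rewrite !rmorph0 add0r big1// => o _; rewrite mulr0.
have [d Hd] := taylor c (z \o Some).
exists (fun o => 'X * b o + if o is Some j then (d j)%:P else iotaY (evY z a)).
rewrite (rmorphD (evY z)) (rmorphM (evY z)) evY_C evY_X (rmorphD iotaY) (rmorphM iotaY).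
under eq_bigr do rewrite mulrDr mulrCA.
rewrite big_split -mulr_sumr [X in _ + (_ + X)]sum_option.
have -> : \sum_o (xY o - iotaY (z o)) * b o = a - iotaY (evY z a).
  by apply/eqP; rewrite eq_sym subr_eq addrC; apply/eqP.
have -> : \sum_j (xY (Some j) - iotaY (z (Some j))) * (d j)%:P =
    c%:P - iotaY (ev (z \o Some) c).
  apply/eqP; rewrite eq_sym subr_eq addrC {1}Hd rmorphD rmorph_sum/=; apply/eqP.
  by congr (_ + _); apply: eq_bigr => j _; rewrite rmorphM rmorphB.
by rewrite /xY; ring.
Qed.

Variable T : set (J -> C).
Hypothesis Tb : forall p, exists2 M, 0 <= M & forall v, T v -> modulus (ev v p) <= M.

Definition polyhull : set (J -> C) := [set z | forall p M, 0 <= M ->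
  (forall v, T v -> modulus (ev v p) <= M) -> modulus (ev z p) <= M].

Lemma sub_polyhull : T `<=` polyhull.
Proof. by move=> v Tv p M _; apply. Qed.

(* the norm  \sum_j sup_T |p_j| eta^j  on polynomials p *)
Definition coefs (eta : R) (p : {poly P}) (r : R) := exists rho : {poly R},
  [/\ forall j, 0 <= rho`_j, forall v j, T v -> modulus (ev v p`_j) <= rho`_j &
      rho.[eta] < r].

Lemma coefs_gauge eta : 0 <= eta -> gauge iotaY (coefs eta).
Proof.
move=> eta0; split.
- move=> a r [rho [rho0 _]]; apply: le_lt_trans.
  by rewrite horner_coef sumr_ge0// => i _; rewrite mulr_ge0// exprn_ge0.
- move=> a b r s [rho [rho0 Ha Hr]] [sig [sig0 Hb Hs]]; exists (rho + sig); split.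
  + by move=> j; rewrite coefD addr_ge0.
  + move=> v j Tv; rewrite !coefD rmorphD; apply: le_trans (modulusD _ _) _.
    by apply: lerD; [apply: Ha|apply: Hb].
  + by rewrite hornerD; apply: ltrD.
- move=> a b r s [rho [rho0 Ha Hr]] [sig [sig0 Hb Hs]]; exists (rho * sig).
  have ge0 (p : {poly R}) : (forall j, 0 <= p`_j) -> 0 <= p.[eta].
    by move=> p0; rewrite horner_coef sumr_ge0// => i _; rewrite mulr_ge0// exprn_ge0.
  split.
  + by move=> j; rewrite coefM sumr_ge0// => i _; rewrite mulr_ge0.
  + move=> v j Tv; rewrite !coefM rmorph_sum; apply: le_trans (modulus_sum _ _ _) _.
    apply: ler_sum => i _; rewrite rmorphM modulusM.
    by apply: ler_pM; rewrite ?modulus_ge0 ?Ha ?Hb.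
  + by rewrite hornerM ltr_pM ?ge0.
- move=> c r cr; exists (modulus c)%:P; split.
  + by move=> j; rewrite coefC; case: ifP; rewrite ?modulus_ge0.
  + move=> v j _; rewrite /iotaY /= !coefC; case: ifP => _; last by rewrite rmorph0 modulus0.
    by rewrite ev_iota.
  + by rewrite hornerC.
- by move=> a r s rs [rho [? ? Hr]]; exists rho; split=> //; apply: lt_le_trans rs.
- move=> a r [rho [? ? Hr]]; exists ((rho.[eta] + r) / 2); first lra.
  by exists rho; split=> //; lra.
- move=> a; pose M j := sval (cid2 (Tb a`_j)).
  exists ((\poly_(j < size a) M j).[eta] + 1), (\poly_(j < size a) M j); split.
  + by move=> j; rewrite coef_poly; case: ifP => // _; rewrite /M; case: cid2.
  + move=> v j Tv; rewrite coef_poly; case: ltnP => [_|aj].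
      by rewrite /M; case: cid2 => /= ? _; apply.
    by rewrite nth_default// rmorph0 modulus0.
  + by rewrite ltrDl.
Qed.

Lemma spectrum_coefs eta z : 0 <= eta -> spectrum evY (coefs eta) z ->
  polyhull (z \o Some) /\ modulus (z None) <= eta.
Proof.
move=> eta0 Hz; split=> [p M M0 HM|]; apply/ler_addgt0Pr => e e0; apply: ltW.
  rewrite -evY_C; apply: Hz; exists M%:P; split.
  - by move=> j; rewrite coefC; case: ifP.
  - by move=> v j Tv; rewrite !coefC; case: ifP => _; rewrite ?HM// rmorph0 modulus0.
  - by rewrite hornerC ltrDl.
rewrite -evY_X; apply: Hz; exists 'X; split.
- by move=> j; rewrite coefX.
- move=> v j Tv; rewrite !coefX; case: eqP => _ /=; rewrite ?rmorph1 ?rmorph0 ?modulus0//.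
  by rewrite modulus1.
- by rewrite hornerX ltrDl.
Qed.

Lemma coefs_spectrum eta z : 0 <= eta -> polyhull (z \o Some) ->
  modulus (z None) <= eta -> spectrum evY (coefs eta) z.
Proof.
move=> eta0 Hz ze a r [rho [rho0 Ha Hr]]; apply: le_lt_trans Hr.
pose q := map_poly (ev (z \o Some)) a.
rewrite (_ : evY z a = q.[z None])// (horner_coef_wide _ (leq_maxl (size q) (size rho))).
rewrite (horner_coef_wide _ (leq_maxr (size q) (size rho))).
apply: le_trans (modulus_sum _ _ _) _; apply: ler_sum => j _.
rewrite modulusM modulusX coef_map; apply: ler_pM; rewrite ?exprn_ge0 ?modulus_ge0//.
  by apply: Hz => // v Tv; apply: Ha.
by rewrite lerXn2r ?nnegrE ?modulus_ge0.
Qed.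


(** Since |g| < theta on the shell around [v0], the box inside the shell is open and closed in the
    part of the hull where |g| >= theta. Sharpen an approximate indicator of it, represent it by a
    polynomial A in 1/g, and let [h] be the polynomial part of g^J A(1/g). On [T], |h| is of order
    theta^J, where |g| <= theta because of the truncation, and elsewhere because the indicator is
    nearly 0. At [v0], |h| is of order |g(v0)|^J, which is larger, although [v0] is in the hull of
    [T]. *)
Lemma no_strict_peak v0 g (theta rho : R) : 0 < theta -> 0 < rho ->
  polyhull v0 -> theta < modulus (ev v0 g) ->
  (forall v, polyhull v -> (forall j, modulus (v j - v0 j) <= rho) ->
     (exists j, rho / 2 <= modulus (v j - v0 j)) -> modulus (ev v g) < theta) ->
  (forall v, T v -> exists j, rho / 2 <= modulus (v j - v0 j)) -> False.
Proof.
move=> th0 rho0 Kv0 gv0 Hshell HT.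
have eta0 : 0 <= theta^-1 by rewrite invr_ge0 ltW.
(* The spectrum of [B] is the part of the hull where |g| >= theta, with 1/g as last coordinate. *)
pose y1 := g%:P * 'X - 1; pose B := gquot (coefs theta^-1) y1.
have gB : gauge iotaY B by apply: gquot_gauge; exact: coefs_gauge.
pose chi (z : option J -> C) := [forall j, modulus (z (Some j) - v0 j) < rho / 2].
have ev_y1 z : evY z y1 = ev (z \o Some) g * z None - 1.
  by rewrite (rmorphB (evY z)) (rmorphM (evY z)) evY_C evY_X rmorph1.
have specB z : spectrum evY B z -> [/\ polyhull (z \o Some), modulus (z None) <= theta^-1
    & theta <= modulus (ev (z \o Some) g)].
  move=> /(spectrum_gquot (coefs_gauge eta0))[/(spectrum_coefs eta0)[zK zN]].
  rewrite ev_y1 => /eqP; rewrite subr_eq0 => /eqP gz; split=> //.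
  have : modulus (ev (z \o Some) g) * modulus (z None) = 1.
    by rewrite -modulusM gz modulus1.
  have zp : 0 < modulus (z None).
    by rewrite modulus_gt0; apply/eqP => z0; move: gz; rewrite z0 mulr0 => /eqP; rewrite eq_sym oner_eq0.
  move=> E; rewrite -[theta]invrK.
  have -> : modulus (ev (z \o Some) g) = (modulus (z None))^-1.
    by apply: (mulIf (lt0r_neq0 zp)); rewrite E mulVf// gt_eqF.
  by rewrite lef_pV2 ?posrE ?invr_gt0.
have Bspec v : polyhull v -> theta <= modulus (ev v g) ->
    spectrum evY B (fun o => if o is Some j then v j else (ev v g)^-1).
  move=> Kv vg a r [c Hc].
  set z := (X in evY X).
  have zc : spectrum evY (coefs theta^-1) z.
    apply: coefs_spectrum => //=.
    by rewrite modulusV lef_pV2 ?posrE//; apply: lt_le_trans vg.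
  have := zc _ _ Hc.
  rewrite (rmorphD (evY z)) (rmorphM (evY z)) ev_y1 /= mulfV ?subrr ?mul0r ?addr0//.
  by rewrite -modulus_gt0; apply: lt_le_trans vg.
have [e He] : exists e, forall z, spectrum evY B z -> near01 (evY z e) (chi z).
  apply: (approximate_idempotent evY_iota evY_x taylorY gB (d := rho / 2)); first lra.
  have half z z' : spectrum evY B z -> spectrum evY B z' ->
      (forall j, modulus (z j - z' j) < rho / 2) -> chi z -> chi z'.
    move=> /specB[_ _ _] /specB[Kz' _ gz'] zz' /forallP zv.
    apply/forallP => j; rewrite ltNge; apply/negP => jv.
    suff : modulus (ev (z' \o Some) g) < theta by rewrite ltNge gz'.
    apply: Hshell => //; last by exists j.
    move=> i; rewrite (_ : _ - _ = (z (Some i) - v0 i) - (z (Some i) - z' (Some i))); last first.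
      by rewrite /=; ring.
    by apply: le_trans (modulusB _ _) _; have := zv i; have := zz' (Some i); lra.
  move=> z z' Hz Hz' zz'; apply/idP/idP; first exact: half zz'.
  by apply: half => // j; rewrite modulusBC.
have [b b0 Hb] := sharp_bounded evY_iota taylorY gB He.
pose G0 := modulus (ev v0 g).
have G00 : 0 < G0 by apply: lt_trans gv0.
(* [J0] is chosen from the bound [b] alone, and only then [k], so large that the error of sharp k e,
   multiplied by (max |g|)^J0, stays below theta^J0. *)
have [J0 HJ0] : exists n, forall m, (n <= m)%N -> (theta / G0) ^+ m < (4 * (b + 2))^-1.
  apply: expr_small; first by rewrite divr_ge0// ltW.
    by rewrite ltr_pdivrMr// mul1r.
  by rewrite invr_gt0; lra.
have [M M0 HM] := Tb g.
have [k Hk] : exists k, (1 / 8 : R) ^+ k * M ^+ J0 <= theta ^+ J0.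
  have [|||n Hn] := @expr_small R (1 / 8) (theta ^+ J0 / (M ^+ J0 + 1)); [lra|lra| |].
    by apply: divr_gt0; rewrite ?exprn_gt0// ltr_wpDl ?exprn_ge0.
  exists n; have MJ : 0 <= M ^+ J0 by rewrite exprn_ge0.
  have /ltW := Hn n (leqnn n); rewrite ler_pdivlMr; last lra.
  apply: le_trans; apply: ler_wpM2l; last lra.
  by rewrite exprn_ge0//; lra.
(* A representative of sharp k e modulo g 'X - 1, whose own norm is less than b + 1. *)
have [c [r [r0 Hr rb]]] := Hb k _ ltr01.
set A := sharp k e + y1 * c in Hr.
have Aev v : theta <= modulus (ev v g) -> polyhull v ->
    modulus ((map_poly (ev v) A).[(ev v g)^-1] - [forall j, modulus (v j - v0 j) < rho / 2]%:R)
      <= (1 / 8) ^+ k / 20.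
  move=> vg Kv; have Hz := Bspec v Kv vg.
  have := sharp_near01 k (He _ Hz); rewrite -rmorph_sharp.
  set z := (X in evY X) => H.
  have -> : (map_poly (ev v) A).[(ev v g)^-1] = evY z A by [].
  rewrite /A (rmorphD (evY z)) (rmorphM (evY z) y1 c) ev_y1 /=.
  rewrite mulfV ?subrr ?mul0r ?addr0//.
  by rewrite -modulus_gt0; apply: lt_le_trans vg.
pose h := \sum_(j < J0.+1) A`_j * g ^+ (J0 - j).
have hE v : ev v h = \sum_(j < J0.+1) (map_poly (ev v) A)`_j * (ev v g) ^+ (J0 - j).
  rewrite rmorph_sum; apply: eq_bigr => j _.
  by rewrite rmorphM rmorphXn coef_map.
have thJ : 0 < theta ^+ J0 by rewrite exprn_gt0.
have hT v : T v -> modulus (ev v h) <= (b + 2) * theta ^+ J0.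
  move=> Tv; rewrite hE.
  have qr j : modulus (map_poly (ev v) A)`_j <= r`_j by rewrite coef_map; exact: Hr.
  have [vg|/ltW vg] := leP (modulus (ev v g)) theta.
    apply: le_trans (truncation_small J0 qr th0 (ltW rb) vg) _.
    by apply: ler_wpM2r; [exact: ltW|lra].
  have H1 := truncation_large J0 qr th0 (ltW rb) vg.
  have := Aev v vg (sub_polyhull Tv).
  have -> : [forall j, modulus (v j - v0 j) < rho / 2] = false.
    by apply/negbTE/forallPn; have [j jv] := HT v Tv; exists j; rewrite -leNgt.
  rewrite mulr0n subr0 => H2.
  set S := \sum_(j < _) _ in H1 *; set Q := _.[_] in H1 H2.
  have -> : S = (S - ev v g ^+ J0 * Q) + ev v g ^+ J0 * Q by ring.
  apply: le_trans (modulusD _ _) _; rewrite modulusM modulusX.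
  have : modulus (ev v g) ^+ J0 * modulus Q <= theta ^+ J0.
    apply: le_trans Hk; rewrite mulrC; apply: ler_pM; rewrite ?modulus_ge0 ?exprn_ge0 ?modulus_ge0//.
      apply: le_trans H2 _; have : 0 <= (1 / 8 : R) ^+ k by apply: exprn_ge0; lra.
      by move: (_ ^+ k) => u; lra.
    by rewrite lerXn2r ?nnegrE ?modulus_ge0// HM.
  by move: H1; move: (modulus (S - _)) (_ * modulus Q) (theta ^+ J0) => u1 u2 u3; lra.
have b2 : 0 <= (b + 2) * theta ^+ J0 by apply: mulr_ge0; lra.
have := Kv0 h _ b2 hT; rewrite hE.
have qr j : modulus (map_poly (ev v0) A)`_j <= r`_j.
  by rewrite coef_map; apply: Kv0 => // v Tv; apply: Hr.
have H1 := truncation_large J0 qr th0 (ltW rb) (ltW gv0).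
have := Aev v0 (ltW gv0) Kv0.
have -> : [forall j, modulus (v0 j - v0 j) < rho / 2] = true.
  by apply/forallP => j; rewrite subrr modulus0; lra.
rewrite mulr1n.
set S := \sum_(j < _) _ in H1 *; set Q := _.[_] in H1 * => H2 H3.
have G0J : 0 < G0 ^+ J0 by rewrite exprn_gt0.
have H4 : (b + 2) * theta ^+ J0 < G0 ^+ J0 / 4.
  have := HJ0 J0 (leqnn _); rewrite expr_div_n ltr_pdivrMr// => H.
  have b2' : 0 < b + 2 by lra.
  rewrite -(ltr_pM2l b2') in H; apply: lt_le_trans H _.
  by rewrite mulrA [leRHS]mulrC ler_wpM2r ?(ltW G0J)// invfM mulrCA mulfV ?mulr1 ?gt_eqF.
have H5 : G0 ^+ J0 * modulus Q <= modulus S + modulus (S - ev v0 g ^+ J0 * Q).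
  have := modulusB S (S - ev v0 g ^+ J0 * Q).
  rewrite (_ : S - (S - ev v0 g ^+ J0 * Q) = ev v0 g ^+ J0 * Q); last by ring.
  by rewrite modulusM modulusX.
have H6 : 19 / 20 <= modulus Q.
  have := modulus_lb 1 Q; rewrite modulusBC modulus1.
  have : (1 / 8 : R) ^+ k <= 1 by apply: exprn_ile1; lra.
  by move: H2; move: (_ ^+ k) => u; lra.
have : G0 ^+ J0 * (19 / 20) <= G0 ^+ J0 * modulus Q by rewrite ler_pM2l.
move: H1 H3 H4 H5 G0J thJ {H2 H6 hT b2}.
move: (modulus (S - _)) (theta ^+ J0) (G0 ^+ J0 * modulus Q) (G0 ^+ J0) (modulus S).
move=> u1 u2 u3 u4 u5 H1 H3 H4 H5 G0J thJ; lra.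
Qed.

End Peak.

(** * Goursat's theorem for trapezoidal sums *)

Section Goursat.
Context {R : realType}.
Local Notation C := (Cx R).
Local Notation "'I" := (Cmk 0 1 : C).
Implicit Types (psi : C -> C) (a h z : C) (s : R).

(** The trapezoidal mean over the segment from [a] to [a + h], with 2^k subintervals; the recursion
    is designed for the bisection of squares. *)
Fixpoint avg k psi a h : C := if k is k'.+1
  then (avg k' psi a (h / 2) + avg k' psi (a + h / 2) (h / 2)) / 2
  else (psi a + psi (a + h)) / 2.

Lemma avg_ind (D : set C) k psi a h :
  (forall u v, D u -> D v -> D ((u + v) / 2)) ->
  (forall t : R, 0 <= t <= 1 -> D (psi (a + RtoC t * h))) -> D (avg k psi a h).
Proof.
move=> Dmid; elim: k a h => [|k IH] a h Hpsi /=.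
  apply: Dmid; first by have := Hpsi 0; rewrite rmorph0 mul0r addr0; apply; lra.
  by have := Hpsi 1; rewrite rmorph1 mul1r; apply; lra.
have half t : RtoC t * (h / 2) = RtoC (t / 2) * h.
  by rewrite rmorphM fmorphV rmorph_nat; ring.
apply: Dmid; apply: IH => t t01.
  by rewrite half; apply: Hpsi; lra.
have -> : a + h / 2 + RtoC t * (h / 2) = a + RtoC ((1 + t) / 2) * h.
  by rewrite !rmorphM rmorphD rmorph1 fmorphV rmorph_nat; ring.
by apply: Hpsi; lra.
Qed.

Lemma avg_le k psi a h d :
  (forall t : R, 0 <= t <= 1 -> modulus (psi (a + RtoC t * h)) <= d) ->
  modulus (avg k psi a h) <= d.
Proof.
apply: (@avg_ind [set u | modulus u <= d]) => u v /= ud vd.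
rewrite modulusM modulusV modulus_natr ler_pdivrMr//.
by apply: le_trans (modulusD _ _) _; lra.
Qed.

Lemma avgD k psi psi' a h :
  avg k (fun z => psi z + psi' z) a h = avg k psi a h + avg k psi' a h.
Proof. by elim: k a h => [|k IH] a h /=; rewrite ?IH; field. Qed.

Lemma avgZ k c psi a h : avg k (fun z => c * psi z) a h = c * avg k psi a h.
Proof. by elim: k a h => [|k IH] a h /=; rewrite ?IH; field. Qed.

Lemma avg_affine k c b a h : avg k (fun z => c + b * z) a h = c + b * (a + h / 2).
Proof. by elim: k a h => [|k IH] a h /=; rewrite ?IH; field. Qed.

(* the sum of the trapezoidal rule along the boundary of the square with corners
   a, a + s, a + s + i s, a + i s *)
Definition contour k psi a s : C :=
  RtoC s * (avg k psi a (RtoC s) - avg k psi (a + 'I * RtoC s) (RtoC s)) +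
  'I * RtoC s *
    (avg k psi (a + RtoC s) ('I * RtoC s) - avg k psi a ('I * RtoC s)).

Lemma contourD k psi psi' a s :
  contour k (fun z => psi z + psi' z) a s = contour k psi a s + contour k psi' a s.
Proof. by rewrite /contour !avgD; ring. Qed.

Lemma contourZ k c psi a s :
  contour k (fun z => c * psi z) a s = c * contour k psi a s.
Proof. by rewrite /contour !avgZ; ring. Qed.

Lemma contour_affine k c b a s : contour k (fun z => c + b * z) a s = 0.
Proof. by rewrite /contour !avg_affine; ring. Qed.

Definition square a s : set C := [set z |
  CRe a <= CRe z <= CRe a + s /\ CIm a <= CIm z <= CIm a + s].

Definition edges a s : set C := [set z | square a s z /\
  [|| CRe z == CRe a, CRe z == CRe a + s, CIm z == CIm a | CIm z == CIm a + s]].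

Lemma CRe_D z z' : CRe (z + z') = CRe z + CRe z'. Proof. by case: z; case: z'. Qed.
Lemma CIm_D z z' : CIm (z + z') = CIm z + CIm z'. Proof. by case: z; case: z'. Qed.
Lemma CRe_RtoC (t : R) : CRe (RtoC t) = t. Proof. by []. Qed.
Lemma CIm_RtoC (t : R) : CIm (RtoC t) = 0. Proof. by []. Qed.
Lemma CRe_I (t : R) : CRe ('I * RtoC t) = 0.
Proof. by rewrite /CRe /= mul0r mulr0 subrr. Qed.
Lemma CIm_I (t : R) : CIm ('I * RtoC t) = t.
Proof. by rewrite /CIm /= mul1r mul0r add0r. Qed.

Lemma edges_param a s (t : R) : 0 <= s -> 0 <= t <= 1 ->
  [/\ edges a s (a + RtoC t * RtoC s),
      edges a s (a + 'I * RtoC s + RtoC t * RtoC s),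
      edges a s (a + RtoC s + RtoC t * ('I * RtoC s)) &
      edges a s (a + RtoC t * ('I * RtoC s))].
Proof.
move=> s0 t01; have ts : 0 <= t * s by rewrite mulr_ge0//; lra.
have ts' : t * s <= s by rewrite ler_piMl//; lra.
rewrite -rmorphM mulrCA -rmorphM.
by split; rewrite /edges /square /= !(CRe_D, CIm_D, CRe_RtoC, CIm_RtoC, CRe_I, CIm_I);
  rewrite ?addr0 ?eqxx ?orbT; split=> //; lra.
Qed.

Lemma contour_le k psi a s d : 0 <= s ->
  (forall z, edges a s z -> modulus (psi z) <= d) ->
  modulus (contour k psi a s) <= 4 * s * d.
Proof.
move=> s0 Hd; have Hp t (t01 : 0 <= t <= 1) := edges_param a s0 t01.
have B1 : modulus (avg k psi a (RtoC s)) <= d.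
  by apply: avg_le => t /Hp[? _ _ _]; apply: Hd.
have B2 : modulus (avg k psi (a + 'I * RtoC s) (RtoC s)) <= d.
  by apply: avg_le => t /Hp[_ ? _ _]; apply: Hd.
have B3 : modulus (avg k psi (a + RtoC s) ('I * RtoC s)) <= d.
  by apply: avg_le => t /Hp[_ _ ? _]; apply: Hd.
have B4 : modulus (avg k psi a ('I * RtoC s)) <= d.
  by apply: avg_le => t /Hp[_ _ _ ?]; apply: Hd.
have I1 : modulus 'I = 1.
  apply/eqP; rewrite -(eqrXn2 (n := 2))// ?modulus_ge0// modulus_sqr.
  by rewrite /CRe /CIm /= expr0n add0r.
apply: le_trans (modulusD _ _) _; rewrite !modulusM I1 mul1r modulus_RtoC_ge0//.
rewrite -mulrDr -mulrA mulrCA ler_wpM2l//.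
apply: le_trans (lerD (modulusB _ _) (modulusB _ _)) _.
lra.
Qed.

(** Each inner edge belongs to two quarters, which traverse it in opposite directions. One order [k]
    is used up. *)
Lemma contour_split k psi a s : let h := s / 2 in
  contour k.+1 psi a s = contour k psi a h + contour k psi (a + RtoC h) h +
    contour k psi (a + 'I * RtoC h) h + contour k psi (a + RtoC h + 'I * RtoC h) h.
Proof.
move=> h; have sh : RtoC s = RtoC h * 2 by rewrite -(rmorph_nat RtoC) -rmorphM /h divfK.
rewrite /contour /= !sh.
have -> : RtoC h * 2 / 2 = RtoC h by field.
have -> : 'I * (RtoC h * 2) / 2 = 'I * RtoC h by field.
have -> : a + 'I * RtoC h + 'I * RtoC h = a + 'I * (RtoC h * 2) by ring.
have -> : a + RtoC h + RtoC h = a + RtoC h * 2 by ring.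
have -> : a + RtoC h + 'I * RtoC h + 'I * RtoC h = a + 'I * (RtoC h * 2) + RtoC h by ring.
have -> : a + RtoC h + 'I * RtoC h + RtoC h = a + RtoC h * 2 + 'I * RtoC h by ring.
have -> : a + 'I * RtoC h + RtoC h = a + RtoC h + 'I * RtoC h by ring.
by field.
Qed.

(* An additive function of squares, which is at least their side if they
   contain [z]: it accounts for the point where [psi] is only continuous. *)
Definition slit z a s : R := s * ((CRe a <= CRe z < CRe a + s)%R%:R +
  (CRe a < CRe z <= CRe a + s)%R%:R).

(** Both half-open indicators are additive under horizontal bisection, and the two rows of quarters
    restore the factor s = 2h. *)
Lemma slit_split z a s : 0 < s -> let h := s / 2 in
  slit z a s = slit z a h + slit z (a + RtoC h) h +
    slit z (a + 'I * RtoC h) h + slit z (a + RtoC h + 'I * RtoC h) h.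
Proof.
move=> s0 h; rewrite /slit !CRe_D !CRe_I CRe_RtoC !addr0.
have -> : CRe a + h + h = CRe a + s by rewrite /h; field.
have h0 : 0 < h by rewrite /h; lra.
have -> : s = h * 2 by rewrite /h; field.
move: (CRe a) (CRe z) => u x.
case: (leP u x) => h1; case: (ltP x (u + h * 2)) => h2; case: (ltP x (u + h)) => h3;
 case: (leP (u + h) x) => h4; case: (leP x (u + h)) => h5; case: (ltP u x) => h6;
 case: (ltP (u + h) x) => h7; case: (leP x (u + h * 2)) => h8; rewrite ?andbT ?andbF ?mulr1n ?mulr0n; lra.
Qed.

Lemma slit_ge z a s : 0 < s -> square a s z -> s <= slit z a s.
Proof.
move=> s0 [/andP[h1 h2] _]; rewrite /slit h1 h2 /= andbT; apply: ler_peMr; first exact: ltW.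
by case: ltP => h3; case: ltP => h4; rewrite ?mulr1n ?mulr0n; lra.
Qed.

Lemma slit_ge0 z a s : 0 <= s -> 0 <= slit z a s.
Proof. by move=> s0; rewrite /slit mulr_ge0// addr_ge0. Qed.

Definition cdiff psi z := exists b, forall d, 0 < d -> exists2 e, 0 < e &
  forall z', modulus (z' - z) < e ->
    modulus (psi z' - psi z - b * (z' - z)) <= d * modulus (z' - z).

Definition ccont psi z := forall d, 0 < d -> exists2 e, 0 < e &
  forall z', modulus (z' - z) < e -> modulus (psi z' - psi z) <= d.

Lemma square_dist a s z z' : square a s z -> square a s z' ->
  modulus (z' - z) <= 2 * s.
Proof.
move=> [Rz Iz] [Rz' Iz']; apply: le_trans (modulus_le_ReIm _) _.
have -> : CRe (z' - z) = CRe z' - CRe z by case: (z); case: (z').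
have -> : CIm (z' - z) = CIm z' - CIm z by case: (z); case: (z').
have [] : `|CRe z' - CRe z| <= s /\ `|CIm z' - CIm z| <= s by rewrite !ler_norml; lra.
lra.
Qed.

Section Nested.
Variables (psi : C -> C) (z : C) (eps : R).
Hypothesis eps0 : 0 < eps.

(** The right-hand side is additive over the four quarters of a square, so the property passes from
    them to the square. *)
Definition small_contour a s := exists m0, forall m, (m0 <= m)%N ->
  modulus (contour m psi a s) <= eps * (s ^+ 2 + slit z a s).

Lemma small_contour_diff x : cdiff psi x -> exists2 e, 0 < e &
  forall a s, 0 < s -> s < e -> square a s x -> small_contour a s.
Proof.
move=> [b /(_ (eps / 8) _)[|e e0 He]]; first by rewrite divr_gt0.
exists (e / 2); first by rewrite divr_gt0.
move=> a s s0 se xs; exists 0%N => m _.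
pose aff w := psi x - b * x + b * w.
have -> : contour m psi a s = contour m (fun w => aff w + (psi w - aff w)) a s.
  by congr contour; apply/funext => w; ring.
rewrite contourD contour_affine add0r.
apply: (@le_trans _ _ (4 * s * (eps / 8 * (2 * s)))).
  apply: contour_le; first exact: ltW.
  move=> w [ws _]; have xw := square_dist xs ws.
  rewrite (_ : psi w - aff w = psi w - psi x - b * (w - x)); last by rewrite /aff; ring.
  apply: le_trans (He w _) _; first by lra.
  by apply: ler_wpM2l xw; rewrite divr_ge0// ltW.
rewrite (_ : 4 * s * _ = eps * s ^+ 2); last by field.
by rewrite ler_pM2l// lerDl slit_ge0// ltW.
Qed.

Lemma small_contour_cont : ccont psi z -> exists2 e, 0 < e &
  forall a s, 0 < s -> s < e -> square a s z -> small_contour a s.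
Proof.
move=> /(_ (eps / 4) _)[|e e0 He]; first by rewrite divr_gt0.
exists (e / 2); first by rewrite divr_gt0.
move=> a s s0 se xs; exists 0%N => m _.
have -> : contour m psi a s =
    contour m (fun w => (psi z + 0 * w) + (psi w - psi z)) a s.
  by congr contour; apply/funext => w; ring.
rewrite contourD contour_affine add0r.
apply: (@le_trans _ _ (4 * s * (eps / 4))).
  apply: contour_le; first exact: ltW.
  move=> w [ws _]; have xw := square_dist xs ws.
  by apply: He; lra.
rewrite (_ : 4 * s * _ = eps * s); last by field.
rewrite ler_pM2l//; apply: le_trans (slit_ge s0 xs) _.
by rewrite lerDr sqr_ge0.
Qed.

Lemma small_contour_split a s : 0 < s ->
  ~ small_contour a s -> exists2 a', ~ small_contour a' (s / 2) &
    CRe a <= CRe a' /\ CRe a' <= CRe a + s / 2 /\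
    CIm a <= CIm a' /\ CIm a' <= CIm a + s / 2.
Proof.
move=> s0 nP; apply: contrapT => H; apply: nP; pose h := s / 2.
have h0 : 0 < h by rewrite /h; lra.
have P a' : CRe a <= CRe a' /\ CRe a' <= CRe a + h /\
    CIm a <= CIm a' /\ CIm a' <= CIm a + h -> small_contour a' h.
  by move=> aa'; apply: contrapT => na'; apply: H; exists a'.
have [|m1 H1] := P a; first lra.
have [|m2 H2] := P (a + RtoC h).
  by rewrite !(CRe_D, CIm_D, CRe_RtoC, CIm_RtoC); lra.
have [|m3 H3] := P (a + 'I * RtoC h).
  by rewrite !(CRe_D, CIm_D, CRe_I, CIm_I); lra.
have [|m4 H4] := P (a + RtoC h + 'I * RtoC h).
  by rewrite !(CRe_D, CIm_D, CRe_RtoC, CIm_RtoC, CRe_I, CIm_I); lra.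
exists (m1 + m2 + m3 + m4).+1 => -[//|m] mm.
rewrite contour_split (slit_split z a s0) -/h.
rewrite (_ : s ^+ 2 = h ^+ 2 + h ^+ 2 + h ^+ 2 + h ^+ 2); last by rewrite /h; field.
have := H1 m ltac:(lia); have := H2 m ltac:(lia).
have := H3 m ltac:(lia); have := H4 m ltac:(lia).
move: (contour m psi a h) (contour m psi (a + RtoC h) h)
  (contour m psi (a + 'I * RtoC h) h) (contour m psi (a + RtoC h + 'I * RtoC h) h).
move=> c1 c2 c3 c4 B4 B3 B2 B1.
have : modulus (c1 + c2 + c3 + c4) <= modulus c1 + modulus c2 + modulus c3 + modulus c4.
  apply: le_trans (modulusD _ _) _; rewrite lerD2r.
  by apply: le_trans (modulusD _ _) _; rewrite lerD2r; exact: modulusD.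
lra.
Qed.

End Nested.

Lemma nested_squares (P : C -> R -> Prop) a s : 0 < s ->
  (forall a s, 0 < s -> P a s -> exists2 a', P a' (s / 2) &
    CRe a <= CRe a' /\ CRe a' <= CRe a + s / 2 /\
    CIm a <= CIm a' /\ CIm a' <= CIm a + s / 2) ->
  P a s -> exists2 x, square a s x & forall e, 0 < e ->
    exists a' s', [/\ 0 < s', s' < e, square a' s' x & P a' s'].
Proof.
move=> s0 step Pa.
pose Q := {u : C * R | 0 < u.2 /\ P u.1 u.2}.
have nextP (u : Q) : exists v : Q, (sval v).2 = (sval u).2 / 2 /\
    (CRe (sval u).1 <= CRe (sval v).1 /\ CRe (sval v).1 <= CRe (sval u).1 + (sval u).2 / 2 /\
    CIm (sval u).1 <= CIm (sval v).1 /\ CIm (sval v).1 <= CIm (sval u).1 + (sval u).2 / 2).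
  case: u => -[a1 s1] [/= s10 Pa1]; have [a' Pa' H] := step _ _ s10 Pa1.
  have Q' : 0 < (a', s1 / 2).2 /\ P (a', s1 / 2).1 (a', s1 / 2).2 by split=> //=; lra.
  by exists (exist _ (a', s1 / 2) Q').
pose next u := sval (cid (nextP u)).
have nextE u : _ := svalP (cid (nextP u)).
pose u0 : Q := exist _ (a, s) (conj s0 Pa).
pose q n := sval (iter n next u0).
have qS n : (q n.+1).2 = (q n).2 / 2 /\
    (CRe (q n).1 <= CRe (q n.+1).1 /\ CRe (q n.+1).1 <= CRe (q n).1 + (q n).2 / 2 /\
    CIm (q n).1 <= CIm (q n.+1).1 /\ CIm (q n.+1).1 <= CIm (q n).1 + (q n).2 / 2).
  by rewrite /q iterS; exact: nextE.
have qP n : 0 < (q n).2 /\ P (q n).1 (q n).2 by exact: (svalP (iter n next u0)).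
have qs n : (q n).2 = s * (1 / 2) ^+ n.
  elim: n => [|n IH]; first by rewrite expr0 mulr1.
  by rewrite (qS n).1 IH exprSr; field.
have mono n k : CRe (q n).1 <= CRe (q (n + k)%N).1 /\
    CRe (q (n + k)%N).1 + (q (n + k)%N).2 <= CRe (q n).1 + (q n).2 /\
    CIm (q n).1 <= CIm (q (n + k)%N).1 /\
    CIm (q (n + k)%N).1 + (q (n + k)%N).2 <= CIm (q n).1 + (q n).2.
  elim: k => [|k IH]; first by rewrite addn0.
  by rewrite addnS; have := qS (n + k)%N; lra.
have sup_in (f : nat -> R) (w : nat -> R) : (forall n, 0 < w n) ->
    (forall n k, f n <= f (n + k)%N /\ f (n + k)%N + w (n + k)%N <= f n + w n) ->
    exists x, forall n, f n <= x <= f n + w n.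
  move=> w0 fw; exists (sup (range f)) => n.
  have ubn k : f k <= f n + w n.
    have [nk|kn] := leqP n k.
      by have := fw n (k - n)%N; rewrite subnKC//; have := w0 k; lra.
    by have := fw k (n - k)%N; rewrite subnKC 1?ltnW//; have := w0 n; lra.
  apply/andP; split.
    by apply: sup_upper_bound; [split; [exists (f 0%N), 0%N|exists (f n + w n) => _ [k _ <-]]|exists n].
  by apply: sup_le_ub; [exists (f 0%N), 0%N|move=> _ [k _ <-]].
have [|n k|x1 Hx1] := sup_in (fun n => CRe (q n).1) (fun n => (q n).2).
- by move=> n; have [] := qP n.
- by have := mono n k; lra.
have [|n k|x2 Hx2] := sup_in (fun n => CIm (q n).1) (fun n => (q n).2).
- by move=> n; have [] := qP n.
- by have := mono n k; lra.
exists (Cmk x1 x2); first by split; [exact: (Hx1 0%N)|exact: (Hx2 0%N)].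
move=> e e0; have [n Hn] : exists n, forall m, (n <= m)%N -> (1 / 2 : R) ^+ m < e / s.
  by apply: expr_small; rewrite ?divr_gt0//; lra.
exists (q n).1, (q n).2; have [? ?] := qP n; split=> //.
by rewrite qs mulrC -ltr_pdivlMr// Hn.
Qed.

(** If the contour is not small, bisection gives nested squares with the same defect that shrink to
    a point. There [psi] is approximately affine, and contours of affine functions are 0. If that
    point is [z], where only continuity is known, the term [slit] dominates. *)
Theorem goursat psi z a s eps : 0 < s -> 0 < eps ->
  (forall x, square a s x -> x <> z -> cdiff psi x) -> ccont psi z ->
  exists m0, forall m, (m0 <= m)%N -> modulus (contour m psi a s) <= eps.
Proof.
move=> s0 eps0 Hd Hc.
have slit_le : slit z a s <= s * 2.
  by rewrite /slit ler_pM2l//; do 2 case: (_ && _); rewrite ?mulr1n ?mulr0n; lra.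
have D0 : 0 < s ^+ 2 + s * 2 by rewrite addr_gt0// ?exprn_gt0// mulr_gt0.
pose e' := eps / (s ^+ 2 + s * 2); have e'0 : 0 < e' by rewrite divr_gt0.
suff [m0 Hm0] : small_contour psi z e' a s.
  exists m0 => m /Hm0/le_trans; apply.
  by rewrite -mulrA ger_pMr// mulrC ler_pdivrMr// mul1r lerD2l.
apply: contrapT => nP.
have [|x xs Hx] := nested_squares (P := fun a s => ~ small_contour psi z e' a s) s0 _ nP.
  by move=> a1 s1 s10; exact: small_contour_split.
have [e e0 He] : exists2 e, 0 < e & forall a s, 0 < s -> s < e -> square a s x ->
    small_contour psi z e' a s.
  have [->|/eqP xz] := eqVneq x z; first exact: small_contour_cont.
  by apply: small_contour_diff => //; exact: Hd.
have [a' [s' [s'0 s'e xs' nP']]] := Hx e e0.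
exact: nP' (He _ _ s'0 s'e xs').
Qed.

End Goursat.

Section Nodes.
Context {R : realType}.
Local Notation C := (Cx R).
Local Notation "'I" := (Cmk 0 1 : C).
Implicit Types (psi : C -> C) (a h z : C) (s : R).

Lemma contour_ext k psi psi' a s : 0 <= s ->
  (forall z, edges a s z -> psi z = psi' z) -> contour k psi a s = contour k psi' a s.
Proof.
move=> s0 E; apply/eqP; rewrite -subr_eq0 -modulus_eq0 eq_le modulus_ge0 andbT.
rewrite -mulN1r -contourZ -contourD.
apply: le_trans (contour_le _ s0 (d := 0) _) _; last by rewrite mulr0.
by move=> z /E ->; rewrite mulN1r subrr modulus0.
Qed.

Lemma avg_nodes k a h : exists l : seq (C * C),
  (forall psi, avg k psi a h = \sum_(p <- l) p.2 * psi p.1) /\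
  forall p, p \in l -> exists2 t : R, 0 <= t <= 1 & p.1 = a + RtoC t * h.
Proof.
elim: k a h => [|k IH] a h.
  exists [:: (a, 1 / 2); (a + h, 1 / 2)]; split=> [psi|p].
    by rewrite !big_cons big_nil /=; field.
  rewrite !inE => /orP[]/eqP->/=; first by exists 0; rewrite ?rmorph0 ?mul0r ?addr0//; lra.
  by exists 1; rewrite ?rmorph1 ?mul1r//; lra.
have [l1 [H1 P1]] := IH a (h / 2); have [l2 [H2 P2]] := IH (a + h / 2) (h / 2).
exists [seq (p.1, p.2 / 2) | p <- l1 ++ l2]; split=> [psi|p].
  rewrite /= H1 H2 big_map big_cat/= mulrDl !mulr_suml.
  by congr (_ + _); apply: eq_bigr => p _; ring.
move=> /mapP[q ql ->] /=; move: ql; rewrite mem_cat => /orP[/P1|/P2] [t t01 ->].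
  exists (t / 2); first by lra.
  by rewrite rmorphM fmorphV rmorph_nat; ring.
exists ((1 + t) / 2); first by lra.
by rewrite !rmorphM rmorphD rmorph1 fmorphV rmorph_nat; ring.
Qed.

(** As a finite combination of values at fixed nodes, the contour preserves approximability by
    polynomials in parameters. *)
Lemma contour_nodes k a s : 0 <= s -> exists l : seq (C * C),
  (forall psi, contour k psi a s = \sum_(p <- l) p.2 * psi p.1) /\
  forall p, p \in l -> edges a s p.1.
Proof.
move=> s0; have Hp t (t01 : 0 <= t <= 1) := edges_param a s0 t01.
have [l1 [H1 P1]] := avg_nodes k a (RtoC s).
have [l2 [H2 P2]] := avg_nodes k (a + 'I * RtoC s) (RtoC s).
have [l3 [H3 P3]] := avg_nodes k (a + RtoC s) ('I * RtoC s).
have [l4 [H4 P4]] := avg_nodes k a ('I * RtoC s).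
pose m (c : C) (l : seq (C * C)) := [seq (p.1, c * p.2) | p <- l].
exists (m (RtoC s) l1 ++ m (- RtoC s) l2 ++ m ('I * RtoC s) l3 ++ m (- ('I * RtoC s)) l4).
have mE c l psi : \sum_(p <- m c l) p.2 * psi p.1 = c * \sum_(p <- l) p.2 * psi p.1.
  by rewrite big_map mulr_sumr; apply: eq_bigr => p _; rewrite mulrA.
split=> [psi|p].
  by rewrite /contour H1 H2 H3 H4 !big_cat/= !mE; ring.
have mP c l (Q : C -> Prop) : (forall q, q \in l -> Q q.1) -> p \in m c l -> Q p.1.
  by move=> HQ /mapP[q /HQ Qq ->].
rewrite !mem_cat => /or4P[] pm; apply: (mP _ _ (edges a s)) pm => q ql.
- by have [t t01 ->] := P1 q ql; have [] := Hp t t01.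
- by have [t t01 ->] := P2 q ql; have [] := Hp t t01.
- by have [t t01 ->] := P3 q ql; have [] := Hp t t01.
- by have [t t01 ->] := P4 q ql; have [] := Hp t t01.
Qed.

(* the corner of the square of center [c] and side [s] *)
Definition corner (c : C) s : C := c - RtoC (s / 2) - 'I * RtoC (s / 2).

Lemma corner_ReIm c s :
  CRe (corner c s) = CRe c - s / 2 /\ CIm (corner c s) = CIm c - s / 2.
Proof. by case: c => u v; rewrite /corner /CRe /CIm /=; split; ring. Qed.

Lemma edges_corner c s z : 0 <= s -> edges (corner c s) s z ->
  s / 2 <= modulus (z - c) <= s.
Proof.
move=> s0 [[Rz Iz] E].
have [Rc Ic] := corner_ReIm c s.
move: Rz Iz E; rewrite Rc Ic => Rz Iz E.
have [Rzc Izc] : CRe (z - c) = CRe z - CRe c /\ CIm (z - c) = CIm z - CIm c.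
  by case: (z); case: (c).
have lR := CRe_le (z - c); have lI := CIm_le (z - c); have := modulus_le_ReIm (z - c).
rewrite Rzc Izc in lR lI *.
have [hR hI] : `|CRe z - CRe c| <= s / 2 /\ `|CIm z - CIm c| <= s / 2.
  by rewrite !ler_norml; lra.
move=> h; apply/andP; split; last lra.
by case/or4P: E => /eqP E; [move: lR|move: lR|move: lI|move: lI];
  rewrite E ler_norml; lra.
Qed.

Lemma square_corner c s z : 0 <= s -> square (corner c s) s z -> modulus (z - c) <= s.
Proof.
move=> s0 [Rz Iz].
have [Rc Ic] := corner_ReIm c s.
move: Rz Iz; rewrite Rc Ic => Rz Iz.
have [Rzc Izc] : CRe (z - c) = CRe z - CRe c /\ CIm (z - c) = CIm z - CIm c.
  by case: (z); case: (c).
have := modulus_le_ReIm (z - c); rewrite Rzc Izc.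
have [hR hI] : `|CRe z - CRe c| <= s / 2 /\ `|CIm z - CIm c| <= s / 2.
  by rewrite !ler_norml; lra.
lra.
Qed.

Lemma avg_Im_ge k psi a h (b : C) d :
  (forall t : R, 0 <= t <= 1 -> d <= CIm (b * psi (a + RtoC t * h))) ->
  d <= CIm (b * avg k psi a h).
Proof.
move=> H; apply: (@avg_ind R [set u | d <= CIm (b * u)] k psi a h) => //= u v du dv.
have -> : b * ((u + v) / 2) = RtoC (1 / 2) * (b * u + b * v).
  by rewrite rmorphM rmorph1 fmorphV rmorph_nat; field.
have -> x : CIm (RtoC (1 / 2) * x) = CIm x / 2.
  by case: x => x y; rewrite /CIm /= mul0r addr0; field.
by rewrite CIm_D; lra.
Qed.

Lemma modulus_I : modulus 'I = 1.
Proof.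
apply/eqP; rewrite -(eqrXn2 (n := 2))// ?modulus_ge0// modulus_sqr.
by rewrite /CRe /CIm /= expr0n add0r.
Qed.

(* each side contributes at least 1 to the imaginary part, whose limit is 2 pi *)
Lemma contour_inv_ge k c s : 0 < s ->
  4 <= modulus (contour k (fun z => (z - c)^-1) (corner c s) s).
Proof.
move=> s0; apply: le_trans (CIm_le _); apply: le_trans (ler_norm _).
set psi := fun z => _.
have s2 : RtoC (s / 2) != 0 by rewrite -modulus_gt0 modulus_RtoC_ge0; lra.
have sE : RtoC s = RtoC (s / 2) * 2 by rewrite -(rmorph_nat RtoC) -rmorphM divfK.
have ge1 (b : C) (t : R) z : b != 0 -> - 1 <= t <= 1 ->
    z - c = b * RtoC (s / 2) * (1 + 'I * RtoC t) -> 1 <= CIm (b * 'I * RtoC s * psi z).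
  move=> b0 t1 zc; set x := b * _ * _ * _.
  have n0 : 1 + 'I * RtoC t != 0.
    apply/eqP => /(congr1 CRe); rewrite CRe_D CRe_I addr0 => /eqP.
    by rewrite [CRe _]/= oner_eq0.
  (* Hence the imaginary part of x is 2 / (1 + t^2), which is at least 1. *)
  have : x * (1 + 'I * RtoC t) = 'I * 2.
    rewrite /x /psi zc sE; move: s2 n0; move: (RtoC (s / 2)) (RtoC t) 'I => v w i v0 n0.
    by field; rewrite b0 v0 n0.
  case: (x) => X Y /eqP; rewrite eq_complex /= => /andP[/eqP h1 /eqP h2].
  rewrite /CIm /=; rewrite ?(mul0r, mulr0, mul1r, add0r, addr0, subr0, sub0r, oppr0) in h1 h2.
  have {}h1 : X = t * Y by move: h1; rewrite mulr1 => h1; lra.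
  move: h2; rewrite h1 => h2.
  have : Y * (1 + t ^+ 2) = 2 by rewrite expr2; lra.
  have t2 : t ^+ 2 <= 1 by rewrite expr2; nra.
  have := sqr_ge0 t; nra.
have I0 : 'I != 0 by rewrite -modulus_gt0 modulus_I.
have II : 'I * 'I = -1.
  by apply/eqP; rewrite eq_complex /=; apply/andP; split; apply/eqP; ring.
have E1 t : RtoC (2 * t - 1) = RtoC t * 2 - 1 by rewrite rmorphB rmorphM rmorph1 rmorph_nat mulrC.
have E1n t : RtoC (- (2 * t - 1)) = 1 - RtoC t * 2.
  by rewrite (rmorphN RtoC) [X in - X]E1 opprB.
have E2 (v w y : C) : y - 'I * v + 'I * 'I * w = y - 'I * v - w by rewrite II; ring.
have H1 : 1 <= CIm (RtoC s * avg k psi (corner c s) (RtoC s)).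
  apply: avg_Im_ge => t t01; set w := psi _.
  rewrite (_ : RtoC s * w = - 'I * 'I * RtoC s * w); last first.
    by rewrite [- 'I * 'I]mulNr II opprK mul1r.
  apply: (ge1 _ (2 * t - 1)); rewrite ?oppr_eq0//; first lra.
  rewrite E1 /corner sE.
  transitivity (0 - 'I * RtoC (s / 2) + 'I * 'I * (- (RtoC (s / 2) * (RtoC t * 2 - 1)))).
    by rewrite E2; ring.
  by ring.
have H2 : 1 <= CIm ('I * RtoC s * avg k psi (corner c s + RtoC s) ('I * RtoC s)).
  apply: avg_Im_ge => t t01; set w := psi _.
  rewrite (_ : 'I * RtoC s * w = 1 * 'I * RtoC s * w); last by rewrite mul1r.
  apply: (ge1 _ (2 * t - 1)); rewrite ?oner_eq0//; first lra.
  by rewrite E1 /corner sE; ring.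
have H3 : 1 <= CIm (- RtoC s * avg k psi (corner c s + 'I * RtoC s) (RtoC s)).
  apply: avg_Im_ge => t t01; set w := psi _.
  rewrite (_ : - RtoC s * w = 'I * 'I * RtoC s * w); last by rewrite II mulN1r.
  apply: (ge1 _ (- (2 * t - 1))) => //; first lra.
  rewrite E1n /corner sE.
  transitivity (0 - 'I * (- RtoC (s / 2)) + 'I * 'I * (- (RtoC (s / 2) * (RtoC t * 2 - 1)))).
    by rewrite E2; ring.
  by ring.
have H4 : 1 <= CIm (- ('I * RtoC s) * avg k psi (corner c s) ('I * RtoC s)).
  apply: avg_Im_ge => t t01; set w := psi _.
  rewrite (_ : - ('I * RtoC s) * w = -1 * 'I * RtoC s * w); last by ring.
  apply: (ge1 _ (- (2 * t - 1))); rewrite ?oppr_eq0 ?oner_eq0//; first lra.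
  by rewrite E1n /corner sE; ring.
have := lerD (lerD H1 H2) (lerD H3 H4); rewrite -!CIm_D.
set u := (X in CIm X); rewrite (_ : u = contour k psi (corner c s) s); first by lra.
by rewrite /u /contour; ring.
Qed.

End Nodes.

(** * Uniform approximation by polynomials *)

Section Approximation.
Context {R : realType}.
Local Notation C := (Cx R).

Section PolynomialFunctions.
Variable J : finType.
Implicit Types (f g : (J -> C) -> C) (w : J -> C) (U : set (J -> C)).

Inductive polyfun : ((J -> C) -> C) -> Prop :=
| polyfun_cst c : polyfun (fun=> c)
| polyfun_coord j : polyfun (fun w => w j)
| polyfun_add f g : polyfun f -> polyfun g -> polyfun (fun w => f w + g w)
| polyfun_mul f g : polyfun f -> polyfun g -> polyfun (fun w => f w * g w).

Lemma polyfun_exp f n : polyfun f -> polyfun (fun w => f w ^+ n).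
Proof.
move=> pf; elim: n => [|n IH]; first exact: polyfun_cst.
rewrite (_ : (fun w => _) = fun w => f w * f w ^+ n); first exact: polyfun_mul.
by apply/funext => w; rewrite exprS.
Qed.

Lemma polyfun_sum (I : Type) (r : seq I) (F : I -> (J -> C) -> C) :
  (forall i, polyfun (F i)) -> polyfun (fun w => \sum_(i <- r) F i w).
Proof.
move=> pF; elim: r => [|i r IH].
  rewrite (_ : (fun w => _) = fun=> 0); first exact: polyfun_cst.
  by apply/funext => w; rewrite big_nil.
rewrite (_ : (fun w => _) = fun w => F i w + \sum_(i <- r) F i w); first exact: polyfun_add.
by apply/funext => w; rewrite big_cons.
Qed.

Lemma polyfun_prod (I : Type) (r : seq I) (F : I -> (J -> C) -> C) :
  (forall i, polyfun (F i)) -> polyfun (fun w => \prod_(i <- r) F i w).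
Proof.
move=> pF; elim: r => [|i r IH].
  rewrite (_ : (fun w => _) = fun=> 1); first exact: polyfun_cst.
  by apply/funext => w; rewrite big_nil.
rewrite (_ : (fun w => _) = fun w => F i w * \prod_(i <- r) F i w); first exact: polyfun_mul.
by apply/funext => w; rewrite big_cons.
Qed.

Definition poly_approx U f := forall d : R, 0 < d -> exists2 h, polyfun h &
  forall w, U w -> modulus (f w - h w) <= d.

Definition bounded_on U f := exists2 M : R, 0 < M & forall w, U w -> modulus (f w) <= M.

Lemma approx_ext U f g : (forall w, U w -> f w = g w) -> poly_approx U f -> poly_approx U g.
Proof.
by move=> E Hf d /Hf[h ph Hh]; exists h => // w Uw; rewrite -E ?Hh.
Qed.

Lemma approx_sub U V f : U `<=` V -> poly_approx V f -> poly_approx U f.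
Proof. by move=> UV Hf d /Hf[h ph Hh]; exists h => // w /UV/Hh. Qed.

Lemma approx_poly U f : polyfun f -> poly_approx U f.
Proof. by move=> pf d d0; exists f => // w _; rewrite subrr modulus0 ltW. Qed.

Lemma approx_lim U f : (forall d : R, 0 < d -> exists2 g, poly_approx U g &
  forall w, U w -> modulus (f w - g w) <= d) -> poly_approx U f.
Proof.
move=> H d d0; have [|g Ag Hg] := H (d / 2); first lra.
have [|h ph Hh] := Ag (d / 2); first lra.
exists h => // w Uw; rewrite (_ : f w - h w = (f w - g w) + (g w - h w)); last by ring.
by apply: le_trans (modulusD _ _) _; have := Hg w Uw; have := Hh w Uw; lra.
Qed.

Lemma approxD U f g : poly_approx U f -> poly_approx U g -> poly_approx U (fun w => f w + g w).
Proof.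
move=> Hf Hg d d0; have [|h ph Hh] := Hf (d / 2); first lra.
have [|k pk Hk] := Hg (d / 2); first lra.
exists (fun w => h w + k w); first exact: polyfun_add.
move=> w Uw; rewrite (_ : _ - _ = (f w - h w) + (g w - k w)); last by ring.
by apply: le_trans (modulusD _ _) _; have := Hh w Uw; have := Hk w Uw; lra.
Qed.

Lemma approxM U f g : bounded_on U f -> bounded_on U g ->
  poly_approx U f -> poly_approx U g -> poly_approx U (fun w => f w * g w).
Proof.
move=> [M M0 fM] [N N0 gN] Hf Hg d d0.
have [|h ph Hh] := Hf (Num.min 1 (d / (2 * N))).
  by rewrite lt_min ltr01 divr_gt0// mulr_gt0.
have [|k pk Hk] := Hg (d / (2 * (M + 1))).
  by rewrite divr_gt0// mulr_gt0//; lra.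
exists (fun w => h w * k w); first exact: polyfun_mul.
move=> w Uw; rewrite (_ : _ - _ = (f w - h w) * g w + h w * (g w - k w)); last by ring.
have := Hh w Uw; rewrite le_min => /andP[h1 h2]; have h3 := Hk w Uw.
apply: le_trans (modulusD _ _) _; rewrite !modulusM.
have h4 : modulus (h w) <= M + 1.
  have := modulus_lb (h w) (f w); rewrite modulusBC; have := fM w Uw; lra.
apply: (@le_trans _ _ (d / (2 * N) * N + (M + 1) * (d / (2 * (M + 1))))).
  by apply: lerD; apply: ler_pM; rewrite ?modulus_ge0// gN.
have M1 : M + 1 != 0 by apply: lt0r_neq0; lra.
by rewrite le_eqVlt; apply/orP; left; apply/eqP; field; rewrite M1 gt_eqF.
Qed.

Lemma bounded_onD U f g : bounded_on U f -> bounded_on U g ->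
  bounded_on U (fun w => f w + g w).
Proof.
move=> [M M0 fM] [N N0 gN]; exists (M + N); first exact: addr_gt0.
by move=> w Uw; apply: le_trans (modulusD _ _) _; rewrite lerD ?fM ?gN.
Qed.

Lemma bounded_onM U f g : bounded_on U f -> bounded_on U g ->
  bounded_on U (fun w => f w * g w).
Proof.
move=> [M M0 fM] [N N0 gN]; exists (M * N); first exact: mulr_gt0.
by move=> w Uw; rewrite modulusM ler_pM ?modulus_ge0 ?fM ?gN.
Qed.

Lemma bounded_on_cst U c : bounded_on U (fun=> c).
Proof.
by exists (modulus c + 1) => [|w _]; have := modulus_ge0 c; lra.
Qed.

Definition bounded_coords U := forall j, bounded_on U (fun w => w j).

Lemma bounded_poly U f : bounded_coords U -> polyfun f -> bounded_on U f.
Proof.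
move=> BU; elim=> {f} [c|j|f g _ Hf _ Hg|f g _ Hf _ Hg] //.
- exact: bounded_on_cst.
- exact: bounded_onD.
- exact: bounded_onM.
Qed.

Lemma bounded_approx U f : bounded_coords U -> poly_approx U f -> bounded_on U f.
Proof.
move=> BU /(_ 1 ltr01)[h ph Hh]; have [M M0 HM] := bounded_poly BU ph.
exists (M + 1); first lra.
move=> w Uw; rewrite (_ : f w = (f w - h w) + h w); last by ring.
by apply: le_trans (modulusD _ _) _; have := Hh w Uw; have := HM w Uw; lra.
Qed.

Lemma approx_sum U (I : Type) (r : seq I) (F : I -> (J -> C) -> C) :
  (forall i, poly_approx U (F i)) -> poly_approx U (fun w => \sum_(i <- r) F i w).
Proof.
move=> pF; elim: r => [|i r IH].
  by apply: approx_ext (approx_poly _ (polyfun_cst 0)) => w _; rewrite big_nil.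
by apply: approx_ext (approxD (pF i) IH) => w _; rewrite big_cons.
Qed.

Lemma approx_expr U f n : bounded_coords U -> poly_approx U f -> poly_approx U (fun w => f w ^+ n).
Proof.
move=> BU Hf; elim: n => [|n IH]; first exact: approx_poly (polyfun_cst 1).
apply: (@approx_ext _ (fun w => f w * f w ^+ n)) => [w _|]; first by rewrite exprS.
by apply: approxM => //; exact: bounded_approx.
Qed.

(** Partial sums of the Neumann series. *)
Lemma approx_inv_near1 U f q : bounded_coords U -> q < 1 ->
  (forall w, U w -> modulus (1 - f w) <= q) -> poly_approx U f -> poly_approx U (fun w => (f w)^-1).
Proof.
move=> BU q1 Hq Hf.
have [[w0 U0]|U0] := pselect (exists w, U w); last first.
  by move=> d d0; exists (fun=> 0); [exact: polyfun_cst|move=> w Uw; exfalso; apply: U0; exists w].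
have q0 : 0 <= q := le_trans (modulus_ge0 _) (Hq _ U0).
apply: approx_lim => d d0.
have [n Hn] : exists n, forall m, (n <= m)%N -> q ^+ m < d * (1 - q).
  by apply: expr_small => //; rewrite mulr_gt0//; lra.
exists (fun w => \sum_(i < n) (1 - f w) ^+ i).
  apply: approx_sum => i; apply: approx_expr => //.
  apply: (@approx_ext _ (fun w => 1 + (-1) * f w)) => [w _|]; first by rewrite mulN1r.
  apply: approxD; first exact: approx_poly (polyfun_cst 1).
  apply: approxM => //; first exact: bounded_on_cst.
    exact: bounded_approx.
  exact: approx_poly (polyfun_cst (-1)).
move=> w Uw; have fq : 1 - q <= modulus (f w).
  by have := modulus_lb 1 (1 - f w); rewrite modulus1 opprB addrCA subrr addr0; have := Hq w Uw; lra.
have f0 : f w != 0 by rewrite -modulus_gt0; lra.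
have -> : (f w)^-1 - \sum_(i < n) (1 - f w) ^+ i = (1 - f w) ^+ n / f w.
  apply: (mulfI f0); rewrite mulrBr mulfV// mulrCA mulfV// mulr1.
  have := subrX1 (1 - f w) n; rewrite (_ : 1 - f w - 1 = - f w); last by ring.
  by move=> /eqP; rewrite subr_eq => /eqP ->; rewrite mulNr addrC.
rewrite modulusM modulusV modulusX ler_pdivrMr ?modulus_gt0//.
apply: (@le_trans _ _ (q ^+ n)).
  by rewrite lerXn2r ?nnegrE ?modulus_ge0// Hq.
apply: le_trans (ltW (Hn n (leqnn n))) _.
by rewrite ler_pM2l.
Qed.

Lemma approx_inv U f c q : bounded_coords U -> c != 0 -> q < modulus c ->
  (forall w, U w -> modulus (c - f w) <= q) -> poly_approx U f -> poly_approx U (fun w => (f w)^-1).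
Proof.
move=> BU c0 qc Hq Hf; have cp : 0 < modulus c by rewrite modulus_gt0.
have cf : poly_approx U (fun w => c^-1 * f w).
  apply: approxM => //; first exact: bounded_on_cst.
    exact: bounded_approx.
  exact: approx_poly (polyfun_cst _).
have H : poly_approx U (fun w => (c^-1 * f w)^-1).
  apply: (approx_inv_near1 (q := q / modulus c)) => //.
    by rewrite ltr_pdivrMr// mul1r.
  move=> w Uw; rewrite (_ : 1 - c^-1 * f w = (c - f w) / c); last by field.
  by rewrite modulusM modulusV ler_pM2r ?invr_gt0// Hq.
apply: (@approx_ext _ (fun w => c^-1 * (c^-1 * f w)^-1)) => [w _|].
  by rewrite invfM invrK mulrA mulVf// mul1r.
apply: approxM => //; first exact: bounded_on_cst.
  exact: bounded_approx.
exact: approx_poly (polyfun_cst _).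
Qed.

End PolynomialFunctions.

Lemma polyfun_comp (J J' : finType) (h : (J' -> C) -> C) (f : J' -> (J -> C) -> C) :
  polyfun h -> (forall j, polyfun (f j)) -> polyfun (fun w => h (fun j => f j w)).
Proof.
move=> ph pf; elim: ph => {h} [c|j|f1 g1 _ Hf _ Hg|f1 g1 _ Hf _ Hg] //.
- exact: polyfun_cst.
- exact: polyfun_add Hf Hg.
- exact: polyfun_mul Hf Hg.
Qed.

Lemma approx_polyfun_comp (J J' : finType) (U : set (J -> C)) (h : (J' -> C) -> C)
    (f : J' -> (J -> C) -> C) : bounded_coords U ->
  polyfun h -> (forall j, poly_approx U (f j)) -> poly_approx U (fun w => h (fun j => f j w)).
Proof.
move=> BU ph pf; elim: ph => {h} [c|j|f1 g1 _ Hf _ Hg|f1 g1 _ Hf _ Hg] //.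
- by apply: (@approx_poly J U (fun=> c)); exact: polyfun_cst.
- exact: approxD Hf Hg.
- by apply: approxM => //; exact: bounded_approx.
Qed.

Lemma approx_comp (J J' : finType) (U : set (J -> C)) (V : set (J' -> C))
    (g : (J' -> C) -> C) (f : J' -> (J -> C) -> C) : bounded_coords U ->
  (forall w, U w -> V (fun j => f j w)) -> poly_approx V g -> (forall j, poly_approx U (f j)) ->
  poly_approx U (fun w => g (fun j => f j w)).
Proof.
move=> BU UV Hg Hf; apply: approx_lim => d /Hg[h ph Hh].
exists (fun w => h (fun j => f j w)); first exact: approx_polyfun_comp.
by move=> w /UV/Hh.
Qed.

End Approximation.

Section ComplexDerivative.
Context {R : realType}.
Local Notation C := (Cx R).
Implicit Types (f g : C -> C) (z c : C).

Lemma cdiff_lip f z : cdiff f z -> exists2 b, 0 < b & exists2 e, 0 < e &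
  forall z', modulus (z' - z) < e -> modulus (f z' - f z) <= b * modulus (z' - z).
Proof.
move=> [b Hb]; have [e e0 He] := Hb 1 ltr01.
exists (modulus b + 1); first by have := modulus_ge0 b; lra.
exists e => // z' /He H.
rewrite (_ : f z' - f z = (f z' - f z - b * (z' - z)) + b * (z' - z)); last by ring.
by apply: le_trans (modulusD _ _) _; rewrite modulusM; lra.
Qed.

Lemma cdiff_ccont f z : cdiff f z -> ccont f z.
Proof.
move=> /cdiff_lip[b b0 [e e0 He]] d d0; exists (Num.min e (d / b)).
  by rewrite lt_min e0 divr_gt0.
move=> z'; rewrite lt_min => /andP[/He H zd]; apply: le_trans H _.
by rewrite mulrC -ler_pdivlMr// ltW.
Qed.

Lemma cdiff_cst c z : cdiff (fun=> c) z.
Proof.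
exists 0 => d d0; exists 1 => // z' _.
by rewrite subrr mul0r subr0 modulus0 mulr_ge0 ?modulus_ge0// ltW.
Qed.

Lemma cdiffD f g z : cdiff f z -> cdiff g z -> cdiff (fun t => f t + g t) z.
Proof.
move=> [b Hb] [c Hc]; exists (b + c) => d d0.
have [|e e0 He] := Hb (d / 2); first lra.
have [|e' e'0 He'] := Hc (d / 2); first lra.
exists (Num.min e e'); first by rewrite lt_min e0.
move=> z'; rewrite lt_min => /andP[/He h1 /He' h2].
rewrite (_ : _ - _ = (f z' - f z - b * (z' - z)) + (g z' - g z - c * (z' - z))); last by ring.
by apply: le_trans (modulusD _ _) _; lra.
Qed.

Lemma cdiffM f g z : cdiff f z -> cdiff g z -> cdiff (fun t => f t * g t) z.
Proof.
move=> Hf Hg; have [bf bf0 [ef ef0 Lf]] := cdiff_lip Hf.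
have [bg bg0 [eg eg0 Lg]] := cdiff_lip Hg.
have [b Hb] := Hf; have [c Hc] := Hg; exists (b * g z + f z * c) => d d0.
pose Q := modulus (g z) + modulus (f z) + 1.
have Q0 : 0 < Q by rewrite /Q; have := modulus_ge0 (g z); have := modulus_ge0 (f z); lra.
have d' : 0 < d / (2 * Q) by rewrite divr_gt0// mulr_gt0.
have [e1 e10 He1] := Hb _ d'; have [e2 e20 He2] := Hc _ d'.
have e3 : 0 < d / (2 * (bf * bg)) by rewrite divr_gt0// mulr_gt0// mulr_gt0.
exists (Num.min (Num.min ef eg) (Num.min (Num.min e1 e2) (d / (2 * (bf * bg))))).
  by rewrite !lt_min ef0 eg0 e10 e20 e3.
move=> z'; rewrite !lt_min => /andP[/andP[/Lf lf /Lg lg]] /andP[/andP[/He1 h1 /He2 h2] h3].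
rewrite (_ : _ - _ - _ = (f z' - f z - b * (z' - z)) * g z +
    f z * (g z' - g z - c * (z' - z)) + (f z' - f z) * (g z' - g z)); last by ring.
apply: le_trans (modulusD _ _) _.
apply: (@le_trans _ _ (d / (2 * Q) * (modulus (g z) + modulus (f z)) * modulus (z' - z) +
    (bf * bg * modulus (z' - z)) * modulus (z' - z))).
  apply: lerD.
    apply: le_trans (modulusD _ _) _; rewrite !modulusM.
    rewrite [leRHS](_ : _ = d / (2 * Q) * modulus (z' - z) * modulus (g z) +
      modulus (f z) * (d / (2 * Q) * modulus (z' - z))); last by ring.
    by apply: lerD; [apply: ler_wpM2r|apply: ler_wpM2l]; rewrite ?modulus_ge0.
  rewrite modulusM; apply: le_trans (ler_pM (modulus_ge0 _) (modulus_ge0 _) lf lg) _.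
  by rewrite le_eqVlt; apply/orP; left; apply/eqP; ring.
rewrite -mulrDl ler_wpM2r ?modulus_ge0//.
rewrite [leRHS](_ : d = d / (2 * Q) * Q + d / 2); last by field; rewrite gt_eqF.
apply: lerD; first by apply: ler_wpM2l; [exact: ltW|rewrite /Q; lra].
have := ltW h3; rewrite ler_pdivlMr ?mulr_gt0//; lra.
Qed.

Lemma cdiff_inv c z : z != c -> cdiff (fun t => (t - c)^-1) z.
Proof.
rewrite -subr_eq0 => u0; exists (- ((z - c) ^+ 2)^-1) => d d0.
have up : 0 < modulus (z - c) by rewrite modulus_gt0.
have u3 : 0 < modulus (z - c) ^+ 3 by rewrite exprn_gt0.
exists (Num.min (modulus (z - c) / 2) (d * modulus (z - c) ^+ 3 / 2)).
  by rewrite lt_min !divr_gt0 ?mulr_gt0.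
move=> z'; rewrite lt_min => /andP[h1 h2].
have v0 : modulus (z - c) / 2 <= modulus (z' - c).
  have := modulus_lbD (z - c) (z' - z); rewrite (_ : z - c + (z' - z) = z' - c); last by ring.
  lra.
have v1 : z' - c != 0 by rewrite -modulus_gt0; lra.
rewrite (_ : _ - _ - _ = (z' - z) ^+ 2 / ((z - c) ^+ 2 * (z' - c))); last first.
  by field; rewrite u0 v1.
rewrite modulusM modulusV modulusM !modulusX expr2 -mulrA mulrC ler_wpM2r ?modulus_ge0//.
rewrite ler_pdivrMr; last by rewrite mulr_gt0 ?exprn_gt0 ?modulus_gt0.
apply: le_trans (ltW h2) _; rewrite -mulrA ler_pM2l//.
rewrite exprSr -mulrA ler_pM2l ?exprn_gt0//.
Qed.

Lemma cdiff_near f g z e : 0 < e -> (forall z', modulus (z' - z) < e -> f z' = g z') ->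
  cdiff f z -> cdiff g z.
Proof.
move=> e0 E [b Hb]; have Ez : f z = g z by apply: E; rewrite subrr modulus0.
exists b => d /Hb[e' e'0 He'].
exists (Num.min e e'); first by rewrite lt_min e0.
move=> z'; rewrite lt_min => /andP[/E <- /He'].
by rewrite Ez.
Qed.

Lemma div_cont (A0 a0 : C) (d : R) : a0 != 0 -> 0 < d -> exists2 e : R, 0 < e &
  forall A a, modulus (A - A0) <= e -> modulus (a - a0) <= e ->
    modulus (A / a - A0 / a0) <= d.
Proof.
move=> a00 d0; have ap : 0 < modulus a0 by rewrite modulus_gt0.
have A0p := modulus_ge0 A0.
pose Q := 2 * (modulus a0 + modulus A0).
have Q0 : 0 < Q by rewrite /Q; lra.
exists (Num.min (modulus a0 / 2) (d * modulus a0 ^+ 2 / Q)).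
  by rewrite lt_min !divr_gt0// mulr_gt0// exprn_gt0.
move=> A a; rewrite !le_min => /andP[_ h1] /andP[h2 h3].
have v0 : modulus a0 / 2 <= modulus a.
  have := modulus_lb a0 (a0 - a); rewrite (_ : a0 - (a0 - a) = a); last by ring.
  by rewrite [modulus (a0 - a)]modulusBC; lra.
have v1 : a != 0 by rewrite -modulus_gt0; lra.
rewrite (_ : _ - _ = ((A - A0) * a0 - A0 * (a - a0)) / (a * a0)); last by field; rewrite v1 a00.
rewrite modulusM modulusV modulusM ler_pdivrMr; last by rewrite mulr_gt0 ?modulus_gt0.
apply: le_trans (modulusB _ _) _; rewrite !modulusM.
apply: (@le_trans _ _ (d * modulus a0 ^+ 2 / Q * (Q / 2))).
  have := ler_wpM2r (ltW ap) h1; have := ler_wpM2l A0p h3.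
  rewrite (_ : Q / 2 = modulus a0 + modulus A0); last by rewrite /Q; field.
  by move: (d * _ / Q) => u; lra.
rewrite mulrA divfK ?gt_eqF// -mulrA ler_pM2l// expr2 -mulrA mulrC.
by rewrite ler_pM2r.
Qed.

End ComplexDerivative.

(** * Cauchy's formula in several variables *)

Section Cauchy.
Context {R : realType}.
Local Notation C := (Cx R).
Variable J : finType.
Implicit Types (f g : (J -> C) -> C) (w : J -> C) (j : J) (t : C).

Definition upd w j t : J -> C := fun i => if i == j then t else w i.

Definition cbox w0 (r : R) : set (J -> C) := [set w | forall j, modulus (w j - w0 j) <= r].

(** Continuity and separate differentiability suit an argument that treats one variable at a
    time. *)
Record good w0 (e : R) f : Prop := Good {
  good_cont : forall w, (forall j, modulus (w j - w0 j) < e) ->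
    forall d, 0 < d -> exists2 n, 0 < n &
      forall w', (forall j, modulus (w' j - w j) < n) -> modulus (f w' - f w) <= d;
  good_diff : forall w j, (forall j, modulus (w j - w0 j) < e) ->
    cdiff (fun t => f (upd w j t)) (w j)
}.

Lemma updK w j : upd w j (w j) = w.
Proof. by apply/funext => i; rewrite /upd; case: eqP => [->|]. Qed.

Lemma updU w j t t' : upd (upd w j t) j t' = upd w j t'.
Proof. by apply/funext => i; rewrite /upd; case: eqP. Qed.

Lemma updC w j k t t' : j != k -> upd (upd w j t) k t' = upd (upd w k t') j t.
Proof.
move=> jk; apply/funext => i; rewrite /upd; case: eqP => [->|_]; last by case: eqP.
by rewrite eq_sym (negbTE jk).
Qed.

Lemma upd_box w0 (e : R) w j t : (forall i, modulus (w i - w0 i) < e) ->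
  modulus (t - w0 j) < e -> forall i, modulus (upd w j t i - w0 i) < e.
Proof. by move=> we te i; rewrite /upd; case: eqP => [->|]. Qed.

Lemma upd_near w w' j t (e : R) : 0 < e -> (forall i, modulus (w' i - w i) < e) ->
  forall i, modulus (upd w' j t i - upd w j t i) < e.
Proof. by move=> e0 ww i; rewrite /upd; case: eqP => // _; rewrite subrr modulus0. Qed.

Lemma good_upd w0 e f j t : modulus (t - w0 j) < e -> good w0 e f ->
  good w0 e (fun w => f (upd w j t)).
Proof.
move=> te [Hc Hd]; split=> [w we d d0|w k we].
  have [n n0 Hn] := Hc _ (upd_box we te) d d0; exists n => // w' ww.
  by apply: Hn; exact: upd_near.
have [->|jk] := eqVneq j k.
  rewrite (_ : (fun _ => _) = fun=> f (upd w k t)); first exact: cdiff_cst.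
  by apply/funext => u; rewrite updU.
have := Hd _ k (upd_box we te).
rewrite (_ : upd w j t k = w k); last by rewrite /upd eq_sym (negbTE jk).
by congr cdiff; apply/funext => u; rewrite updC.
Qed.

Lemma bounded_cbox w0 (q : R) : bounded_coords (cbox w0 q).
Proof.
move=> i; exists (`|q| + modulus (w0 i) + 1).
  by have := modulus_ge0 (w0 i); have := normr_ge0 q; lra.
move=> w /(_ i) wq; rewrite (_ : w i = (w i - w0 i) + w0 i); last by ring.
apply: le_trans (modulusD _ _) _; have := ler_norm q; lra.
Qed.

Section Step.
Variables (w0 : J -> C) (e : R) (f : (J -> C) -> C) (j : J).
Hypotheses (e0 : 0 < e) (gf : good w0 e f).
Variables s r : R.
Hypotheses (sE : s = e / 2) (rE : r = e / 64).
Local Notation a := (corner (w0 j) s).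
Local Notation kern := (fun w z => (f (upd w j z) - f w) / (z - w j)).

(* [lra] does not see section variables *)
Let sizes : [/\ 0 < e, s = e / 2, r = e / 64 & 0 < s].
Proof. by split=> //; rewrite sE divr_gt0. Qed.
Let s0 : 0 < s. Proof. by have [] := sizes. Qed.
Let cbox_lt w : cbox w0 r w -> forall i, modulus (w i - w0 i) < e.
Proof. by have [? ? ? ?] := sizes; move=> H i; apply: le_lt_trans (H i) _; lra. Qed.

Let far w z : cbox w0 r w -> s / 2 <= modulus (z - w0 j) -> z - w j != 0.
Proof.
have [? ? ? ?] := sizes.
move=> /(_ j) H zs; rewrite -modulus_gt0.
have := modulus_lb (z - w0 j) (w j - w0 j).
rewrite (_ : z - w0 j - (w j - w0 j) = z - w j); last by ring.
lra.
Qed.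

(** The difference quotient extends continuously to z = w j, the exceptional point that [goursat]
    allows and which lies off the edges. *)
Lemma kern_contour w d : cbox w0 r w -> 0 < d -> exists m0, forall m, (m0 <= m)%N ->
  modulus (contour m (kern w) a s) <= d.
Proof.
have [? ? ? ?] := sizes.
move=> wr d0; have we := cbox_lt wr; have [b Hb] := good_diff gf j we.
pose psi z := if z == w j then b else kern w z.
have psiE m : contour m (kern w) a s = contour m psi a s.
  apply: contour_ext; first exact: ltW.
  move=> z /(edges_corner (ltW s0))/andP[zs _]; rewrite /psi ifF//.
  by rewrite -subr_eq0; apply/negbTE; exact: far zs.
have [||m0 Hm0] := @goursat R psi (w j) a s d s0 d0.
- move=> z /(square_corner (ltW s0)) zs /eqP zw.
  have ze : modulus (z - w0 j) < e by apply: le_lt_trans zs _; lra.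
  apply: (@cdiff_near _ (fun t => (f (upd w j t) + - f w) * (t - w j)^-1) psi z (modulus (z - w j))).
  + by rewrite modulus_gt0 subr_eq0.
  + move=> z'; rewrite /psi; case: eqP => // ->.
    by rewrite modulusBC ltxx.
  + apply: cdiffM; last exact: cdiff_inv.
    apply: cdiffD; last exact: cdiff_cst.
    have := good_diff gf j (upd_box we ze).
    rewrite (_ : upd w j z j = z); last by rewrite /upd eqxx.
    by congr cdiff; apply/funext => u; rewrite updU.
- move=> d' d'0; have [n n0 Hn] := Hb d' d'0; exists n => // z'.
  rewrite {2}/psi eqxx /psi; case: eqP => [_ _|/eqP zw /Hn].
    by rewrite subrr modulus0 ltW.
  have zw' : z' - w j != 0 by rewrite subr_eq0.
  rewrite updK (_ : _ / _ - b = (f (upd w j z') - f w - b * (z' - w j)) / (z' - w j)).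
    by rewrite modulusM modulusV ler_pdivrMr ?modulus_gt0.
  by field.
- by exists m0 => m; rewrite psiE; exact: Hm0.
Qed.

Lemma kern_cont w1 z0 d : cbox w0 r w1 -> s / 2 <= modulus (z0 - w0 j) ->
  modulus (z0 - w0 j) <= s -> 0 < d ->
  exists2 n, 0 < n & forall w z, (forall i, modulus (w i - w1 i) < n) ->
    modulus (z - z0) < n -> modulus (kern w z - kern w1 z0) <= d.
Proof.
have [? ? ? ?] := sizes.
move=> w1r zs zs' d0; have z0e : modulus (z0 - w0 j) < e.
  by apply: le_lt_trans zs' _; lra.
have [n1 n10 H1] := div_cont (f (upd w1 j z0) - f w1) (far w1r zs) d0.
have [|n2 n20 H2] := good_cont gf (upd_box (cbox_lt w1r) z0e) (d := n1 / 2); first lra.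
have [|n3 n30 H3] := good_cont gf (cbox_lt w1r) (d := n1 / 2); first lra.
exists (Num.min (n1 / 2) (Num.min n2 n3)); first by rewrite !lt_min n20 n30; lra.
move=> w z ww1; rewrite !lt_min => /and3P[zz1 zz2 _].
have ww i : [/\ modulus (w i - w1 i) < n1 / 2, modulus (w i - w1 i) < n2 &
    modulus (w i - w1 i) < n3] by have := ww1 i; rewrite !lt_min => /and3P[].
apply: H1.
  rewrite (_ : _ - _ = (f (upd w j z) - f (upd w1 j z0)) - (f w - f w1)); last by ring.
  apply: le_trans (modulusB _ _) _.
  have h1 : modulus (f (upd w j z) - f (upd w1 j z0)) <= n1 / 2.
    by apply: H2 => i; rewrite /upd; case: eqP => // _; have [] := ww i.
  have h2 : modulus (f w - f w1) <= n1 / 2 by apply: H3 => i; have [] := ww i.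
  lra.
rewrite (_ : _ - _ = (z - z0) - (w j - w1 j)); last by ring.
by apply: le_trans (modulusB _ _) _; have [] := ww j; lra.
Qed.

Lemma kern_cont_edges w1 d : cbox w0 r w1 -> 0 < d ->
  exists2 n, 0 < n & forall w, (forall i, modulus (w i - w1 i) < n) ->
    forall z, edges a s z -> modulus (kern w z - kern w1 z) <= d.
Proof.
have [? ? ? ?] := sizes.
move=> w1r d0; pose P (V : set C) := exists2 n, 0 < n & forall w,
  (forall i, modulus (w i - w1 i) < n) ->
  forall z, V (z - w0 j) -> modulus (kern w z - kern w1 z) <= d.
suff : P [set q | s / 2 <= modulus q <= s].
  by move=> [n n0 Hn]; exists n => // w /Hn H z /(edges_corner (ltW s0)); exact: H.
apply: annulus_ind.
- by move=> U V UV [n n0 Hn]; exists n => // w /Hn H z /UV; exact: H.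
- move=> U V [n n0 Hn] [n' n'0 Hn']; exists (Num.min n n'); first by rewrite lt_min n0.
  move=> w ww z [Uz|Vz]; [apply: Hn|apply: Hn'] => // i; have := ww i;
    by rewrite lt_min => /andP[].
- by exists 1.
- move=> q q1 q2; have [|||n n0 Hn] := @kern_cont w1 (q + w0 j) (d / 2) w1r; rewrite ?addrK//.
    lra.
  exists n => //; exists n => // w ww z /= zq.
  have zq' : modulus (z - (q + w0 j)) < n.
    by rewrite (_ : z - _ = z - w0 j - q)//; ring.
  have w11 i : modulus (w1 i - w1 i) < n by rewrite subrr modulus0.
  rewrite (_ : _ - _ = (kern w z - kern w1 (q + w0 j)) - (kern w1 z - kern w1 (q + w0 j))); last by ring.
  apply: le_trans (modulusB _ _) _.
  by have := Hn w z ww zq'; have := Hn w1 z w11 zq'; lra.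
Qed.

(** Kernels of nearby [w] are close on the edges, so compactness gives one order for all [w]. *)
Lemma kern_contour_unif d : 0 < d -> exists m, forall w, cbox w0 r w ->
  modulus (contour m (kern w) a s) <= d.
Proof.
have [? ? ? ?] := sizes.
move=> d0; pose P (U : set (J -> C)) := exists m0, forall m, (m0 <= m)%N ->
  forall w, U w -> cbox w0 r w -> modulus (contour m (kern w) a s) <= d.
suff : P [set w | forall j, modulus (w j) <= r + \sum_i modulus (w0 i)].
  move=> [m Hm]; exists m => w wr; apply: (Hm m) => // i /=.
  rewrite (_ : w i = (w i - w0 i) + w0 i); last by ring.
  apply: le_trans (modulusD _ _) (lerD (wr i) _).
  by rewrite (bigD1 i)//= lerDl sumr_ge0// => k _; exact: modulus_ge0.
apply: box_ind.
- by move=> U V UV [m0 Hm0]; exists m0 => m /Hm0 H w /UV; exact: H.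
- move=> U V [m1 H1] [m2 H2]; exists (maxn m1 m2) => m.
  by rewrite geq_max => /andP[m1m m2m] w [Uw|Vw]; [exact: H1|exact: H2].
- move=> w1; have [w1r|] := pselect (cbox w0 r w1); last first.
    move=> /existsNP[i /negP]; rewrite -ltNge => wi.
    exists (modulus (w1 i - w0 i) - r); first lra.
    exists 0%N => m _ w /(_ i) /= ww /(_ i) wr.
    have := modulus_lb (w1 i - w0 i) (w i - w0 i).
    rewrite (_ : w1 i - w0 i - (w i - w0 i) = - (w i - w1 i)); last by ring.
    by rewrite modulusN; lra.
  have d8 : 0 < d / 2 by lra.
  have d9 : 0 < d / (8 * s) by rewrite divr_gt0// mulr_gt0.
  have [m0 Hm0] := kern_contour w1r d8.
  have [n n0 Hn] := kern_cont_edges w1r d9.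
  exists n => //; exists m0 => m mm w ww wr.
  have -> : contour m (kern w) a s =
      contour m (fun z => kern w1 z + (kern w z - kern w1 z)) a s.
    by congr contour; apply/funext => z; ring.
  rewrite contourD; apply: le_trans (modulusD _ _) _.
  have h1 := Hm0 m mm.
  have h2 := contour_le m (ltW s0) (Hn w ww).
  rewrite (_ : 4 * s * (d / (8 * s)) = d / 2) in h2; last by field; rewrite gt_eqF.
  lra.
Qed.

Lemma winding_near m z : modulus (z - w0 j) <= r ->
  modulus (contour m (fun u => (u - w0 j)^-1) a s - contour m (fun u => (u - z)^-1) a s) <= 1.
Proof.
have [? ? ? ?] := sizes.
move=> zr; rewrite -[- contour _ _ _ _]mulN1r -contourZ -contourD.
have -> : 1 = 4 * s * (1 / (4 * s)) by field; rewrite gt_eqF.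
apply: contour_le; first exact: ltW.
move=> u /(edges_corner (ltW s0))/andP[us _].
have uz : s / 4 <= modulus (u - z).
  have := modulus_lb (u - w0 j) (z - w0 j).
  rewrite (_ : u - w0 j - (z - w0 j) = u - z); last by ring.
  by lra.
have u0 : u - w0 j != 0 by rewrite -modulus_gt0; lra.
have u1 : u - z != 0 by rewrite -modulus_gt0; lra.
rewrite (_ : _ + _ = (w0 j - z) / ((u - w0 j) * (u - z))); last by field; rewrite u0 u1.
rewrite modulusM modulusV modulusM modulusBC ler_pdivrMr ?mulr_gt0 ?modulus_gt0//.
apply: le_trans zr _.
apply: (@le_trans _ _ (1 / (4 * s) * (s / 2 * (s / 4)))); last first.
  apply: ler_wpM2l; first by rewrite divr_ge0// mulr_ge0// ltW.
  by apply: ler_pM => //; lra.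
rewrite (_ : 1 / (4 * s) * _ = s / 32); last by field; rewrite gt_eqF.
by lra.
Qed.

(** Up to [d], f(w) is W(w j)^-1 times the sum over the nodes of p.2 f(upd w j p.1) / (p.1 - w j),
    where the j-th argument of [f] is frozen. The discrete winding sum [W] stands for 2 pi i; it is
    at least 4 in modulus at the centre and varies by at most 1, so it can be inverted. *)
Lemma cauchy_step : (forall t, modulus (t - w0 j) < e ->
    poly_approx (cbox w0 r) (fun w => f (upd w j t))) -> poly_approx (cbox w0 r) f.
Proof.
have [? ? ? ?] := sizes.
move=> Hf; apply: approx_lim => d d0.
have [m Hm] := kern_contour_unif d0.
have [l [lE ledge]] := contour_nodes m a (ltW s0).
pose W z := contour m (fun u => (u - z)^-1) a s.
have BU := bounded_cbox w0 r.
have W4 := contour_inv_ge m (w0 j) s0; rewrite -/(W (w0 j)) in W4.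
have ainv p : p \in l -> poly_approx (cbox w0 r) (fun w => (p.1 - w j)^-1).
  move=> /ledge/(edges_corner (ltW s0))/andP[ps _].
  apply: (approx_inv (c := p.1 - w0 j) (q := r)) => //.
  - by rewrite -modulus_gt0; move: ps; lra.
  - by move: ps; lra.
  - by move=> w /(_ j); rewrite (_ : p.1 - w0 j - (p.1 - w j) = w j - w0 j)//; ring.
  - apply: (@approx_ext _ _ _ (fun w => p.1 + (-1) * w j)) => [w _|]; first by rewrite mulN1r.
    apply: approx_poly; apply: polyfun_add; first exact: polyfun_cst.
    by apply: polyfun_mul; [exact: polyfun_cst|exact: polyfun_coord].
have asum (F : C * C -> (J -> C) -> C) : (forall p, p \in l -> poly_approx (cbox w0 r) (F p)) ->
    poly_approx (cbox w0 r) (fun w => \sum_(p <- l) F p w).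
  move=> HF; apply: (@approx_ext _ _ _ (fun w => \sum_(p <- l) if p \in l then F p w else 0)).
    by move=> w _; rewrite -big_mkcond/= -big_seq.
  apply: approx_sum => p; case pl: (p \in l); first exact: HF.
  by apply: approx_poly; exact: polyfun_cst.
have aW : poly_approx (cbox w0 r) (fun w => (W (w j))^-1).
  apply: (approx_inv (c := W (w0 j)) (q := 1)) => //.
  - by rewrite -modulus_gt0; lra.
  - lra.
  - by move=> w /(_ j); exact: winding_near.
  - apply: (@approx_ext _ _ _ (fun w => \sum_(p <- l) p.2 * (p.1 - w j)^-1)) => [w _|].
      by rewrite /W lE.
    apply: asum => p pl; apply: approxM => //; first exact: bounded_on_cst.
      by apply: bounded_approx => //; exact: ainv.
    by apply: approx_poly; exact: polyfun_cst.
    exact: ainv.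
exists (fun w => (W (w j))^-1 * \sum_(p <- l) p.2 * (f (upd w j p.1) * (p.1 - w j)^-1)).
  have aS : poly_approx (cbox w0 r) (fun w => \sum_(p <- l) p.2 * (f (upd w j p.1) * (p.1 - w j)^-1)).
    apply: asum => p pl; have ap := ainv p pl.
    have fp : poly_approx (cbox w0 r) (fun w => f (upd w j p.1)).
      apply: Hf; have /andP[_ ps] := edges_corner (ltW s0) (ledge p pl).
      by apply: le_lt_trans ps _; lra.
    have af : poly_approx (cbox w0 r) (fun w => f (upd w j p.1) * (p.1 - w j)^-1).
      by apply: approxM => //; exact: bounded_approx.
    apply: approxM => //; first exact: bounded_on_cst.
      exact: bounded_approx.
    by apply: approx_poly; exact: polyfun_cst.
  by apply: approxM => //; exact: bounded_approx.
move=> w wr; have := Hm w wr; rewrite lE => H.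
have W3 : 3 <= modulus (W (w j)).
  have := modulus_lb (W (w0 j)) (W (w0 j) - W (w j)).
  rewrite opprB addrCA subrr addr0; have := winding_near m (wr j); rewrite -/(W _) -/(W _); lra.
have Wn : W (w j) != 0 by rewrite -modulus_gt0; lra.
have E : \sum_(p <- l) p.2 * kern w p.1 =
    \sum_(p <- l) p.2 * (f (upd w j p.1) * (p.1 - w j)^-1) - f w * W (w j).
  rewrite /W lE mulr_sumr -sumrB; apply: eq_bigr => p _; ring.
rewrite (_ : _ - _ = - (\sum_(p <- l) p.2 * kern w p.1) / W (w j)); last first.
  by rewrite E; field.
rewrite modulusM modulusN modulusV ler_pdivrMr; last lra.
apply: le_trans H _; rewrite ler_peMr ?(ltW d0)//; lra.
Qed.

End Step.

(* holomorphic functions are locally uniform limits of polynomials *)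
Theorem good_approx w0 e f : 0 < e -> good w0 e f -> poly_approx (cbox w0 (e / 64)) f.
Proof.
move=> e0; have : forall w w', (forall j, j \in enum J -> w j = w' j) -> f w = f w'.
  by move=> w w' H; congr f; apply/funext => j; rewrite H// mem_enum.
(* Induction on the list of variables on which [f] may still depend. *)
elim: (enum J) f => [|j l IH] f fl gf.
  apply: (@approx_ext _ _ _ (fun=> f w0)); first by move=> w _; exact: fl.
  by apply: approx_poly; exact: polyfun_cst.
apply: (@cauchy_step w0 e f j e0 gf (e / 2) (e / 64)) => // t te; apply: IH; last exact: good_upd.
move=> w w' H; apply: fl => i; rewrite /upd inE; case: eqP => //= _; exact: H.
Qed.

End Cauchy.

Section GoodDifferentiable.
Context {R : realType}.
Local Notation C := (Cx R).
Variable k : nat.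

(** [None] is the index of the fibre coordinate mu. *)
Definition row_pt (w : option 'I_k -> C) : 'rV[C]_k * C := (\row_i w (Some i), w None).

Definition pt_row (z : 'rV[C]_k * C) (o : option 'I_k) : C :=
  if o is Some i then z.1 ord0 i else z.2.

Lemma pt_rowK z : row_pt (pt_row z) = z.
Proof.
case: z => u v; rewrite /row_pt /=; congr pair.
by apply/rowP => i; rewrite mxE.
Qed.

Lemma posC (e : C) : 0 < e -> e = RtoC (modulus e) /\ 0 < modulus e.
Proof.
move=> e0; rewrite modulusCE ger0_norm ?ltW//; split=> //.
by rewrite modulus_gt0 gt_eqF.
Qed.

Lemma near_row_pt (w0 : option 'I_k -> C) (P : set ('rV[C]_k * C)) :
  (\forall z \near row_pt w0, P z) -> exists2 e : R, 0 < e &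
    forall w, (forall o, modulus (w o - w0 o) < e) -> P (row_pt w).
Proof.
move=> /nbhs_ballP[e /= eC He]; have [eE e0] := posC eC; exists (modulus e) => // w ww.
apply: He; split=> /=.
- split=> // i j; rewrite !mxE -ball_normE/= distrC eE normc_lt; exact: ww.
- by rewrite -ball_normE/= distrC eE normc_lt; exact: ww.
Qed.

Lemma near_C (z0 : C) (P : set C) : (\forall z \near z0, P z) ->
  exists2 e : R, 0 < e & forall z, modulus (z - z0) < e -> P z.
Proof.
move=> /nbhs_ballP[e /= eC He]; have [eE e0] := posC eC; exists (modulus e) => // z zz.
by apply: He; rewrite -ball_normE/= distrC eE normc_lt.
Qed.

Lemma good_differentiable (G : 'rV[C]_k * C -> C) (z : 'rV[C]_k * C) :
  holomorphic_near G z -> exists2 e : R, 0 < e & good (pt_row z) e (fun w => G (row_pt w)).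
Proof.
rewrite /holomorphic_near -{1}[z]pt_rowK => /near_row_pt[e e0 He]; exists e => //; split.
- move=> w /He dG d d0.
  have dC : 0 < RtoC d by rewrite -(rmorph0 RtoC) RtoC_lt.
  have /cvgrPdist_lt /(_ _ dC) := differentiable_continuous dG.
  move=> /near_row_pt[n n0 Hn]; exists n => // w' /Hn.
  by rewrite normc_lt modulusBC => /ltW.
- move=> w j /He dG.
  pose v := row_pt (fun i => (i == j)%:R).
  have /cvg_ex[/= b Hb] := @diff_derivable _ _ _ _ _ v dG.
  exists b => d d0.
  have dC : 0 < RtoC d by rewrite -(rmorph0 RtoC) RtoC_lt.
  have {}Hb : (fun h : C => h^-1 *: (G (h *: v + row_pt w) - G (row_pt w)) : C)
    @ (0 : C)^' --> (b : C) := Hb.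
  have /cvgrPdist_lt {}Hb := Hb; have := Hb _ dC.
  move=> /near_C[n n0 Hn]; exists n => // t tn.
  rewrite updK; have [->|tw] := eqVneq t (w j).
    by rewrite updK !subrr mulr0 subrr modulus0 mulr0.
  have h0 : t - w j != 0 by rewrite subr_eq0.
  have := Hn (t - w j); rewrite subr0 => /(_ tn h0).
  have -> : (t - w j) *: v + row_pt w = row_pt (upd w j t).
    rewrite /v /row_pt /=; apply/pair_eqP => /=; apply/andP; split; apply/eqP.
      apply/rowP => i; rewrite !mxE /upd; case: eqP => [->|_].
        by rewrite mulr1; ring.
      by rewrite mulr0 add0r.
    rewrite /upd; case: eqP => [->|_].
      by rewrite /GRing.scale /= mulr1; ring.
    by rewrite scaler0 add0r.
  rewrite normc_lt => H.
  set D := G _ - G _ in H *.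
  have -> : D - b * (t - w j) = (t - w j) * - (b - (t - w j)^-1 *: D).
    by rewrite /GRing.scale /=; field.
  by rewrite modulusM modulusN mulrC ler_wpM2r ?modulus_ge0// ltW.
Qed.

End GoodDifferentiable.

Import (canonicals, coercions) mpoly.

(** * Complex points of X in homogeneous coordinates *)

Section IntegerPolynomials.
Context {N : nat}.
Implicit Types (P : mpoly.mpoly N int) (A : comNzRingType).

Definition peval A (y : 'I_N -> A) P : A := mpoly.mmap intr y P.

Definition hpart A (y : 'I_N -> A) P (e : nat) : A :=
  \sum_(m <- mpoly.msupp P | mpoly.mdeg m == e) (mpoly.mcoeff m P)%:~R * mpoly.mmap1 y m.

Lemma pevalD A (y : 'I_N -> A) P Q : peval y (P + Q) = peval y P + peval y Q.
Proof. exact: mpoly.mmapD. Qed.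

Lemma pevalM A (y : 'I_N -> A) P Q : peval y (P * Q) = peval y P * peval y Q.
Proof. exact: (mpoly.mmap_is_multiplicative _ _).1. Qed.

Lemma peval1 A (y : 'I_N -> A) : peval y 1 = 1.
Proof. exact: (mpoly.mmap_is_multiplicative _ _).2. Qed.

Lemma peval0 A (y : 'I_N -> A) : peval y 0 = 0.
Proof. exact: mpoly.mmap0. Qed.

Lemma pevalB A (y : 'I_N -> A) P Q : peval y (P - Q) = peval y P - peval y Q.
Proof. exact: mpoly.mmapB. Qed.

Lemma pevalX A (y : 'I_N -> A) i n :
  peval y (mpoly.mpolyX int (mpoly.mnm1 i) ^+ n) = y i ^+ n.
Proof.
elim: n => [|n IH]; first by rewrite !expr0 peval1.
by rewrite !exprS pevalM IH; congr (_ * _); rewrite /peval mpoly.mmapX mpoly.mmap1U.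
Qed.

Lemma mmap1_rmorph A A' (f : {rmorphism A -> A'}) (y : 'I_N -> A) m :
  f (mpoly.mmap1 y m) = mpoly.mmap1 (fun i => f (y i)) m.
Proof. by rewrite rmorph_prod; apply: eq_bigr => i _; rewrite rmorphXn. Qed.

Lemma peval_rmorph A A' (f : {rmorphism A -> A'}) (y : 'I_N -> A) P :
  f (peval y P) = peval (fun i => f (y i)) P.
Proof.
rewrite rmorph_sum; apply: eq_bigr => m _.
by rewrite rmorphM rmorph_int mmap1_rmorph.
Qed.

Lemma hpart_rmorph A A' (f : {rmorphism A -> A'}) (y : 'I_N -> A) P e :
  f (hpart y P e) = hpart (fun i => f (y i)) P e.
Proof.
rewrite rmorph_sum; apply: eq_bigr => m _.
by rewrite rmorphM rmorph_int mmap1_rmorph.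
Qed.

Lemma hpartZ A c (y : 'I_N -> A) P e :
  hpart (fun i => c * y i) P e = c ^+ e * hpart y P e.
Proof.
rewrite /hpart mulr_sumr; apply: eq_bigr => m /eqP <-.
rewrite mulrCA; congr (_ * _); rewrite /mpoly.mmap1.
under eq_bigr do rewrite exprMn.
by rewrite big_split/= -expr_sum mpoly.mdegE.
Qed.

Lemma peval_hpart A (y : 'I_N -> A) P n : (mpoly.msize P <= n)%N ->
  peval y P = \sum_(e < n) hpart y P e.
Proof.
move=> Pn; rewrite /hpart (exchange_big_dep xpredT)//=.
apply: eq_big_seq => m mP.
have mn : (mpoly.mdeg m < n)%N by apply: leq_trans (mpoly.msize_mdeg_lt mP) Pn.
by rewrite (big_pred1 (Ordinal mn))// => e; rewrite eq_sym.
Qed.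

End IntegerPolynomials.

Section Pieces.
Context {S : comNzRingType} (Sg : grading S).

Lemma piece_sum n (I : Type) (r : seq I) (Q : pred I) (F : I -> S) :
  (forall i, Q i -> Sg n (F i)) -> Sg n (\sum_(i <- r | Q i) F i).
Proof. by move=> H; elim/big_ind: _ => //; [exact: piece0|exact: pieceD]. Qed.

Lemma piece_int n (z : int) a : Sg n a -> Sg n (z%:~R * a).
Proof.
move=> Ha; have nat_case (k : nat) : Sg n (k%:R * a).
  elim: k => [|k IH]; first by rewrite mul0r; exact: piece0.
  by rewrite -natr1 mulrDl mul1r; exact: pieceD.
case: z => k; first exact: nat_case.
rewrite NegzE rmorphN mulNr -[- _]add0r; apply: pieceB; first exact: piece0.
exact: nat_case.
Qed.

Lemma piece_exp n a k : Sg n a -> Sg (n * k)%N (a ^+ k).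
Proof.
move=> Ha; elim: k => [|k IH]; first by rewrite muln0; exact: piece1.
by rewrite mulnS exprS; exact: pieceM.
Qed.

Lemma piece_mmap1 N (s : 'I_N -> S) m : (forall i, Sg 1%N (s i)) ->
  Sg (mpoly.mdeg m) (mpoly.mmap1 s m).
Proof.
move=> Hs; rewrite mpoly.mdegE /mpoly.mmap1.
elim/big_ind2: _ => [|k a l b|i _]; [exact: piece1|exact: pieceM|].
by have := piece_exp (m i) (Hs i); rewrite mul1n.
Qed.

Lemma piece_hpart N (s : 'I_N -> S) P e : (forall i, Sg 1%N (s i)) -> Sg e (hpart s P e).
Proof.
move=> Hs; apply: piece_sum => m /eqP <-; apply: piece_int.
exact: piece_mmap1.
Qed.

(** The grading is direct, so if P(s) has degree [d], the parts of [P] of other degrees vanish at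
    [s] even if they are nonzero. *)
Lemma homog_part N (s : 'I_N -> S) P d : (forall i, Sg 1%N (s i)) ->
  Sg d (peval s P) -> forall e, hpart s P e = if e == d then peval s P else 0.
Proof.
move=> Hs HP e; pose n := maxn (mpoly.msize P) (maxn d e).+1.
pose c k := hpart s P k - if k == d then peval s P else 0.
have cS k : Sg k (c k).
  apply: pieceB; first exact: piece_hpart.
  by case: eqP => [->|_]//; exact: piece0.
have en : (e < n)%N by rewrite leq_max ltnS leq_maxr orbT.
have dn : (d < n)%N by rewrite leq_max ltnS leq_maxl orbT.
apply/eqP; rewrite -subr_eq0; apply/eqP; apply: (piece_direct cS _ en).
rewrite sumrB -(peval_hpart s (leq_maxl _ _)) -big_mkcond/=.
by rewrite (big_pred1 (Ordinal dn)) ?subrr.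
Qed.

End Pieces.

Section Points.
Context {R : realType} {S : comNzRingType} {Sg : grading S}.
Local Notation C := (Cx R).
Context {N : nat} {s : 'I_N -> S}.
Hypothesis es : embedding_sections Sg s.
Local Notation coordX := (Defs.coord R (line_deg Sg)).
Implicit Types (p q : coordX) (y : 'I_N -> C).

Definition pos p : 'I_N -> C := fun i => ev p (s i).

Lemma pos_neq0 p : exists i, pos p i != 0.
Proof.
have [a Da pa] := semistable p ord0.
have [k [b Hb]] := emb_cover es (n := 1%N) isT Da.
apply: contrapT => /forallNP H; have : ev p (a ^+ k) != 0 by rewrite rmorphXn expf_neq0.
rewrite Hb rmorph_sum big1 ?eqxx// => i _; rewrite rmorphM.
by have /negP/negPn/eqP := H i; rewrite /pos => ->; rewrite mulr0.
Qed.

Lemma closedP i a : exists k P, s i ^+ k * a = peval s P.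
Proof.
have [n [c [cS ->]]] := piece_span Sg a.
elim: n => [|n [k [P HP]]].
  by exists 0%N, 0; rewrite big_ord0 mulr0 peval0.
have [l [Q HQ]] := emb_closed es i (cS n).
pose X := mpoly.mpolyX int (mpoly.mnm1 i).
exists (k + l)%N, (X ^+ l * P + X ^+ k * Q).
rewrite big_ord_recr/= pevalD !pevalM !pevalX -HP -[peval s Q]HQ exprD; ring.
Qed.

Lemma ev_peval p P : ev p (peval s P) = peval (pos p) P.
Proof. exact: peval_rmorph. Qed.

Lemma pos_inj p q : pos p =1 pos q -> ev p =1 ev q.
Proof.
move=> E a; have [i pi] := pos_neq0 p; have [k [P HP]] := closedP i a.
have pk : pos p i ^+ k != 0 by rewrite expf_neq0.
apply: (mulfI pk); rewrite {2}E -!rmorphXn -!rmorphM HP !ev_peval.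
by congr peval; apply/funext.
Qed.

(** The complex points of the affine cone over X. *)
Definition relations : set ('I_N -> C) :=
  [set y | forall P, peval s P = 0 -> peval y P = 0].

Lemma relations_pos p c : relations (fun i => c * pos p i).
Proof.
move=> P P0; have P0' : Sg 0%N (peval s P) by rewrite P0; exact: piece0.
have H e : hpart (pos p) P e = 0.
  rewrite -[hpart _ _ _](hpart_rmorph (ev p)) (homog_part (emb_deg1 es) P0').
  by rewrite P0; case: ifP; rewrite rmorph0.
by rewrite (peval_hpart _ (leqnn _)) big1// => e _; rewrite hpartZ H mulr0.
Qed.

(** If [a] has degree n and s_i^k a = P(s), only the part of [P] of degree k + n contributes, and it
    scales by c^(k+n). *)
Lemma pos_scale p q c : c != 0 -> (forall i, pos q i = c * pos p i) ->
  mu q = c^-1 * mu p -> same_point p q.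
Proof.
move=> c0 qp mqp; exists (fun=> c); split=> // [d a Da|]; rewrite ?big_ord1//.
rewrite /line_deg in Da; rewrite /character big_ord1; move: (d ord0) Da => n Da.
have [i pi] := pos_neq0 p; have [k [P HP]] := emb_closed es i Da.
have Pk : Sg (k + n)%N (peval s P).
  rewrite /peval -HP; apply: pieceM => //.
  by have := piece_exp k (emb_deg1 es i); rewrite mul1n.
have H e : hpart (pos p) P e = if e == (k + n)%N then peval (pos p) P else 0.
  rewrite -[hpart _ _ _](hpart_rmorph (ev p)) (homog_part (emb_deg1 es) Pk).
  by case: ifP; rewrite ?rmorph0// ev_peval.
have E : peval (pos q) P = c ^+ (k + n) * peval (pos p) P.
  have -> : pos q = fun i => c * pos p i by apply/funext.
  pose M := maxn (mpoly.msize P) (k + n).+1.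
  rewrite [LHS](peval_hpart _ (leq_maxl _ (k + n).+1)) -/M.
  under eq_bigr do rewrite hpartZ H.
  have kM : (k + n < M)%N by rewrite leq_maxr.
  rewrite (bigD1 (Ordinal kM))//= eqxx big1 ?addr0// => e.
  by rewrite -val_eqE/= => /negbTE ->; rewrite mulr0.
have ck : c ^+ k != 0 by rewrite expf_neq0.
have pk : pos p i ^+ k != 0 by rewrite expf_neq0.
have Ep : pos p i ^+ k * ev p a = peval (pos p) P.
  by rewrite -ev_peval /peval -HP rmorphM rmorphXn.
have Eq : c ^+ k * pos p i ^+ k * ev q a = peval (pos q) P.
  by rewrite -exprMn -qp -ev_peval /peval -HP rmorphM rmorphXn.
apply: (mulfI (mulf_neq0 ck pk)); rewrite Eq E -Ep exprD; ring.
Qed.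

Section Construct.
Variables (y : 'I_N -> C) (i : 'I_N).
Hypotheses (yR : relations y) (yi : y i != 0).

(** The value of [a] at the point with coordinates [y], computed on the chart where s_i is nonzero.
    It does not depend on k and P because [y] satisfies all relations between the s_j. *)
Let value a v := exists k P, s i ^+ k * a = peval s P /\ v = peval y P / y i ^+ k.

Let value_ex a : exists v, value a v.
Proof. by have [k [P HP]] := closedP i a; exists (peval y P / y i ^+ k), k, P. Qed.

Let value_uniq a v v' : value a v -> value a v' -> v = v'.
Proof.
move=> [k [P [HP ->]]] [l [Q [HQ ->]]].
pose X := mpoly.mpolyX int (mpoly.mnm1 i).
have := yR (P := X ^+ l * P - X ^+ k * Q).
rewrite !pevalB !pevalM !pevalX -HP -HQ => /(_ _)/eqP.
rewrite mulrCA subrr subr_eq0 => /(_ erefl)/eqP E.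
have yk n : y i ^+ n != 0 by rewrite expf_neq0.
apply: (mulfI (yk l)); apply: (mulfI (yk k)).
transitivity (y i ^+ l * peval y P); first by field; rewrite yk.
by rewrite E; field; rewrite yk.
Qed.

Let evy a := sval (cid (value_ex a)).

Let evyP a v : value a v -> evy a = v.
Proof. by apply: value_uniq; exact: (svalP (cid (value_ex a))). Qed.

Let evyE a : value a (evy a). Proof. exact: (svalP (cid (value_ex a))). Qed.

Let yk n : y i ^+ n != 0. Proof. by rewrite expf_neq0. Qed.
Let X := mpoly.mpolyX int (mpoly.mnm1 i).

Let evy_zmod : zmod_morphism evy.
Proof.
move=> a b; have [k [P [HP ->]]] := evyE a; have [l [Q [HQ ->]]] := evyE b.
apply: evyP; exists (k + l)%N, (X ^+ l * P - X ^+ k * Q); split.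
  rewrite pevalB !pevalM !pevalX -HP -HQ exprD; ring.
by rewrite pevalB !pevalM !pevalX exprD; field; rewrite !yk.
Qed.

Let evy_monoid : monoid_morphism evy.
Proof.
split.
  by apply: evyP; exists 0%N, 1; rewrite !peval1 !expr0 mulr1 divr1.
move=> a b; have [k [P [HP ->]]] := evyE a; have [l [Q [HQ ->]]] := evyE b.
apply: evyP; exists (k + l)%N, (P * Q); split.
  by rewrite pevalM -HP -HQ exprD; ring.
by rewrite pevalM exprD; field; rewrite !yk.
Qed.

HB.instance Definition _ := GRing.isZmodMorphism.Build S C evy evy_zmod.
HB.instance Definition _ := GRing.isMonoidMorphism.Build S C evy evy_monoid.

Let evy_s j : evy (s j) = y j.
Proof.
apply: evyP; exists 0%N, (mpoly.mpolyX int (mpoly.mnm1 j) ^+ 1).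
by rewrite !pevalX !expr0 !expr1 mul1r divr1.
Qed.

Lemma coord_exists m : exists p, pos p =1 y /\ mu p = m.
Proof.
have st j : exists2 a, line_deg Sg (unit_degree j) a & evy a != 0.
  exists (s i); last by rewrite evy_s.
  by rewrite /line_deg /unit_degree (ord1 j) eqxx; exact: emb_deg1 es i.
by exists (Coord (D := line_deg Sg) m st); split=> // j; exact: evy_s.
Qed.

End Construct.

End Points.

(** * Local form of holomorphic functions on V_X(L) *)

Section PolyContinuity.
Context {R : realType}.
Local Notation C := (Cx R).
Variable J : finType.

Lemma finite_radius (Q : J -> R -> Prop) :
  (forall j e e', 0 < e' -> e' <= e -> Q j e -> Q j e') ->
  (forall j, exists2 e, 0 < e & Q j e) -> exists2 e, 0 < e & forall j, Q j e.
Proof.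
move=> Qle H; suff [e e0 He] : exists2 e, 0 < e & forall j, j \in enum J -> Q j e.
  by exists e => // j; apply: He; rewrite mem_enum.
elim: (enum J) => [|j l [e e0 He]]; first by exists 1.
have [e' e'0 He'] := H j; have m0 : 0 < Num.min e e' by rewrite lt_min e0.
exists (Num.min e e') => // i; rewrite inE => /orP[/eqP->|/He].
  by apply: Qle He' => //; rewrite ge_min lexx orbT.
by apply: Qle => //; rewrite ge_min lexx.
Qed.

Lemma polyfun_cont (h : (J -> C) -> C) w0 d : polyfun h -> 0 < d ->
  exists2 n, 0 < n & forall w, cbox w0 n w -> modulus (h w - h w0) <= d.
Proof.
move=> ph; elim: ph d => {h} [c|j|f g _ Hf _ Hg|f g pf Hf pg Hg] d d0.
- by exists 1 => // w _; rewrite subrr modulus0 ltW.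
- by exists d => // w; exact.
- have [|n n0 Hn] := Hf (d / 2); first lra.
  have [|m m0 Hm] := Hg (d / 2); first lra.
  exists (Num.min n m); first by rewrite lt_min n0.
  move=> w ww; rewrite (_ : _ - _ = (f w - f w0) + (g w - g w0)); last by ring.
  apply: le_trans (modulusD _ _) _.
  have h1 : modulus (f w - f w0) <= d / 2.
    by apply: Hn => j; apply: le_trans (ww j) _; rewrite ge_min lexx.
  have h2 : modulus (g w - g w0) <= d / 2.
    by apply: Hm => j; apply: le_trans (ww j) _; rewrite ge_min lexx orbT.
  lra.
- pose Q := modulus (f w0) + modulus (g w0) + 1.
  have [fg0 gg0] := (modulus_ge0 (f w0), modulus_ge0 (g w0)).
  have Q0 : 0 < Q by rewrite /Q; lra.
  have dQ : 0 < Num.min 1 (d / Q) by rewrite lt_min ltr01 divr_gt0.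
  have [n n0 Hn] := Hf _ dQ; have [m m0 Hm] := Hg _ dQ.
  exists (Num.min n m); first by rewrite lt_min n0.
  move=> w ww.
  have h1 : modulus (f w - f w0) <= Num.min 1 (d / Q).
    by apply: Hn => j; apply: le_trans (ww j) _; rewrite ge_min lexx.
  have h2 : modulus (g w - g w0) <= Num.min 1 (d / Q).
    by apply: Hm => j; apply: le_trans (ww j) _; rewrite ge_min lexx orbT.
  move: h1 h2; rewrite !le_min => /andP[h1 h1'] /andP[h2 h2'].
  rewrite (_ : _ - _ = (f w - f w0) * g w0 + f w0 * (g w - g w0) +
    (f w - f w0) * (g w - g w0)); last by ring.
  apply: le_trans (modulusD _ _) (@le_trans _ _ (d / Q * (modulus (g w0)) +
    modulus (f w0) * (d / Q) + 1 * (d / Q)) _ _ _ _).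
    apply: lerD; last by rewrite modulusM ler_pM ?modulus_ge0.
    apply: le_trans (modulusD _ _) _; rewrite !modulusM.
    by apply: lerD; [apply: ler_wpM2r|apply: ler_wpM2l]; rewrite ?modulus_ge0.
  by rewrite le_eqVlt; apply/orP; left; apply/eqP; rewrite /Q; field; rewrite gt_eqF.
Qed.

Lemma approx_cont (f : (J -> C) -> C) w0 r d : 0 < r -> poly_approx (cbox w0 r) f ->
  0 < d -> exists2 n, 0 < n & n <= r /\ forall w, cbox w0 n w -> modulus (f w - f w0) <= d.
Proof.
move=> r0 fa d0; have [|h ph Hh] := fa (d / 4); first lra.
have [|n n0 Hn] := polyfun_cont w0 ph (d := d / 2); first lra.
exists (Num.min n r); first by rewrite lt_min n0.
split=> [|w ww]; first by rewrite ge_min lexx orbT.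
have h1 : modulus (f w - h w) <= d / 4.
  by apply: Hh => j; apply: le_trans (ww j) _; rewrite ge_min lexx orbT.
have h2 : modulus (h w - h w0) <= d / 2.
  by apply: Hn => j; apply: le_trans (ww j) _; rewrite ge_min lexx.
have h3 : modulus (f w0 - h w0) <= d / 4.
  by apply: Hh => j; rewrite subrr modulus0 ltW.
rewrite (_ : _ - _ = (f w - h w) + (h w - h w0) - (f w0 - h w0)); last by ring.
apply: le_trans (modulusB _ _) _; have := modulusD (f w - h w) (h w - h w0).
by move: h1 h2 h3; lra.
Qed.

End PolyContinuity.

Lemma polyfun_peval (R : realType) (J : finType) N (f : 'I_N -> (J -> Cx R) -> Cx R) P :
  (forall i, polyfun (f i)) -> polyfun (fun w => peval (fun i => f i w) P).
Proof.
move=> pf; rewrite /peval /mpoly.mmap; apply: polyfun_sum => m.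
apply: polyfun_mul; first exact: polyfun_cst.
by apply: polyfun_prod => i; exact: polyfun_exp.
Qed.

Section Local.
Context {R : realType} {S : comNzRingType} {Sg : grading S}.
Local Notation C := (Cx R).
Context {N : nat} {s : 'I_N -> S}.
Hypothesis es : embedding_sections Sg s.
Local Notation coordX := (Defs.coord R (line_deg Sg)).
Local Notation pos := (pos (s := s)).
Implicit Types (p q : coordX).

Definition chart p : option 'I_N -> C := fun o => if o is Some i then pos p i else mu p.

(** Near [p] some s_i does not vanish, and there [a] is P(s) / s_i^k. *)
Lemma value_approx a p : exists2 r, 0 < r & exists f,
  poly_approx (cbox (chart p) r) f /\
  forall q, cbox (chart p) r (chart q) -> ev q a = f (chart q).
Proof.
have [i pi] := pos_neq0 es p; have [k [P HP]] := closedP es i a.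
have pi0 : 0 < modulus (pos p i) by rewrite modulus_gt0.
have BU := bounded_cbox (chart p) (modulus (pos p i) / 2).
exists (modulus (pos p i) / 2); first lra.
exists (fun w => peval (fun j => w (Some j)) P * (w (Some i))^-1 ^+ k); split.
  have a1 : poly_approx (cbox (chart p) (modulus (pos p i) / 2))
      (fun w => peval (fun j => w (Some j)) P).
    by apply: approx_poly; apply: polyfun_peval => j; exact: polyfun_coord.
  have a2 : poly_approx (cbox (chart p) (modulus (pos p i) / 2))
      (fun w => (w (Some i))^-1 ^+ k).
    apply: approx_expr => //; apply: (approx_inv (c := pos p i) (q := modulus (pos p i) / 2)) => //.
    - lra.
    - by move=> w /(_ (Some i)); rewrite modulusBC.
    - by apply: approx_poly; exact: polyfun_coord.
  by apply: approxM => //; exact: bounded_approx.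
move=> q /(_ (Some i)) /= qp.
have qi : pos q i != 0.
  by rewrite -modulus_gt0; have := modulus_lb (pos p i) (pos p i - pos q i);
    rewrite opprB addrCA subrr addr0 modulusBC; move: qp; lra.
rewrite -[peval _ P](ev_peval (s := s) q) -HP rmorphM rmorphXn -/(pos q i).
rewrite exprVn mulrAC mulfV ?mul1r// expf_neq0//.
Qed.

Lemma value_cont a p d : 0 < d -> exists2 n, 0 < n &
  forall q, cbox (chart p) n (chart q) -> modulus (ev q a - ev p a) <= d.
Proof.
move=> d0; have [r r0 [f [fa fE]]] := value_approx a p.
have [n n0 [nr Hn]] := approx_cont r0 fa d0; exists n => // q qp.
rewrite !fE ?Hn// => j; last exact: le_trans (qp j) nr.
by rewrite subrr modulus0 ltW.
Qed.

(** The topology is that of pointwise convergence on all of [S], but by [value_cont] the finitely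
    many coordinates in [chart] control every value. *)
Lemma near_chart p (Q : set coordX) : nbhs p Q -> exists2 e, 0 < e &
  forall q, cbox (chart p) e (chart q) -> Q q.
Proof.
pose Fl := filter_from [set e : R | 0 < e] (fun e => [set q | cbox (chart p) e (chart q)]).
have FlF : Filter Fl.
  apply: filter_from_filter; first by exists 1; exact: ltr01.
  move=> i j i0 j0; exists (Num.min i j); first by rewrite /mkset lt_min; apply/andP.
  by move=> q qp; split=> o; apply: le_trans (qp o) _; rewrite ge_min lexx ?orbT.
suff cvg_fun : (fun q => coord_fun q) @ Fl --> coord_fun p.
  rewrite nbhsE => -[V [[U oU <-] Up] VQ].
  have : nbhs (coord_fun p) U by exact: open_nbhs_nbhs.
  by move=> /cvg_fun[e e0 He]; exists e => // q /He Uq; exact: VQ.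
have cvgC (f : coordX -> C) : (forall d, 0 < d -> exists2 n, 0 < n &
    forall q, cbox (chart p) n (chart q) -> modulus (f q - f p) <= d) -> f @ Fl --> f p.
  move=> H; apply/cvgrPdist_le => e /posC[eE e0].
  have [n n0 Hn] := H _ e0; exists n => // q /Hn fq.
  by rewrite distrC -modulusCE eE RtoC_le.
(* [pointwise_cvgP] asks for an irrelevant topology on the domain *)
have H1 : (fun q => (ev q : {ptws S -> C})) @ Fl --> (ev p : {ptws S -> C}).
  apply: (iffRL (@pointwise_cvgP (initial_topology (fun _ : S => 0 : R)) C
    ((fun q => (ev q : S -> C)) @ Fl) (ev p) _)) => a.
  by apply: (cvgC (fun q => ev q a)) => d; exact: value_cont.
have H2 : (fun q => mu q) @ Fl --> mu p.
  by apply: cvgC => d d0; exists d => // q /(_ None).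
exact: (cvg_pair H1 H2).
Qed.

End Local.

Section LocalApprox.
Context {R : realType} {S : comNzRingType} {Sg : grading S}.
Local Notation C := (Cx R).

(** A relation between elements of [A] holds between their values at a point, so the ideal in
    [germ_eq] contributes 0 there. *)
Lemma germ_eq_value (A : comNzRingType) r (D : ('I_r -> nat) -> set A)
    (q : Defs.coord R D) (g h : germ) :
  germ_eq q g h -> germ_value g q = germ_value h q.
Proof.
move=> [m [a [f [f' [fE f'E [n [P [c [Pa _ /nbhs_singleton H]]]]]]]]].
have val k (e : 'I_k -> A) (u : 'I_k -> 'I_m) : (forall i, a (u i) = e i) ->
    select u (values a q) = values e q.
  move=> uE; rewrite /select /values /=; congr pair.
  by apply/rowP => i; rewrite !mxE uE.
have {}H : germ_value g q - germ_value h q = 0.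
  rewrite /germ_value -(val _ _ _ fE) -(val _ _ _ f'E) H big1// => j _.
  rewrite (_ : mpoly.mmap intr _ (P j) = ev q (mpoly.mmap intr a (P j))).
    by rewrite Pa rmorph0 mul0r.
  rewrite -[mpoly.mmap _ a _]/(peval a (P j)) peval_rmorph /peval.
  by congr mpoly.mmap; apply/funext => i; rewrite mxE.
by apply/eqP; rewrite -subr_eq0; apply/eqP.
Qed.

Context {N : nat} {s : 'I_N -> S}.
Hypothesis es : embedding_sections Sg s.
Local Notation coordX := (Defs.coord R (line_deg Sg)).
Local Notation chart := (chart (s := s)).
Implicit Types (p q : coordX).

(** Near [p] the values of F are those of the one germ at [p]: a holomorphic function of mu and
    finitely many elements of [S], which are themselves limits of polynomials in the chart. *)
Lemma local_approx (F : VX R Sg -> C) p : holomorphic F ->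
  exists2 e, 0 < e & exists f, poly_approx (cbox (chart p) e) f /\
    forall q, cbox (chart p) e (chart q) -> F (\pi_(VX R Sg) q) = f (chart q).
Proof.
move=> [g Hg]; have [[gD gH _] _ near_p] := Hg p.
have [e1 e10 He1] := near_chart es near_p.
have Fq q : cbox (chart p) e1 (chart q) -> F (\pi_(VX R Sg) q) = germ_value (g p) q.
  by move=> /He1/germ_eq_value ->; have [_ ->] := Hg q.
move: (g p) gD gH Fq => {g Hg near_p He1} [k a d G] /= gD gH Fq.
have [e2 e20 /(good_approx e20)] := good_differentiable gH.
set v0 := pt_row _; have e20' : 0 < e2 / 64 by rewrite divr_gt0.
move: (e2 / 64) e20' => {e20}e2 e20 aG.
pose Q (i : 'I_k) e := exists f, [/\ poly_approx (cbox (chart p) e) f,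
  forall q, cbox (chart p) e (chart q) -> ev q (a i) = f (chart q) &
  forall w, cbox (chart p) e w -> modulus (f w - f (chart p)) <= e2].
have cbox_le e e' : e' <= e -> cbox (chart p) e' `<=` cbox (chart p) e.
  by move=> ee w we j; apply: le_trans (we j) ee.
have self e : 0 < e -> cbox (chart p) e (chart p).
  by move=> e0 j; rewrite subrr modulus0 ltW.
have [|i|e3 e30 He3] := @finite_radius R _ Q.
- move=> i e e' e'0 ee [f [f1 f2 f3]]; exists f; split.
  + exact: approx_sub (cbox_le _ _ ee) f1.
  + by move=> q /(cbox_le _ _ ee)/f2.
  + by move=> q /(cbox_le _ _ ee)/f3.
- have [r r0 [f [fa fE]]] := value_approx es (a i) p.
  have [n n0 [nr Hn]] := approx_cont r0 fa e20; exists n => //; exists f; split=> //.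
    exact: approx_sub (cbox_le _ _ nr) fa.
  by move=> q /(cbox_le _ _ nr)/fE.
pose f i := sval (cid (He3 i)); have Hf i := svalP (cid (He3 i)); rewrite -/(f _) in Hf.
pose e := Num.min e1 (Num.min e3 e2).
have e0 : 0 < e by rewrite !lt_min e10 e30.
have ee1 : e <= e1 by rewrite ge_min lexx.
have ee3 : e <= e3 by rewrite !ge_min lexx orbT.
have ee2 : e <= e2 by rewrite !ge_min lexx !orbT.
pose A (o : option 'I_k) (w : option 'I_N -> C) := if o is Some i then f i w else w None.
have AE q : cbox (chart p) e (chart q) -> row_pt (A^~ (chart q)) = values a q.
  move=> qp; rewrite /row_pt /values /=; congr pair; apply/rowP => i; rewrite !mxE.
  by have [_ -> //] := Hf i; exact: cbox_le qp.
exists e => //; exists (fun w => G (row_pt (fun o => A o w))); split; last first.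
  by move=> q qp; rewrite Fq ?AE//; exact: cbox_le qp.
apply: (approx_comp (V := cbox v0 e2) (g := fun w => G (row_pt w))) => //.
- exact: bounded_cbox.
- move=> w we [i|]; rewrite /A /v0 /=.
    have [_ fp fw] := Hf i; rewrite mxE fp; last exact: self.
    by apply: fw; exact: cbox_le we.
  by apply: le_trans (we None) _.
- move=> [i|]; last by apply: approx_poly; exact: polyfun_coord.
  by have [fa _ _] := Hf i; exact: approx_sub (cbox_le _ _ ee3) fa.
Qed.

End LocalApprox.

(** * Maxima on closed bounded sets *)

Section ContinuousMax.
Context {R : realType}.
Local Notation C := (Cx R).
Variable J : finType.
Implicit Types (f g : (J -> C) -> C) (w : J -> C) (A : set (J -> C)).

Definition fcont f w0 := forall d : R, 0 < d -> exists2 n : R, 0 < n &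
  forall w, cbox w0 n w -> modulus (f w - f w0) <= d.

Lemma fcont_poly f w0 : polyfun f -> fcont f w0.
Proof. by move=> pf d; exact: polyfun_cont. Qed.

Lemma fcont_comp2 (h : (bool -> C) -> C) f g w0 : polyfun h -> fcont f w0 -> fcont g w0 ->
  fcont (fun w => h (fun b => if b then f w else g w)) w0.
Proof.
move=> ph Hf Hg d d0.
have [n n0 Hn] := polyfun_cont (fun b => if b then f w0 else g w0) ph d0.
have [m m0 Hm] := Hf n n0; have [k k0 Hk] := Hg n n0.
exists (Num.min m k); first by rewrite lt_min m0.
move=> w ww; apply: Hn => -[].
  by apply: Hm => j; apply: le_trans (ww j) _; rewrite ge_min lexx.
by apply: Hk => j; apply: le_trans (ww j) _; rewrite ge_min lexx orbT.
Qed.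

Lemma fcontD f g w0 : fcont f w0 -> fcont g w0 -> fcont (fun w => f w + g w) w0.
Proof.
by apply: (@fcont_comp2 (fun u => u true + u false)); apply: polyfun_add; exact: polyfun_coord.
Qed.

Lemma fcontM f g w0 : fcont f w0 -> fcont g w0 -> fcont (fun w => f w * g w) w0.
Proof.
by apply: (@fcont_comp2 (fun u => u true * u false)); apply: polyfun_mul; exact: polyfun_coord.
Qed.

Lemma fcont_modulus f w0 : fcont f w0 -> fcont (fun w => RtoC (modulus (f w))) w0.
Proof.
move=> Hf d /Hf[n n0 Hn]; exists n => // w /Hn; apply: le_trans.
rewrite -rmorphB modulus_RtoC ler_norml.
have := modulus_lb (f w) (f w0); have := modulus_lb (f w0) (f w).
by rewrite modulusBC; lra.
Qed.

Lemma fcont_prod (I : Type) (r : seq I) (F : I -> (J -> C) -> C) w0 :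
  (forall i, fcont (F i) w0) -> fcont (fun w => \prod_(i <- r) F i w) w0.
Proof.
move=> HF; elim: r => [|i r IH].
  rewrite (_ : (fun w => _) = fun=> 1); first by apply: fcont_poly; exact: polyfun_cst.
  by apply/funext => w; rewrite big_nil.
rewrite (_ : (fun w => _) = fun w => F i w * \prod_(i <- r) F i w); first exact: fcontM.
by apply/funext => w; rewrite big_cons.
Qed.

Definition seq_closed A := forall w, ~ A w -> exists2 e : R, 0 < e &
  forall w', cbox w e w' -> ~ A w'.

Lemma seq_closedI A A' : seq_closed A -> seq_closed A' -> seq_closed (A `&` A').
Proof.
move=> HA HA' w /not_andP[/HA|/HA'] [e e0 He]; exists e => // w' /He nA [] //.
Qed.

Lemma seq_closed_bigcap (I : Type) (F : I -> set (J -> C)) :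
  (forall i, seq_closed (F i)) -> seq_closed [set w | forall i, F i w].
Proof.
move=> HF w /existsNP[i /HF[e e0 He]]; exists e => // w' /He nF H.
exact: nF.
Qed.

Lemma seq_closed_le f (M : R) : (forall w, fcont f w) ->
  seq_closed [set w | modulus (f w) <= M].
Proof.
move=> Hf w /= /negP; rewrite -ltNge => wM.
have [|n n0 Hn] := Hf w ((modulus (f w) - M) / 2); first lra.
exists n => // w' /Hn; have := modulus_lb (f w) (f w').
by rewrite modulusBC => h1 h2 h3; lra.
Qed.

Lemma seq_closed_ex (I : finType) (F : I -> (J -> C) -> C) (M : R) :
  (forall i w, fcont (F i) w) -> seq_closed [set w | exists i, M <= modulus (F i w)].
Proof.
move=> HF w /forallNP H.
have [|i|e e0 He] := @finite_radius R I (fun i e => forall w', cbox w e w' -> modulus (F i w') < M).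
- by move=> i e e' e'0 ee Hw w' ww; apply: Hw => j; apply: le_trans (ww j) ee.
- have /negP := H i; rewrite -ltNge => wM.
  have [|n n0 Hn] := HF i w ((M - modulus (F i w)) / 2); first lra.
  exists n => // w' /Hn; have := modulus_lb (F i w') (F i w); lra.
- by exists e => // w' ww [k Mk]; move: Mk; rewrite leNgt He.
Qed.

(** If there were no maximum, near each point [phi] would be below some attained value; [box_ind]
    then gives one attained value above all others, itself included. *)
Lemma compact_max A (phi : (J -> C) -> R) (B : R) : A !=set0 ->
  (forall w j, A w -> modulus (w j) <= B) -> seq_closed A ->
  (forall w t, A w -> phi w < t -> exists2 e, 0 < e &
     forall w', A w' -> cbox w e w' -> phi w' < t) ->
  exists2 w, A w & forall w', A w' -> phi w' <= phi w.
Proof.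
move=> [w1 Aw1] AB cA usc; apply: contrapT => nmax.
have next w : A w -> exists2 w', A w' & phi w < phi w'.
  move=> Aw; apply: contrapT => H; apply: nmax; exists w => // w' Aw'.
  by rewrite leNgt; apply/negP => ww'; apply: H; exists w'.
pose P U := exists2 w, A w & forall w', U w' -> A w' -> phi w' < phi w.
have [w0 Aw0 H] : P [set w | forall j, modulus (w j) <= B]; last first.
  by have := H w0 (fun j => AB w0 j Aw0) Aw0; rewrite ltxx.
apply: box_ind.
- by move=> U V UV [w Aw H]; exists w => // w' /UV; exact: H.
- move=> U V [w Aw H] [w' Aw' H']; have [ww|ww] := leP (phi w) (phi w').
    by exists w' => // u [Uu|Vu] Au; [apply: lt_le_trans ww; exact: H|exact: H'].
  by exists w => // u [Uu|Vu] Au; [exact: H|apply: lt_trans ww; exact: H'].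
- move=> p; have [Ap|nAp] := pselect (A p).
    have [w Aw pw] := next p Ap; have [e e0 He] := usc p _ Ap pw.
    by exists e => //; exists w => // w' pw' Aw'; apply: He => // j; exact: ltW.
  have [e e0 He] := cA p nAp; exists e => //; exists w1 => // w' pw' Aw'.
  by exfalso; apply: (He w') => // j; exact: ltW.
Qed.

End ContinuousMax.

(** * Rossi's principle for polynomial functions *)

Section PeakPolyfun.
Context {R : realType} {N : nat}.
Local Notation C := (Cx R).
Local Notation P := (mpoly.mpoly N C).
Implicit Types (v z : 'I_N -> C).

Let iota : {rmorphism C -> P} := @mpoly.mpolyC N C.
Let x i : P := mpoly.mpolyX C (mpoly.mnm1 i).
Let ev z : {rmorphism P -> C} := mpoly.meval z.

Let ev_iota z c : ev z (iota c) = c. Proof. exact: mpoly.mevalC. Qed.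
Let ev_x z i : ev z (x i) = z i. Proof. exact: mpoly.mevalXU. Qed.

Let mpoly_ind (Q : P -> Prop) : (forall c, Q (iota c)) -> (forall i, Q (x i)) ->
  (forall a b, Q a -> Q b -> Q (a + b)) -> (forall a b, Q a -> Q b -> Q (a * b)) ->
  forall a, Q a.
Proof.
move=> QC QX QD QM; apply: mpoly.mpolyind; first by rewrite -(rmorph0 iota).
move=> c m p _ _ Qp; apply: QD => //; rewrite -mpoly.mul_mpolyC; apply: (QM); first exact: QC.
rewrite mpoly.mpolyXE_id; elim/big_ind: _ => [|a b|i _]; [by rewrite -(rmorph1 iota)|exact: QM|].
elim: (m i) => [|n IH]; first by rewrite expr0 -(rmorph1 iota).
by rewrite exprS; apply: QM => //; exact: (QX i).
Qed.

Let taylor a z : exists b : 'I_N -> P,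
  a = iota (ev z a) + \sum_j (x j - iota (z j)) * b j.
Proof.
elim/mpoly_ind: a => [c|i|a b [a' Ha] [b' Hb]|a b [a' Ha] [b' Hb]].
- by exists (fun=> 0); rewrite ev_iota big1 ?addr0// => j _; rewrite mulr0.
- exists (fun j => (j == i)%:R); rewrite ev_x (bigD1 i)//= eqxx mulr1 big1.
    by rewrite addr0 addrC subrK.
  by move=> j /negbTE ->; rewrite mulr0.
- exists (fun j => a' j + b' j); under eq_bigr do rewrite mulrDr.
  by rewrite big_split/= {1}Ha {1}Hb (rmorphD (ev z)) (rmorphD iota); ring.
- exists (fun j => a' j * b + iota (ev z a) * b' j).
  under eq_bigr do rewrite mulrDr mulrA mulrCA.
  rewrite big_split/= -mulr_suml -mulr_sumr.
  rewrite (rmorphM (ev z)) (rmorphM iota).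
  move: Ha Hb; set sa := \sum_j _ * a' j; set sb := \sum_j _ * b' j => Ha Hb.
  rewrite -[sa](addKr (iota (ev z a))) -Ha -[sb](addKr (iota (ev z b))) -Hb; ring.
Qed.

Let polyfun_ev p : polyfun (fun z => ev z p).
Proof.
elim/mpoly_ind: p => [c|i|a b Ha Hb|a b Ha Hb].
- by rewrite (_ : (fun z => _) = fun=> c); [exact: polyfun_cst|apply/funext => z; exact: ev_iota].
- by rewrite (_ : (fun z => _) = fun z => z i); [exact: polyfun_coord|apply/funext => z; exact: ev_x].
- rewrite (_ : (fun z => _) = fun z => ev z a + ev z b); first exact: polyfun_add.
  by apply/funext => z; rewrite rmorphD.
- rewrite (_ : (fun z => _) = fun z => ev z a * ev z b); first exact: polyfun_mul.
  by apply/funext => z; rewrite rmorphM.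
Qed.

Let ev_polyfun (h : ('I_N -> C) -> C) : polyfun h -> exists p, forall z, h z = ev z p.
Proof.
elim=> {h} [c|i|f g _ [p Hp] _ [q Hq]|f g _ [p Hp] _ [q Hq]].
- by exists (iota c) => z; rewrite ev_iota.
- by exists (x i) => z; rewrite ev_x.
- by exists (p + q) => z; rewrite rmorphD Hp Hq.
- by exists (p * q) => z; rewrite rmorphM Hp Hq.
Qed.

(* the polynomial hull *)
Definition phull (T : set ('I_N -> C)) : set ('I_N -> C) := [set z | forall h M, polyfun h ->
  0 <= M -> (forall v, T v -> modulus (h v) <= M) -> modulus (h z) <= M].

Let phullE T : phull T = polyhull ev T.
Proof.
apply/seteqP; split=> z Hz.
  by move=> p M M0 HM; apply: (Hz (fun z => ev z p)).
move=> h M /ev_polyfun[p Hp] M0 HM; rewrite Hp; apply: Hz => // v Tv.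
by rewrite -Hp; exact: HM.
Qed.

(* Rossi's local maximum modulus principle *)
Lemma no_peak (T : set ('I_N -> C)) v0 (g : ('I_N -> C) -> C) (theta rho b : R) :
  (forall v i, T v -> modulus (v i) <= b) -> polyfun g ->
  0 < theta -> 0 < rho -> phull T v0 -> theta < modulus (g v0) ->
  (forall v, phull T v -> cbox v0 rho v ->
     (exists j, rho / 2 <= modulus (v j - v0 j)) -> modulus (g v) < theta) ->
  (forall v, T v -> exists j, rho / 2 <= modulus (v j - v0 j)) -> False.
Proof.
move=> Tb /ev_polyfun[p Hp] th0 rho0; rewrite phullE Hp => Kv0 gv0 Hshell HT.
apply: (no_strict_peak ev_iota ev_x taylor _ th0 rho0 Kv0 gv0 _ HT).
- move=> q; have TU : bounded_coords T.
    move=> i; exists (`|b| + 1); first by have := normr_ge0 b; lra.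
    by move=> w /Tb Hw; apply: le_trans (Hw i) _; have := ler_norm b; lra.
  have [M M0 HM] := bounded_poly TU (polyfun_ev q); exists M => //; exact: ltW.
- by move=> v Kv vr vj; rewrite -Hp; apply: Hshell => //; rewrite phullE.
Qed.

End PeakPolyfun.

(** * Hermitian weights that make a maximum strict *)

Section Weights.
Context {R : realType} {N : nat}.
Local Notation C := (Cx R).
Implicit Types (v w : 'I_N -> C).

(** For e >= 0, Lagrange's identity for the vectors (1, sqrt e a) and (1, sqrt e b). *)
Lemma modulus_hermitian (e : R) (a b : C) :
  modulus (1 + RtoC e * a * Cconj b) ^+ 2 =
  (1 + e * modulus a ^+ 2) * (1 + e * modulus b ^+ 2) - e * modulus (a - b) ^+ 2.
Proof.
rewrite !modulus_sqr; case: a => a1 a2; case: b => b1 b2.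
by rewrite /CRe /CIm /=; ring.
Qed.

(** The values of the Hermitian kernel [peaking] on the diagonal; on bounded sets they tend to 1
    with [e]. *)
Definition weight (e : R) v : R := \prod_i (1 + e * modulus (v i) ^+ 2).

Lemma weight_ge1 e v : 0 <= e -> 1 <= weight e v.
Proof.
move=> e0; rewrite /weight; elim/big_ind: _ => // [a b a1 b1|i _].
  by rewrite -[1]mulr1 ler_pM.
by rewrite lerDl mulr_ge0// exprn_ge0// modulus_ge0.
Qed.

Lemma weight_le e b v : 0 <= e -> (forall i, modulus (v i) <= b) ->
  weight e v <= (1 + e * b ^+ 2) ^+ N.
Proof.
move=> e0 vb; rewrite -[N in X in _ <= X]card_ord -prodr_const; apply: ler_prod => i _.
have vb' : modulus (v i) ^+ 2 <= b ^+ 2.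
  by rewrite lerXn2r ?nnegrE ?modulus_ge0 ?vb//; apply: le_trans (vb i); exact: modulus_ge0.
by rewrite addr_ge0 ?mulr_ge0 ?exprn_ge0 ?modulus_ge0//= lerD2l ler_wpM2l.
Qed.

(* the factor of [g] which makes [v0] a strict peak *)
Definition peaking (e : R) v0 v : C := \prod_i (1 + RtoC e * v i * Cconj (v0 i)).

Lemma polyfun_peaking e v0 : polyfun (peaking e v0).
Proof.
apply: polyfun_prod => i; apply: polyfun_add; first exact: polyfun_cst.
apply: polyfun_mul; last exact: polyfun_cst.
by apply: polyfun_mul; [exact: polyfun_cst|exact: polyfun_coord].
Qed.

Lemma peaking_self e v0 : modulus (peaking e v0 v0) ^+ 2 = weight e v0 ^+ 2.
Proof.
rewrite /peaking modulus_prod -!prodrXl; apply: eq_bigr => i _.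
by rewrite modulus_hermitian subrr modulus0 expr0n mulr0 subr0 expr2.
Qed.

Lemma peaking_le e v0 v : 0 <= e ->
  modulus (peaking e v0 v) ^+ 2 <= weight e v * weight e v0.
Proof.
move=> e0; rewrite /peaking modulus_prod -prodrXl -big_split/=.
apply: ler_prod => i _; rewrite exprn_ge0 ?modulus_ge0//= modulus_hermitian gerBl.
by rewrite mulr_ge0// exprn_ge0// modulus_ge0.
Qed.

(** The j-th factor gains the term e |v_j - v0_j|^2, and the others obey the Cauchy-Schwarz
    inequality. So if |F|^2 [weight] is maximal at [v0], then |F [peaking]| has a strict peak
    there. *)
Lemma peaking_far e b v0 v (r : R) : 0 < e -> 0 <= r -> (forall i, modulus (v i) <= b) ->
  (forall i, modulus (v0 i) <= b) -> (exists j, r <= modulus (v j - v0 j)) ->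
  modulus (peaking e v0 v) ^+ 2 <=
    (1 - e * r ^+ 2 / (1 + e * b ^+ 2) ^+ 2) * (weight e v * weight e v0).
Proof.
move=> e0 r0 vb v0b [j vj]; rewrite /peaking modulus_prod -prodrXl -big_split/=.
rewrite (bigD1 j)//= [in leRHS](bigD1 j)//= mulrA.
have ge0 i : 0 <= (1 + e * modulus (v i) ^+ 2) * (1 + e * modulus (v0 i) ^+ 2).
  by rewrite mulr_ge0// addr_ge0// mulr_ge0 ?exprn_ge0 ?modulus_ge0// ltW.
apply: ler_pM; rewrite ?exprn_ge0 ?modulus_ge0//.
- by rewrite prodr_ge0// => i _; rewrite exprn_ge0 ?modulus_ge0.
- have b0 : 0 <= b := le_trans (modulus_ge0 _) (vb j).
  have Bp : 0 < 1 + e * b ^+ 2 by rewrite ltr_pwDl// mulr_ge0 ?exprn_ge0// ltW.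
  have sq (u : C) : modulus u <= b -> 1 + e * modulus u ^+ 2 <= 1 + e * b ^+ 2.
    by move=> ub; rewrite lerD2l ler_pM2l// lerXn2r ?nnegrE ?modulus_ge0.
  have pos (u : C) : 0 <= 1 + e * modulus u ^+ 2.
    by rewrite addr_ge0// mulr_ge0 ?exprn_ge0 ?modulus_ge0// ltW.
  have XB : (1 + e * modulus (v j) ^+ 2) * (1 + e * modulus (v0 j) ^+ 2) <=
      (1 + e * b ^+ 2) ^+ 2.
    by rewrite [leRHS]expr2; apply: ler_pM; rewrite ?pos ?sq.
  rewrite modulus_hermitian mulrBl mul1r lerD2l lerN2.
  apply: (@le_trans _ _ (e * r ^+ 2)).
    rewrite mulrAC ler_pdivrMr ?exprn_gt0//; apply: ler_wpM2l XB.
    by rewrite mulr_ge0 ?exprn_ge0// ltW.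
  by rewrite ler_pM2l// lerXn2r ?nnegrE ?modulus_ge0.
- apply: ler_prod => i _; rewrite exprn_ge0 ?modulus_ge0//= modulus_hermitian gerBl.
  by rewrite mulr_ge0 ?exprn_ge0 ?modulus_ge0//; exact: ltW.
Qed.

Lemma expr_near1 (a : R) n : 1 < a -> exists2 x, 0 < x & (1 + x) ^+ n <= a.
Proof.
elim: n a => [|n IH] a a1; first by exists 1 => //; rewrite expr0 ltW.
have [|x x0 Hx] := IH ((1 + a) / 2); first lra.
have a0 : 0 < (1 + a) / 2 by lra.
pose y := Num.min x ((a - 1) / (1 + a)).
have y0 : 0 < y by rewrite lt_min x0 divr_gt0//; lra.
have yx : y <= x by rewrite ge_min lexx.
have ya : y <= (a - 1) / (1 + a) by rewrite ge_min lexx orbT.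
exists y => //; rewrite exprS.
apply: (@le_trans _ _ (2 * a / (1 + a) * ((1 + a) / 2))).
  apply: ler_pM; rewrite ?exprn_ge0//; first lra. lra.
    rewrite (_ : 2 * a / (1 + a) = 1 + (a - 1) / (1 + a)); first by rewrite lerD2l.
    by field; apply: lt0r_neq0; lra.
  by apply: le_trans Hx; rewrite lerXn2r ?nnegrE; lra.
by rewrite le_eqVlt; apply/orP; left; apply/eqP; field; apply: lt0r_neq0; lra.
Qed.

End Weights.

(** * Bounding holomorphic functions over the polynomial hull *)

Section HullBound.
Context {R : realType} {S : comNzRingType} {Sg : grading S}.
Local Notation C := (Cx R).
Context {N : nat} {s : 'I_N -> S}.
Hypothesis es : embedding_sections Sg s.
Local Notation coordX := (Defs.coord R (line_deg Sg)).
Local Notation VX := (VX R Sg).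
Local Notation chart := (chart (s := s)).
Local Notation pos := (pos (s := s)).
Implicit Types (p q : coordX).

(** The map to the affine cone over X that contracts the zero section to the vertex. *)
Definition tpos p : 'I_N -> C := fun i => mu p * pos p i.

Lemma chart_inj p q : chart p = chart q -> \pi_VX p = \pi_VX q.
Proof.
move=> E; apply/total_eqP; apply: (pos_scale es (c := 1)); rewrite ?oner_neq0//.
  by move=> i; have := congr1 (@^~ (Some i)) E; rewrite /= mul1r => ->.
by have := congr1 (@^~ None) E; rewrite /= invr1 mul1r => ->.
Qed.

Lemma coord_relations y i m : relations (s := s) y -> y i != 0 ->
  exists p, pos p = y /\ mu p = m.
Proof.
move=> yR yi; have [p [py pm]] := coord_exists es yR yi m.
by exists p; split=> //; apply/funext.
Qed.

Lemma rescale p c : c != 0 -> exists q,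
  [/\ \pi_VX q = \pi_VX p, pos q = (fun i => c * pos p i) & mu q = c^-1 * mu p].
Proof.
move=> c0; have [i pi] := pos_neq0 es p.
have [|q [qy qm]] := coord_relations (i := i) (c^-1 * mu p) (relations_pos es p c).
  by rewrite mulf_neq0.
exists q; split=> //; apply/esym/total_eqP; apply: (pos_scale es c0) => //.
by move=> j; rewrite qy.
Qed.

Lemma normalize p : exists q, [/\ \pi_VX q = \pi_VX p, forall i, modulus (pos q i) <= 1,
  exists i, 1 <= modulus (pos q i) & tpos q = tpos p].
Proof.
have [i0 pi0] := pos_neq0 es p.
have [j Hj] : exists j, forall i, modulus (pos p i) <= modulus (pos p j).
  case: (@arg_maxP _ _ _ i0 xpredT (fun i => modulus (pos p i)) isT) => j _ Hj.
  by exists j => i; exact: Hj.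
have pj : 0 < modulus (pos p j) by apply: lt_le_trans (Hj i0); rewrite modulus_gt0.
have c0 : RtoC (modulus (pos p j))^-1 != 0.
  by rewrite -modulus_gt0 modulus_RtoC gtr0_norm invr_gt0.
have [q [qp qy qm]] := rescale p c0; exists q; split=> //.
- move=> i; rewrite qy modulusM modulus_RtoC_ge0 ?invr_ge0 ?modulus_ge0//.
  by rewrite mulrC ler_pdivrMr// mul1r.
- exists j; rewrite qy modulusM modulus_RtoC_ge0 ?invr_ge0 ?modulus_ge0//.
  by rewrite mulVf// gt_eqF.
- by apply/funext => i; rewrite /tpos qm qy mulrACA mulVf// mul1r.
Qed.

Variables (T : set VX) (b : R).
Hypothesis T0 : zero_section `<=` T.

Definition cone : set ('I_N -> C) := [set v | exists2 p, T (\pi_VX p) & v = tpos p].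

Hypotheses (b0 : 0 <= b) (Tb : forall v i, cone v -> modulus (v i) <= b).
Local Notation K := (phull cone).

Lemma sub_phull : cone `<=` K.
Proof. by move=> v Tv h M _ _; apply. Qed.

Lemma phull_le v i : K v -> modulus (v i) <= b.
Proof.
by move=> Kv; apply: (Kv (fun v => v i)) => //; [exact: polyfun_coord|move=> w /Tb].
Qed.

(** The affine cone is cut out by polynomials, so it contains the polynomial hull of each of its
    subsets. *)
Lemma phull_relations v : K v -> relations (s := s) v.
Proof.
move=> Kv P P0; apply/eqP; rewrite -modulus_eq0 eq_le modulus_ge0 andbT.
apply: (Kv (fun v => peval v P)) => //.
  by apply: (polyfun_peval (f := fun i w => w i)) => i; exact: polyfun_coord.
by move=> _ [p _ ->]; rewrite (relations_pos es p (mu p) P0) modulus0.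
Qed.

(** Charts of the points above the hull, scaled so that the largest homogeneous coordinate has
    modulus 1. This set is closed and bounded, and it keeps apart the points above the vertex, which
    [tpos] identifies. *)
Definition normalized : set (option 'I_N -> C) :=
  [set w | relations (s := s) (fun i => w (Some i))] `&`
  ([set w | forall i, modulus (w (Some i)) <= 1] `&`
  ([set w | exists i, 1 <= modulus (w (Some i))] `&`
   [set w | K (fun i => w None * w (Some i))])).

Lemma normalized_closed : seq_closed normalized.
Proof.
have coordc o (w : option 'I_N -> C) : fcont (fun w => w o) w.
  by apply: fcont_poly; exact: polyfun_coord.
apply: seq_closedI; last apply: seq_closedI; last apply: seq_closedI.
- move=> w /existsNP[P /not_implyP[P0 wP]].
  have [||e e0 He] := @seq_closed_le R _ (fun w => peval (fun i => w (Some i)) P) 0 _ w.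
  + move=> u; apply: fcont_poly.
    by apply: (polyfun_peval (f := fun i w => w (Some i))) => i; exact: polyfun_coord.
  + by move=> /=; rewrite le_eqVlt ltNge modulus_ge0 orbF modulus_eq0 => /eqP.
  + by exists e => // u /He H uR; apply: H; rewrite /= uR// modulus0.
- by apply: seq_closed_bigcap => i; apply: seq_closed_le => w.
- by apply: seq_closed_ex => i w.
- move=> w /existsNP[h /existsNP[M /not_implyP[ph /not_implyP[M0 /not_implyP[HM wM]]]]].
  have [||e e0 He] := @seq_closed_le R _ (fun w => h (fun i => w None * w (Some i))) M _ w.
  + move=> u; apply: fcont_poly.
    apply: (polyfun_comp (f := fun i w => w None * w (Some i))) => // i.
    by apply: polyfun_mul; exact: polyfun_coord.
  + by [].
  + by exists e => // u /He H uK; apply: H; exact: uK.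
Qed.

Lemma normalized_coord w : normalized w -> exists p, chart p = w.
Proof.
move=> [wR [_ [[i wi] _]]].
have [|p [py pm]] := coord_relations (i := i) (w None) wR.
  by rewrite -modulus_gt0; apply: lt_le_trans wi.
by exists p; apply/funext => -[j|] //=; rewrite py.
Qed.

Lemma fcont_approx (J : finType) (f : (J -> C) -> C) w0 r : 0 < r ->
  poly_approx (cbox w0 r) f -> fcont f w0.
Proof.
move=> r0 fa d /(approx_cont r0 fa)[n n0 [_ Hn]]; by exists n.
Qed.

Section Maximum.
Variables (F : VX -> C) (p1 : coordX) (e : R).
Hypotheses (holF : holomorphic F) (Kp1 : K (tpos p1)).

(** Every point above the hull has a normalized chart, and by [local_approx] the weighted function
    is continuous in the chart, so [compact_max] applies. *)
Lemma weighted_max : exists2 p0, K (tpos p0) & forall p, K (tpos p) ->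
  modulus (F (\pi_VX p)) ^+ 2 * weight e (tpos p) <=
  modulus (F (\pi_VX p0)) ^+ 2 * weight e (tpos p0).
Proof.
(* A point with chart [w]; the default [p1] only occurs for [w] that are not charts. *)
pose pt w := xget p1 [set p | chart p = w].
have ptE p : \pi_VX (pt (chart p)) = \pi_VX p.
  by apply: chart_inj; apply: (xgetPex p1 (P := [set q | chart q = chart p])); exists p.
pose phi w := modulus (F (\pi_VX (pt w))) ^+ 2 * weight e (fun i => w None * w (Some i)).
have chart_norm p : K (tpos p) -> exists q, [/\ normalized (chart q),
    \pi_VX q = \pi_VX p & tpos q = tpos p].
  have [q [qp q1 q2 qt]] := normalize p; rewrite -qt => Kq; exists q; split=> //.
  split; last by split=> //; split.
  move=> P P0; have := relations_pos es q 1 P0; congr (_ = _); congr peval.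
  by apply/funext => i; rewrite mul1r.
have [w0 w0n Hmax] : exists2 w, normalized w & forall w', normalized w' -> phi w' <= phi w.
  apply: (compact_max (B := b + 1)).
  - by have [q [qn _ _]] := chart_norm _ Kp1; exists (chart q).
  - move=> w o [_ [w1 [[i wi] /phull_le Hw]]]; have b1 : b <= b + 1 by rewrite lerDl.
    case: o => [j|]; first by apply: le_trans (w1 j) _; rewrite lerDr; exact: b0.
    apply: le_trans b1; apply: le_trans (Hw i).
    by rewrite modulusM ler_peMr ?modulus_ge0.
  - exact: normalized_closed.
  - move=> w t wn wt; have [p pw] := normalized_coord wn.
    have [r r0 [f [fa fE]]] := local_approx es p holF; rewrite pw in fa fE.
    have fw : fcont f w := fcont_approx r0 fa.
    pose u i (w : option 'I_N -> C) := RtoC (modulus (w None * w (Some i))).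
    pose g w := RtoC (modulus (f w)) * RtoC (modulus (f w)) *
      \prod_(i < N) (1 + RtoC e * (u i w * u i w)).
    have gE w' : g w' = RtoC (modulus (f w') ^+ 2 * weight e (fun i => w' None * w' (Some i))).
      rewrite rmorphM expr2 rmorphM; congr (_ * _); rewrite rmorph_prod.
      by apply: eq_bigr => i _; rewrite rmorphD rmorph1 rmorphM expr2 rmorphM.
    have gw : fcont g w.
      apply: fcontM; first by apply: fcontM; exact: fcont_modulus.
      apply: fcont_prod => i; apply: fcontD; first by apply: fcont_poly; exact: polyfun_cst.
      apply: fcontM; first by apply: fcont_poly; exact: polyfun_cst.
      by apply: fcontM; apply: fcont_modulus; apply: fcontM; apply: fcont_poly; exact: polyfun_coord.
    have phiE w' : normalized w' -> cbox w r w' -> RtoC (phi w') = g w'.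
      move=> /normalized_coord[q <-] qw; rewrite gE; congr RtoC.
      by rewrite /phi ptE fE.
    have [|n n0 Hn] := gw ((t - phi w) / 2); first by rewrite divr_gt0// subr_gt0.
    exists (Num.min n r); first by rewrite lt_min n0.
    move=> w' w'n ww'.
    have w'r : cbox w r w' by move=> j; apply: le_trans (ww' j) _; rewrite ge_min lexx orbT.
    have wr : cbox w r w by move=> j; rewrite subrr modulus0 ltW.
    have := Hn w' (fun j => le_trans (ww' j) (le_trans (_ : Num.min n r <= n) (lexx n))).
    rewrite -phiE// -phiE// -rmorphB modulus_RtoC => /(_ _)H.
    have {}H : `|phi w' - phi w| <= (t - phi w) / 2 by apply: H; rewrite ge_min lexx.
    have := ler_norm (phi w' - phi w); move: wt H; lra.
have [p0 p0w] := normalized_coord w0n; exists p0.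
  by case: w0n => [_ [_ [_]]]; rewrite -p0w.
move=> p /chart_norm[q [qn <- <-]]; have := Hmax _ qn.
by rewrite -p0w /phi !ptE.
Qed.

End Maximum.

End HullBound.

Section Rossi.
Context {R : realType} {S : comNzRingType} {Sg : grading S}.
Local Notation C := (Cx R).
Context {N : nat} {s : 'I_N -> S}.
Hypothesis es : embedding_sections Sg s.
Local Notation coordX := (Defs.coord R (line_deg Sg)).
Local Notation VX := (VX R Sg).
Local Notation chart := (chart (s := s)).
Local Notation pos := (pos (s := s)).
Local Notation tpos := (tpos (s := s)).
Implicit Types (p q : coordX).

(** Suppose |F| > M at a point above the hull. At a maximum [p0] of |F|^2 [weight] one still has |F|
    > M, the weight being close to 1, so [p0] is not in the zero section. Scaled to mu = 1, it has
    the chart (v0, 1); so near v0 the function F depends on v = tpos alone, and it is a uniform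
    limit of polynomials in v. Its product with [peaking] has a strict peak at v0 on the hull, and
    the cone of [T] stays away from v0, where |F| > M. A polynomial close to the product contradicts
    [no_peak]. *)
Theorem hull_bound (T : set VX) (b : R) (F : VX -> C) (M : R) :
  zero_section `<=` T -> 0 <= b ->
  (forall v i, cone (s := s) T v -> modulus (v i) <= b) ->
  holomorphic F -> 0 <= M -> (forall z, T z -> modulus (F z) <= M) ->
  forall p, phull (cone (s := s) T) (tpos p) -> modulus (F (\pi_VX p)) <= M.
Proof.
move=> T0 b0 Tb holF M0 FM p1 Kp1; rewrite leNgt; apply/negP => MA.
pose A1 := modulus (F (\pi_VX p1)); rewrite -/A1 in MA.
pose M1 := (M + A1) / 2.
have [M10 [MM1 M1A]] : 0 < M1 /\ M < M1 /\ M1 < A1 by rewrite /M1; lra.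
have a1 : 1 < (A1 / M1) ^+ 2.
  by rewrite -[1](expr1n _ 2%N) ltr_pXn2r// ?nnegrE ?divr_ge0 ?ltr_pdivlMr ?mul1r//; lra.
have [x x0 Hx] := expr_near1 N a1.
(* So small that the weight is at most (A1 / M1)^2 on the hull; hence |F| is still at least M1 > M
   at the weighted maximum. *)
have [e e0 eb] : exists2 e, 0 < e & e * b ^+ 2 <= x.
  have b1 : 0 < b ^+ 2 + 1 by rewrite ltr_wpDl ?exprn_ge0.
  exists (x / (b ^+ 2 + 1)); first by rewrite divr_gt0.
  by rewrite mulrAC ler_pdivrMr// ler_pM2l// lerDl.
have [p0 Kp0 Hmax] := @weighted_max _ _ _ _ _ es T b b0 Tb F p1 e holF Kp1.
set K := phull _ in Kp1 Kp0 Hmax.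
have Kb v i : K v -> modulus (v i) <= b := phull_le b0 Tb i.
have wK v : K v -> weight e v <= (1 + e * b ^+ 2) ^+ N.
  by move=> Kv; apply: weight_le => [|i]; [exact: ltW|exact: Kb].
have w1 (v : 'I_N -> C) : 1 <= weight e v by apply: weight_ge1; exact: ltW.
have Fp0 : M1 <= modulus (F (\pi_VX p0)).
  have H1 : A1 ^+ 2 <= modulus (F (\pi_VX p0)) ^+ 2 * (A1 / M1) ^+ 2.
    apply: (@le_trans _ _ (A1 ^+ 2 * weight e (tpos p1))).
      by rewrite ler_peMr// exprn_ge0// modulus_ge0.
    apply: le_trans (Hmax _ Kp1) _; apply: ler_wpM2l; first by rewrite exprn_ge0// modulus_ge0.
    apply: le_trans (wK _ Kp0) _; apply: le_trans Hx.
    rewrite lerXn2r ?nnegrE ?addr_ge0 ?mulr_ge0 ?exprn_ge0 ?(ltW e0) ?(ltW x0)//.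
    by rewrite lerD2l.
  have A0 : 0 < A1 by lra.
  have H2 : M1 ^+ 2 <= modulus (F (\pi_VX p0)) ^+ 2.
    by move: H1; rewrite expr_div_n mulrA ler_pdivlMr ?exprn_gt0// [A1 ^+ 2 * _]mulrC ler_pM2r ?exprn_gt0.
  by move: H2; rewrite ler_pXn2r ?nnegrE ?modulus_ge0 ?(ltW M10).
have mp0 : mu p0 != 0.
  apply/eqP => m0; suff : modulus (F (\pi_VX p0)) <= M by lra.
  by apply: FM; apply: T0; exists p0.
have [p2 [p20 posp2 mup2]] := rescale es p0 mp0.
pose v0 := tpos p0.
have {}posp2 : pos p2 = v0 by [].
have {}mup2 : mu p2 = 1 by rewrite mup2 mulVf.
have [i0 v00] : exists i, v0 i != 0.
  by have [i pi] := pos_neq0 es p2; rewrite posp2 in pi; exists i.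
have [r r0 [f [fa fE]]] := local_approx es p2 holF.
(* the point of the bundle above [v], for [v] near [v0] *)
pose ext v (o : option 'I_N) : C := if o is Some i then v i else 1.
have chart2 : chart p2 = ext v0 by apply/funext => -[i|] //=; rewrite -posp2.
rewrite chart2 in fa fE.
pose f' v := f (ext v).
have polye o : polyfun (fun v : 'I_N -> C => ext v o).
  by case: o => [i|]; [exact: polyfun_coord|exact: polyfun_cst].
have ext_cbox n v : cbox v0 n v -> 0 <= n -> cbox (ext v0) n (ext v).
  by move=> vn n0 [i|]; [exact: vn|rewrite /= subrr modulus0].
have f'a : poly_approx (cbox v0 r) f'.
  move=> d /fa[h ph Hh]; exists (fun v => h (ext v)).
    exact: (polyfun_comp (f := fun o v => ext v o)).
  by move=> v vr; apply: Hh; apply: ext_cbox => //; exact: ltW.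
have ptv v : K v -> v i0 != 0 -> exists p, [/\ tpos p = v & chart p = ext v].
  move=> /(phull_relations es) vR vi; have [p [pv pm]] := coord_relations es (i := i0) 1 vR vi.
  exists p; split; first by apply/funext => i; rewrite /tpos pm mul1r pv.
  by apply/funext => -[i|] /=; rewrite ?pv.
have f'E v p : cbox v0 r v -> chart p = ext v -> f' v = F (\pi_VX p).
  by move=> vr pv; rewrite fE pv//; apply: ext_cbox => //; exact: ltW.
have f'0 : f' v0 = F (\pi_VX p0).
  rewrite (@f'E v0 p2)// ?p20// => j; rewrite subrr modulus0; exact: ltW.
(* a box around [v0] where [f'] is large and v_i0 is not zero *)
have [rho rho0 [rhor [f'M vi0]]] : exists2 rho, 0 < rho & rho <= r /\
    (forall v, cbox v0 rho v -> M < modulus (f' v)) /\ (forall v, cbox v0 rho v -> v i0 != 0).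
  have [|n n0 [nr Hn]] := approx_cont r0 f'a (d := (modulus (F (\pi_VX p0)) - M) / 2).
    by rewrite divr_gt0// subr_gt0; lra.
  exists (Num.min n (modulus (v0 i0) / 2)); first by rewrite lt_min n0 divr_gt0// modulus_gt0.
  split; first by rewrite ge_min nr.
  split=> v vn.
    have H : modulus (f' v - F (\pi_VX p0)) <= (modulus (F (\pi_VX p0)) - M) / 2.
      by rewrite -{1}f'0; apply: Hn => j; apply: le_trans (vn j) _; rewrite ge_min lexx.
    by have := modulus_lb (F (\pi_VX p0)) (f' v); rewrite modulusBC; lra.
  have := vn i0; rewrite le_min => /andP[_ H]; rewrite -modulus_gt0.
  have := modulus_lb (v0 i0) (v i0); rewrite modulusBC.
  by have : 0 < modulus (v0 i0) by [rewrite modulus_gt0]; lra.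
have rhoB n v : n <= r -> cbox v0 n v -> cbox v0 r v.
  by move=> nr vn j; apply: le_trans (vn j) nr.
pose g1 v := f' v * peaking e v0 v.
have g1a : poly_approx (cbox v0 rho) g1.
  have BU := bounded_cbox v0 rho.
  have fa' : poly_approx (cbox v0 rho) f' by apply: approx_sub f'a => v; exact: rhoB.
  have pa : poly_approx (cbox v0 rho) (peaking e v0) by apply: approx_poly; exact: polyfun_peaking.
  by apply: approxM => //; exact: bounded_approx.
pose A0 := modulus (F (\pi_VX p0)) ^+ 2 * weight e v0.
pose G := modulus (g1 v0).
have GE : G ^+ 2 = A0 * weight e v0.
  by rewrite /G /g1 modulusM exprMn peaking_self f'0 /A0 expr2 mulrA.
have G0 : 0 < G.
  rewrite /G modulusM mulr_gt0//; first by rewrite f'0; lra.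
  rewrite modulus_gt0; apply/eqP => z0; have := peaking_self e v0.
  rewrite z0 modulus0 expr0n => /esym/eqP; rewrite expf_eq0 /= => /eqP w0.
  by have := w1 v0; rewrite w0 ler10.
have le_A0 v : K v -> cbox v0 rho v -> modulus (f' v) ^+ 2 * weight e v <= A0.
  move=> Kv vr; have [p [pv pc]] := ptv v Kv (vi0 v vr).
  by have := Hmax p; rewrite pv (f'E v p (rhoB _ _ rhor vr) pc) => /(_ Kv).
pose kap := 1 - e * (rho / 2) ^+ 2 / (1 + e * b ^+ 2) ^+ 2.
have kap1 : kap < 1.
  have B0 : 0 < 1 + e * b ^+ 2 by rewrite ltr_pwDl// mulr_ge0 ?exprn_ge0// ltW.
  rewrite /kap gtrBl; apply: divr_gt0; last by rewrite exprn_gt0.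
  by apply: mulr_gt0 => //; rewrite exprn_gt0// divr_gt0.
have shell v : K v -> cbox v0 rho v -> (exists j, rho / 2 <= modulus (v j - v0 j)) ->
    modulus (g1 v) ^+ 2 <= kap * G ^+ 2.
  move=> Kv vr vj; rewrite /g1 modulusM exprMn GE.
  have H := @peaking_far R N e b v0 v (rho / 2) e0 _ (fun i => Kb v i Kv) (fun i => Kb v0 i Kp0) vj.
  have {}H := H ltac:(lra); rewrite -/kap in H.
  have f2 : 0 <= modulus (f' v) ^+ 2 by rewrite exprn_ge0 ?modulus_ge0.
  apply: le_trans (ler_wpM2l f2 H) _.
  have [k0|k0] := leP 0 kap; last first.
    have H2 : 0 <= kap * (weight e v * weight e v0).
      by apply: le_trans H; rewrite exprn_ge0 ?modulus_ge0.
    have H3 : 0 < weight e v * weight e v0.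
      by apply: mulr_gt0; apply: lt_le_trans (w1 _).
    by move: H2; rewrite nmulr_rge0// leNgt H3.
  rewrite mulrCA ler_wpM2l// mulrA ler_wpM2r//; first by apply: le_trans (w1 _).
  exact: le_A0.
(* [kap] bounds a ratio of squares and may be negative; kap' lies strictly between 0 and 1, and kap
   <= kap'^2. *)
pose kap' := (1 + Num.max kap 0) / 2.
have km1 : Num.max kap 0 < 1 by rewrite gt_max kap1 ltr01.
have km0 : 0 <= Num.max kap 0 by rewrite le_max lexx orbT.
have kapm : kap <= Num.max kap 0 by rewrite le_max lexx.
have kap'1 : kap' < 1 by rewrite /kap'; lra.
have kap'0 : 0 < kap' by rewrite /kap'; lra.
have kapk : kap <= kap' ^+ 2.
  apply: le_trans kapm _; rewrite /kap'; move: (Num.max _ _) => k.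
  by have := sqr_ge0 (1 - k); rewrite !expr2; lra.
have shell' v : K v -> cbox v0 rho v -> (exists j, rho / 2 <= modulus (v j - v0 j)) ->
    modulus (g1 v) <= kap' * G.
  move=> Kv vr vj; have kG : 0 <= kap' * G by apply: mulr_ge0; exact: ltW.
  rewrite -(ler_pXn2r (n := 2)) ?nnegrE ?modulus_ge0//.
  apply: le_trans (shell v Kv vr vj) _; rewrite exprMn; apply: ler_wpM2r kapk.
  by rewrite exprn_ge0// ltW.
(* An eighth of the gap between the bound kap' G on the shell and the peak value G, so that a
   polynomial within [d] still lies on the right sides of the midpoint. *)
pose d := (1 - kap') * G / 8.
have d0 : 0 < d by rewrite divr_gt0// mulr_gt0// subr_gt0.
have [g pg Hg] := g1a d d0.
have v0r : cbox v0 rho v0 by move=> j; rewrite subrr modulus0 ltW.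
have th0 : 0 < (kap' + 1) / 2 * G by apply: mulr_gt0 => //; lra.
have [u uE] : exists u, u = kap' * G by exists (kap' * G).
have uG : u < G by rewrite uE gtr_pMl.
have thE : (kap' + 1) / 2 * G = (u + G) / 2 by rewrite uE; ring.
have dE : d = (G - u) / 8 by rewrite uE /d; ring.
apply: (@no_peak R N (cone (s := s) T) v0 g _ rho b Tb pg th0 rho0 Kp0).
- rewrite thE; have := modulus_lb (g1 v0) (g v0); have := Hg v0 v0r; rewrite dE -/G.
  by clear -uG; lra.
- move=> v Kv vr vj; rewrite thE; have := shell' v Kv vr vj; have := Hg v vr.
  have := modulus_lb (g v) (g1 v); rewrite modulusBC dE -uE.
  by clear -uG; lra.
- move=> v Tv; apply: contrapT => /forallNP H.
  have vr : cbox v0 rho v.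
    by move=> j; have /negP := H j; rewrite -ltNge => /ltW h; apply: le_trans h _; lra.
  have Kv : K v := sub_phull Tv.
  have [p [pv pc]] := ptv v Kv (vi0 v vr).
  have := f'M v vr; rewrite (f'E v p (rhoB _ _ rhor vr) pc) ltNge => /negP; apply.
  apply: FM; have [q Tq vq] := Tv.
  have mq : mu q != 0.
    by apply/eqP => m0; move: (vi0 v vr); rewrite vq /tpos m0 mul0r eqxx.
  have [q' [q'q q'y q'm]] := rescale es q mq.
  rewrite (_ : \pi_VX p = \pi_VX q) // -q'q; apply: (chart_inj es).
  rewrite pc; apply/funext => -[i|] /=; last by rewrite q'm mulVf.
  by rewrite q'y vq.
Qed.

End Rossi.

(** * Boundedness of the cone over a compact tube *)

Section ConeBounded.
Context {R : realType} {S : comNzRingType} {Sg : grading S}.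
Local Notation C := (Cx R).
Context {N : nat} {s : 'I_N -> S}.
Hypothesis es : embedding_sections Sg s.
Local Notation coordX := (Defs.coord R (line_deg Sg)).
Local Notation VX := (VX R Sg).
Local Notation pos := (pos (s := s)).
Local Notation tpos := (tpos (s := s)).
Implicit Types (p q : coordX).

Lemma tpos_continuous i : continuous (fun p : coordX => tpos p i).
Proof.
have c_fun : continuous (fun p : coordX => coord_fun p) by exact: initial_continuous.
have c1 : continuous (fun p : coordX => (coord_fun p).1).
  by move=> p; apply: (@continuous_comp _ _ _ (fun p : coordX => coord_fun p) fst p (c_fun p)); exact: cvg_fst.
have c2 : continuous (fun p : coordX => (coord_fun p).2).
  by move=> p; apply: (@continuous_comp _ _ _ (fun p : coordX => coord_fun p) snd p (c_fun p)); exact: cvg_snd.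
have c3 : continuous (fun p : coordX => pos p i).
  move=> p; apply: (@continuous_comp _ _ _ (fun p : coordX => (coord_fun p).1)
    (@proj S (fun=> C) (s i)) p (c1 p)).
  exact: proj_continuous.
by move=> p; exact: (cvgM (c2 p) (c3 p)).
Qed.

Lemma tpos_same p q : \pi_VX p = \pi_VX q -> tpos p = tpos q.
Proof.
move=> /total_eqP[l [l0 lD lm]]; apply/funext => i; rewrite /tpos lm /pos.
rewrite (lD (fun=> 1%N)) ?big_ord1; last exact: emb_deg1 es i.
rewrite /character big_ord1 expr1.
have := l0 ord0; move: (l ord0) => c c0.
by rewrite mulrACA mulVf// mul1r.
Qed.

Definition tposV (z : VX) : 'I_N -> C := tpos (repr z).

Lemma tposVE p : tposV (\pi_VX p) = tpos p.
Proof. by apply: tpos_same; rewrite reprK. Qed.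

Lemma tposV_continuous i : continuous (fun z : VX => tposV z i).
Proof.
apply: (@repr_comp_continuous _ _ _ (fun p : coordX => tpos p i)).
  exact: tpos_continuous.
by move=> p q /eqP/tpos_same ->.
Qed.

Lemma cone_bounded (T : set VX) : compact T ->
  exists2 b, 0 <= b & forall v i, cone (s := s) T v -> modulus (v i) <= b.
Proof.
move=> cT; apply: contrapT => H.
pose F := filter_from [set: nat] (fun n => [set z | T z /\ exists i, n%:R < modulus (tposV z i)]).
have PF : ProperFilter F.
  apply: filter_from_proper.
    apply: filter_from_filter; first by exists 0%N.
    move=> n m _ _; exists (maxn n m) => // z [Tz [i zi]].
    by split; split=> //; exists i; apply: le_lt_trans zi; rewrite ler_nat ?leq_maxl ?leq_maxr.
  move=> n _; apply: contrapT => nz; apply: H; exists n%:R => // _ i [p Tp ->].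
  rewrite leNgt; apply/negP => np; apply: nz; exists (\pi_VX p); split=> //.
  by exists i; rewrite tposVE.
have [|z [Tz zF]] := cT F PF; first by exists 0%N => // w [].
pose U := [set w | forall i, modulus (tposV z i - tposV w i) < 1].
have Uz : nbhs z U.
  suff H1 i : \forall w \near z, modulus (tposV z i - tposV w i) < 1.
    by apply: (@filter_forall VX _ (fun i w => modulus (tposV z i - tposV w i) < 1) (nbhs z) _ H1).
  have c01 : 0 < (1 : C) by [].
  have /cvgrPdist_lt/(_ _ c01) := @tposV_continuous i z.
  by apply: filterS => w /=; rewrite -[1 : C](rmorph1 RtoC) normc_lt.
pose n := Num.Def.archi_bound (\sum_i modulus (tposV z i) + 1).
have Hn : \sum_i modulus (tposV z i) + 1 < n%:R.
  by apply: archi_boundP; rewrite addr_ge0// sumr_ge0// => i _; exact: modulus_ge0.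
have Fn : F [set w | T w /\ exists i, n%:R < modulus (tposV w i)] by exists n.
have [w [[_ [i wi]] Uw]] := zF _ _ Fn Uz.
have := Uw i; have := modulus_lb (tposV w i) (tposV z i); rewrite modulusBC.
have : modulus (tposV z i) <= \sum_i modulus (tposV z i).
  by rewrite (bigD1 i)//= lerDl sumr_ge0// => j _; exact: modulus_ge0.
by move: Hn wi; lra.
Qed.

End ConeBounded.

(** * The fibre of the deformation over 1 *)

Section FiberOne.
Context {R : realType} {S : comNzRingType}.
Variables (Sg : grading S) (I : ideal S).
Local Notation C := (Cx R).
Hypothesis hI : hyperplane_section Sg I.
Local Notation coordX := (Defs.coord R (line_deg Sg)).
Local Notation coordD := (Defs.coord R (@defo_deg S I Sg)).
Local Notation VX := (VX R Sg).
Local Notation VD := (VD Sg I).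
Local Notation cst := (cox_cst I).
Local Notation t := (cox_t I).
Local Notation u := (cox_u I).

Lemma ideal_powSI l a : ideal_pow I l.+1 a -> I a.
Proof.
move=> [m [x [y [xy ->]]]]; elim/big_ind: _ => [||j _]; [exact: ideal_0|exact: ideal_D|].
by rewrite mulrC; apply: ideal_M; have [] := xy j.
Qed.

(** [I] is generated in degree 1, so an element of it has no component of degree 0. *)
Lemma ideal_piece0 a : I a -> Sg 0%N a -> a = 0.
Proof.
move=> Ia a0; have [m [b [x [xI aE]]]] := hyp_degree1 hI Ia.
have [n [c [cS cE]]] : exists n (c : 'I_m -> nat -> S),
    (forall j k, Sg k (c j k)) /\ forall j, b j = \sum_(k < n) c j k.
  have H j : exists nc : nat * (nat -> S), (forall k, Sg k (nc.2 k)) /\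
      b j = \sum_(k < nc.1) nc.2 k.
    by have [n [c Hc]] := piece_span Sg (b j); exists (n, c).
  pose f j := sval (cid (H j)); have Hf j := svalP (cid (H j)); rewrite -/(f _) in Hf.
  pose n := (\max_j (f j).1)%N.
  exists n, (fun j k => if (k < (f j).1)%N then (f j).2 k else 0); split.
    by move=> j k; case: ifP => _; [have [] := Hf j|exact: piece0].
  move=> j; have [_ ->] := Hf j.
  have fn : ((f j).1 <= n)%N by exact: (leq_bigmax j).
  rewrite (big_ord_widen n (fun k => (f j).2 k) fn) [LHS]big_mkcond.
  by apply: eq_bigr => k _.
(* A family with sum 0: [a] in degree 0, and in degree k' + 1 minus the products of the components
   of degree k' with the generators. *)
pose d k := if k is k'.+1 then - \sum_j c j k' * x j else a.
have dS k : Sg k (d k).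
  case: k => [|k] //=; rewrite -sub0r; apply: pieceB; first exact: piece0.
  by apply: piece_sum => j _; rewrite -addn1; apply: pieceM => //; have [] := xI j.
apply: (piece_direct dS (n := n.+1) _ (k := 0%N)) => //.
rewrite big_ord_recl /= aE; under [in X in X + _]eq_bigr do rewrite cE mulr_suml.
by rewrite exchange_big/= sumrN subrr.
Qed.

Section Points.
Variable q : coordD.
Hypothesis qut : ev q u = ev q t.

(** Since u = v t, the monomial v^i t^d times t^n is u^i t^(n-i+d). The factor t^n serves for i > d,
    where v^i t^d alone is not a monomial in u and t. *)
Lemma defo_expand (P : coxring I) (d : nat) :
  (forall i j, j != d -> coef2 P i j = 0) -> exists n, P * t ^+ n =
    \sum_(i < n) cst (coef2 P i d) * u ^+ i * t ^+ (n - i + d).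
Proof.
move=> Pd; pose Pv : {poly {poly S}} := val P; pose n := size Pv`_d; exists n; apply: val_inj.
have PE : Pv = (Pv`_d)%:P * 'X ^+ d.
  apply/polyP => j; rewrite coefCM coefXn; case: eqP => [->|/eqP jd]; first by rewrite mulr1.
  by rewrite mulr0; apply/polyP => i; rewrite coef0; exact: Pd.
have dE : Pv`_d = \sum_(i < n) (coef2 P i d)%:P * 'X ^+ i.
  transitivity (\sum_(i < n) (Pv`_d)`_i *: 'X^i); first by rewrite -poly_def coefK.
  by apply: eq_bigr => i _; rewrite -mul_polyC.
transitivity (Pv * 'X ^+ n); first by rewrite [LHS]rmorphM [X in _ * X]rmorphXn.
transitivity (\sum_(i < n) ((coef2 P i d)%:P * 'X ^+ i)%:P * 'X ^+ d * 'X ^+ n).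
  by rewrite {1}PE {1}dE rmorph_sum !mulr_suml.
rewrite [RHS]rmorph_sum; apply: eq_bigr => i _; move: (coef2 P i d) => a.
transitivity (a%:P%:P * ('X%:P * 'X) ^+ i * 'X ^+ (n - i + d) : {poly {poly S}}); last first.
  by rewrite 2!rmorphM !rmorphXn.
rewrite exprMn -rmorphXn rmorphM /= -!mulrA; congr (_ * (_ * _)).
by rewrite -!exprD addnA subnKC ?(ltnW (ltn_ord i))// addnC.
Qed.

Lemma cst_is_zmod : zmod_morphism cst.
Proof. by move=> a b; apply: val_inj; rewrite /= !rmorphB. Qed.

Lemma cst_is_monoid : monoid_morphism cst.
Proof. by split=> [|a b]; apply: val_inj; rewrite /= ?rmorph1 ?rmorphM. Qed.

HB.instance Definition _ := GRing.isZmodMorphism.Build S (coxring I) cst cst_is_zmod.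
HB.instance Definition _ := GRing.isMonoidMorphism.Build S (coxring I) cst cst_is_monoid.

(** Where u = t, every term of [defo_expand] acquires the same factor t^(n+d), and the coefficients
    add up to the value of [P] at v = t = 1. *)
Lemma ev_cox_at1 (P : coxring I) (d : nat) : ev q t != 0 ->
  (forall i j, j != d -> coef2 P i j = 0) ->
  ev q P = ev q t ^+ d * ev q (cst (cox_at1 I P)).
Proof.
move=> t0 Pd; have [n Hn] := defo_expand Pd.
have fP : cox_at1 I P = \sum_(i < n) coef2 P i d.
  have := congr1 (cox_at1 I) Hn.
  move: (cox_at1 I) (cox_at1_cst I) (cox_at1_t I) (cox_at1_u I) => f fc ft fu.
  rewrite rmorphM rmorphXn ft expr1n mulr1 => ->; rewrite rmorph_sum.
  by apply: eq_bigr => i _; rewrite !rmorphM !rmorphXn ft fu fc !expr1n !mulr1.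
have tn : ev q t ^+ n != 0 by rewrite expf_neq0.
apply: (mulIf tn); rewrite -rmorphXn -rmorphM Hn fP !rmorph_sum mulr_sumr mulr_suml.
apply: eq_bigr => i _; rewrite !rmorphM !rmorphXn qut -mulrA -exprD.
by rewrite addnA subnKC ?(ltnW (ltn_ord i))// exprD; ring.
Qed.

(** In degree (0, 1) the coefficient of v^i t for i > 1 lies both in [I] and in degree 0, hence
    vanishes. Such elements are therefore c0 t + c1 u, and all of them would be 0 at a point where t
    = u = 0. *)
Lemma fiber1_t_neq0 : ev q t != 0.
Proof.
apply/eqP => t0; have [P DP /eqP] := semistable q ord_max; apply.
have Pj i j : j != 1%N -> coef2 P i j = 0.
  by move=> j1; have := DP i j; rewrite (_ : unit_degree _ _ = 1%N)// (negbTE j1).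
have Pi i : (1 < i)%N -> coef2 P i 1 = 0.
  case: i => [|[|i]]// _; apply: ideal_piece0.
    by have /reesP/(_ i.+2 1%N)/ideal_powSI := valP P.
  exact: (DP i.+2 1%N).
have -> : P = cst (coef2 P 0 1) * t + cst (coef2 P 1 1) * u.
  apply: val_inj; apply/polyP => j; apply/polyP => i.
  rewrite [LHS]/(coef2 P i j).
  transitivity ((((coef2 P 0 1)%:P + (coef2 P 1 1)%:P * 'X)%:P * 'X : {poly {poly S}})`_j`_i);
    last first.
    congr ((fun Q : {poly {poly S}} => (Q`_j : {poly S})`_i) _).
    by rewrite polyCD polyCM mulrDl -mulrA.
  rewrite coefMX; case: j => [|[|j]] /=.
  - by rewrite coef0; exact: Pj.
  - rewrite coefC /= coefD coefC coefMX; case: i => [|[|i]] /=.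
    + by rewrite addr0.
    + by rewrite coefC add0r.
    + by rewrite coefC add0r; exact: Pi.
  - by rewrite coefC coef0; exact: Pj.
by rewrite rmorphD !rmorphM qut t0 !mulr0 addr0.
Qed.

(** The second factor of the torus scales t = u to 1; this multiplies mu by t. *)
Lemma fiber1_lift : exists p : coordX, \pi_VD q = \pi_VD (fiber1_coord I p).
Proof.
have t0 := fiber1_t_neq0.
have st i : exists2 a, line_deg Sg (unit_degree i) a & (ev q \o cst) a != 0.
  have [P DP P0] := semistable q ord0; exists (cox_at1 I P).
    by rewrite /line_deg (ord1 i) /unit_degree eqxx; exact: (cox_at1_deg DP).
  move: P0; rewrite (@ev_cox_at1 P 0%N)// ?expr0 ?mul1r// => i' j j0.
  by have := DP i' j; rewrite /unit_degree /= (negbTE j0).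
exists (Coord (D := line_deg Sg) (ev := ev q \o cst) (ev q t * mu q) st).
apply/esym/total_eqP; exists (fun i => if i == ord0 then 1 else ev q t); split.
- by move=> i; case: ifP => _; rewrite ?oner_neq0.
- move=> d P DP; rewrite (@ev_cox_at1 P (d ord_max))//; last first.
    by move=> i j jd; have := DP i j; rewrite (negbTE jd).
  rewrite /character !big_ord_recl big_ord0 /= expr1n mul1r mulr1.
  by rewrite (_ : lift ord0 ord0 = ord_max :> 'I_2)//; exact: val_inj.
- by rewrite !big_ord_recl big_ord0 /= mul1r mulr1 mulrA mulVf// mul1r.
Qed.

End Points.
End FiberOne.

(** * Invariant holomorphic functions on the deformation *)

Section PolynomialOnVD.
Context {R : realType} {S : comNzRingType} {Sg : grading S} {I : ideal S}.
Local Notation C := (Cx R).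
Context {N : nat} {s : 'I_N -> S}.
Hypothesis es : embedding_sections Sg s.
Local Notation coordX := (Defs.coord R (line_deg Sg)).
Local Notation coordD := (Defs.coord R (@defo_deg S I Sg)).
Local Notation VD := (VD Sg I).
Local Notation cst := (cox_cst I).
Local Notation t := (cox_t I).
Local Notation tpos := (tpos (s := s)).

(* the coordinates mu t s_i *)
Definition dpos (q : coordD) : 'I_N -> C := fun i => mu q * ev q t * ev q (cst (s i)).

Lemma dpos_fiber1 (p : coordX) : dpos (fiber1_coord I p) = tpos p.
Proof.
apply/funext => i; rewrite /dpos /tpos /pos.
rewrite (_ : ev (fiber1_coord I p) t = ev p (cox_at1 I t))// cox_at1_t.
rewrite (_ : ev (fiber1_coord I p) (cst (s i)) = ev p (cox_at1 I (cst (s i))))//.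
by rewrite cox_at1_cst rmorph1 mulr1.
Qed.

(** The action fixes mu, and also t and the constants s_i, which do not involve v. The coordinate u
    would be scaled by [l]. *)
Lemma dpos_transverse (l : C) p q : transverse l p q -> dpos q = dpos p.
Proof.
move=> [mpq epq]; apply/funext => i; rewrite /dpos mpq.
rewrite (epq 0%N) ?(epq 0%N (cst _)) ?expr0 ?mul1r// => k j k0.
  by rewrite /coef2 /= coefC; case: ifP; rewrite ?coef0// coefC (negbTE k0).
by rewrite /coef2 /= coefX; case: eqP => _; rewrite ?coef0// coef1 (negbTE k0).
Qed.

Definition elts_st (o : 'I_N.+1) : coxring I :=
  if unlift ord0 o is Some i then cst (s i) else t.

Definition degs_st (o : 'I_N.+1) : 'I_2 -> nat :=
  fun k => if unlift ord0 o is Some _ then (k == ord0 : nat) else (k == ord_max : nat).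

Definition monomials (z : 'rV[C]_N.+1 * C) : 'I_N -> C :=
  fun i => z.2 * z.1 ord0 ord0 * z.1 ord0 (lift ord0 i).

Lemma monomials_values q : monomials (values elts_st q) = dpos q.
Proof.
by apply/funext => i; rewrite /monomials /values /= !mxE /elts_st unlift_none liftK.
Qed.

Lemma monomials_torus (l : 'rV[C]_2) z : l ord0 ord0 != 0 -> l ord0 ord_max != 0 ->
  monomials (torus_act degs_st l z) = monomials z.
Proof.
move=> l0 l1; apply/funext => i; rewrite /monomials /torus_act /= !mxE.
rewrite /degs_st unlift_none liftK /character !big_ord_recl !big_ord0 /=.
rewrite (_ : lift ord0 ord0 = ord_max :> 'I_2); last exact: val_inj.
by rewrite !expr0 !expr1; field; rewrite l0 l1.
Qed.

Lemma dpos_same p q : \pi_VD p = \pi_VD q -> dpos p = dpos q.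
Proof.
move=> /total_eqP[l [l0 lD lm]]; apply/funext => i; rewrite /dpos lm.
rewrite (lD (fun k => k == ord_max : nat) t); last exact: defo_deg_t.
rewrite (lD (fun k => k == ord0 : nat) (cst (s i))); last first.
  by apply: defo_deg_cst => //; exact: emb_deg1 es i.
rewrite /character !big_ord_recl !big_ord0 /=.
have := l0 ord0; have := l0 (lift ord0 ord0).
move: (l ord0) (l (lift ord0 ord0)) => a b b0 a0.
by rewrite !expr0 !expr1; field; rewrite a0 b0.
Qed.

Lemma differentiable_poly (J : finType) (V : normedModType C) (f : J -> V -> C)
    (h : (J -> C) -> C) z : polyfun h -> (forall j, differentiable (f j) z) ->
  differentiable (fun z => h (fun j => f j z)) z.
Proof.
move=> ph fd; elim: ph => {h} [c|j|f1 g1 _ Hf _ Hg|f1 g1 _ Hf _ Hg].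
- exact: differentiable_cst.
- exact: fd.
- exact: differentiableD Hf Hg.
- exact: differentiableM Hf Hg.
Qed.

Lemma differentiable_snd (V W : normedModType C) (z : V * W) :
  differentiable (fun z : V * W => z.2) z.
Proof.
have c : continuous (snd : V * W -> W) by move=> x; exact: cvg_snd.
exact: (@linear_differentiable _ _ _ (snd : {linear (V * W)%type -> W}) z c).
Qed.

Lemma differentiable_fst_coord n (W : normedModType C) (z : 'rV[C]_n * W) i :
  differentiable (fun z : 'rV[C]_n * W => z.1 ord0 i) z.
Proof.
apply: (@differentiable_comp _ _ _ _ fst (fun v : 'rV[C]_n => v ord0 i)).
  have c : continuous (fst : 'rV[C]_n * W -> 'rV[C]_n) by move=> x; exact: cvg_fst.
  exact: (@linear_differentiable _ _ _ (fst : {linear ('rV[C]_n * W)%type -> 'rV[C]_n}) z c).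
exact: differentiable_coord.
Qed.

(** A single germ serves at all points; it is invariant because t s_i has degree (1, 1) and mu the
    opposite weight. *)
Lemma holomorphic_dpos (h : ('I_N -> C) -> C) : polyfun h ->
  holomorphic (fun z : VD => h (dpos (repr z))).
Proof.
move=> ph; pose g : germ := @Germ R (coxring I) 2 N.+1 elts_st degs_st (fun z => h (monomials z)).
have gE q : germ_value g q = h (dpos q) by rewrite /germ_value /= monomials_values.
exists (fun=> g) => q; split.
- split.
  + move=> o; rewrite /= /degs_st /elts_st; case: (unlift ord0 o) => [i|].
      by apply: defo_deg_cst => //; exact: emb_deg1 es i.
    exact: defo_deg_t.
  + apply: (@filterE _ (nbhs (values elts_st q))) => z.
    apply: (@differentiable_poly _ _ (fun i z => monomials z i)) => // i.
    apply: differentiableM; first apply: differentiableM.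
    * exact: differentiable_snd.
    * exact: differentiable_fst_coord.
    * exact: differentiable_fst_coord.
  + have l0 i : nbhs (const_mx 1 : 'rV[C]_2) [set l : 'rV[C]_2 | l ord0 i != 0].
      apply/nbhs_ballP; exists 1 => //= l [_ /(_ ord0 i)].
      rewrite mxE -ball_normE /= -[1 : C](rmorph1 RtoC) normc_lt => H.
      by apply/eqP => li; move: H; rewrite li subr0 modulus_RtoC normr1 ltxx.
    exists ([set l : 'rV[C]_2 | l ord0 ord0 != 0 /\ l ord0 ord_max != 0], setT).
      by split; [exact: filterI (l0 _) (l0 _)|exact: filterT].
    by move=> [l z] [[/= l00 l01] _]; rewrite monomials_torus.
- by rewrite gE; congr h; apply: dpos_same; rewrite reprK.
- apply: (@filterE _ (nbhs q)) => q'; exists N.+1, elts_st, id, id; split=> //.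
  exists 0%N, (fun=> 0), (fun=> fun=> 0); split=> [[]//|[]//|].
  by apply: (@filterE _ (nbhs (values elts_st q'))) => z; rewrite big_ord0 subrr.
Qed.

End PolynomialOnVD.

(** * Holomorphic hulls and the conclusion *)

Section HullSup.
Context {R : realType} {A : comNzRingType} {r : nat} {D : ('I_r -> nat) -> set A}.
Implicit Types (K : set (Defs.total R D)) (F : Defs.total R D -> Cx R).

Lemma sub_hull K : K `<=` hull K.
Proof. by move=> z Kz F _; apply: ereal_sup_ubound; exists z. Qed.

Lemma hull_le K F M z : holomorphic F -> (forall w, K w -> modulus (F w) <= M) ->
  hull K z -> modulus (F z) <= M.
Proof.
move=> holF KM /(_ _ holF) H; rewrite -lee_fin; apply: le_trans H _.
by apply: ge_ereal_sup => _ [w Kw <-]; rewrite lee_fin KM.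
Qed.

Lemma hull_of K z : K !=set0 -> (forall F M, holomorphic F -> 0 <= M ->
    (forall w, K w -> modulus (F w) <= M) -> modulus (F z) <= M) -> hull K z.
Proof.
move=> [w0 Kw0] H F holF; set sup := ereal_sup _.
have ub w : K w -> ((modulus (F w))%:E <= sup)%E.
  by move=> Kw; apply: ereal_sup_ubound; exists w.
case: sup ub => [M| |] ub; last 2 first.
- exact: leey.
- by have := ub _ Kw0; rewrite leNgt ltNyr.
have FM w : K w -> modulus (F w) <= M by move=> /ub; rewrite lee_fin.
by rewrite lee_fin; apply: H => //; apply: le_trans (FM _ Kw0); exact: modulus_ge0.
Qed.

End HullSup.

Theorem proposition6p2 (R : realType)
    (S : comNzRingType) (Sg : grading S) (I : ideal S) (T : set (VX R Sg)) :
  very_ample_section_ring Sg ->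
  tube T -> semipositive T ->
  hyperplane_section Sg I ->
  deformation_tube I T `&` fiber1 = fiber1_emb @` T.
Proof.
move=> [N [s es]] tT hullT hI.
have T0 := tube_zero tT.
have [b b0 Tb] := cone_bounded es (tube_compact tT).
apply/seteqP; split=> [z [zT [q qut zq]]|_ [z Tz <-]]; last first.
  split.
    apply: sub_hull; right.
    exists 1, (fiber1_coord I (repr z)), (fiber1_coord I (repr z)).
    split=> //; first by rewrite modulus1.
      by exists z.
    by split=> // i P _; rewrite expr1n mul1r.
  exists (fiber1_coord I (repr z)) => //.
  rewrite (_ : ev _ _ = ev (repr z) (cox_at1 I (cox_u I)))//.
  rewrite (_ : ev _ (cox_t I) = ev (repr z) (cox_at1 I (cox_t I)))//.
  by rewrite cox_at1_u cox_at1_t.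
have [p qp] := fiber1_lift hI qut.
have zp : z = fiber1_emb (\pi_(VX R Sg) p) by rewrite fiber1_embE zq.
exists (\pi_(VX R Sg) p); last by rewrite zp.
(* By semipositivity, membership in [T] is tested on the holomorphic functions on V_X(L). *)
rewrite -hullT; apply: hull_of => [|F M holF M0 FM].
  have [i pi] := pos_neq0 es p.
  have [p0 [_ p00]] := coord_relations es (i := i) 0 (relations_pos es p 1)
    (mulf_neq0 (oner_neq0 _) pi).
  by exists (\pi_(VX R Sg) p0); apply: T0; exists p0.
(* It remains to see that [tpos p] is in the polynomial hull of the cone of [T]. A polynomial [h]
   extends to the function h(dpos) on the deformation: on the orbit of [T] it has the values of [h]
   on the cone, and on the zero section the value h(0), which the zero section inside [T] also
   gives. *)
apply: (hull_bound es T0 b0 Tb holF M0 FM) => h M' ph M'0 hM'.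
have zero_cone : cone (s := s) T (fun=> 0).
  have [i pi] := pos_neq0 es p.
  have [p0 [_ p00]] := coord_relations es (i := i) 0 (relations_pos es p 1)
    (mulf_neq0 (oner_neq0 _) pi).
  exists p0; first by apply: T0; exists p0.
  by apply/funext => i'; rewrite /tpos p00 mul0r.
have := hull_le (M := M') (holomorphic_dpos es ph) _ zT.
rewrite zq qp (dpos_same es (q := fiber1_coord I p)) ?reprK// dpos_fiber1; apply.
move=> w [[w0 w00 ->]|[l [p1 [p2 [l1 [t Tt tp1] p12 ->]]]]].
  rewrite (dpos_same es (q := w0)) ?reprK//.
  rewrite (_ : dpos w0 = fun=> 0); first exact: hM'.
  by apply/funext => i; rewrite /dpos w00 !mul0r.
rewrite (dpos_same es (q := p2)) ?reprK// (dpos_transverse p12).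
rewrite (dpos_same es (q := fiber1_coord I (repr t))) ?dpos_fiber1//.
by apply: hM'; exists (repr t) => //; rewrite reprK.
Qed.
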